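(* Let $P_0=N(0,1)$, let $\varepsilon_n=n^{-\beta}$ with $\beta\in(1/2,1]$, and let $\widetilde h_n$ be as in the context. Let $\mathrm{Leb}$ denote Lebesgue measure. Suppose that there is some $\beta^*\in\mathbb{R}$ such that for every $\delta>0$ $$\liminf_{n\to\infty}\mathrm{Leb}\Bigl(x\in\mathbb{R}:\ \beta^*-\delta-\tfrac12\le\frac{\widetilde h_n(x)}{\log n}-x^2+\frac{\min\{x^2,1\}}{2}\Bigr)>0$$ and there is $N_{1,\delta}\in\mathbb{N}$ such that for all $n\ge N_{1,\delta}$ $$\mathrm{Leb}\Bigl(x\in\mathbb{R}:\ \beta^*+\delta-\tfrac12\le\frac{\widetilde h_n(x)}{\log n}-x^2+\frac{\min\{x^2,1\}}{2}\Bigr)=0.$$ Let $(\lambda_n)_{n\in\mathbb{N}}$ be a sequence in $(0,\infty)$ with $\lambda_n\to0$ and $\lambda_nn^\kappa\to\infty$ for all $\kappa>0$. Suppose that for some $M\ge1$ at least one of the following holds: (A) there is a function $\alpha:\mathbb{R}\to\mathbb{R}$ with $\displaystyle\lim_{n\to\infty}\sup_{|x|\ge M}\Bigl|\frac{\widetilde h_n(x)}{\log n}-\alpha(x)\Bigr|=0$; (B) for every $\delta>0$ there exists $N_{2,\delta}\in\mathbb{N}$ such that for all $n\ge N_{2,\delta}$ $$\mathrm{Leb}\Bigl(|x|\ge M:\ \beta^*+\delta-1\le\frac{\widetilde h_n(x)}{\log n}-\Bigl(1-\frac{\lambda_n}{\log n}\Bigr)x^2\Bigr)=0.$$ Then the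 detection threshold satisfies $\beta^{\#}=\beta^*$, that is: if $\beta>\beta^*$ then no sequence of tests can distinguish between $\mathcal H_{0,n}$ and $\mathcal H_{1,n}$ asymptotically, and if $\beta<\beta^*$ then there is a sequence of likelihood ratio tests which completely separates $\mathcal H_{0,n}$ and $\mathcal H_{1,n}$ asymptotically. Moreover, if $\beta<\beta^{\#}$ then for every $s\in\mathbb{R}$ there is a sequence $(c_n(s))_{n\in\mathbb{N}}$ of critical values such that $\varphi_n=\mathbf{1}\{S_n(s)>c_n(s)\}$ completely separates $\mathcal H_{0,n}$ and $\mathcal H_{1,n}$ asymptotically.
   Context: Setting: the noise distribution is $P_0=N(0,1)$ with distribution function $F_0$; $(\mu_n)$ is a fixed sequence of (signal) probability distributions on $\mathbb{R}$ with $\mu_n\ll P_0$; $Q_n=(1-\varepsilon_n)P_0+\varepsilon_n\mu_n$. $\mathcal H_{0,n}$: $X_{n,1},\ldots,X_{n,n}$ are i.i.d. $\sim P_0$; $\mathcal H_{1,n}$: $X_{n,1},\ldots,X_{n,n}$ are i.i.d. $\sim Q_n$. $P_0^n,Q_n^n$ are the $n$-fold product measures. For $x\in\mathbb{R}$ (with $\log 0=-\infty$) let $$\widetilde h_n(x)=\log\Bigl(\frac{d\mu_n}{dP_0}\bigl(x\sqrt{2\log(n)}\bigr)\Bigr).$$ A sequence of tests $\varphi_n$ (measurable functions of the sample with values in $[0,1]$) has sum of type 1 and type 2 error probabilities $E_{P_0^n}(\varphi_n)+E_{Q_n^n}(1-\varphi_n)$. It completely separates $\mathcal H_{0,n}$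 and $\mathcal H_{1,n}$ asymptotically if this sum tends to $0$; it cannot distinguish between them asymptotically if this sum tends to $1$. A likelihood ratio test is a test rejecting for large values of $dQ_n^n/dP_0^n$. The detection threshold $\beta^{\#}$ is the value such that for $\beta>\beta^{\#}$ no sequence of tests can distinguish $\mathcal H_{0,n}$ and $\mathcal H_{1,n}$ asymptotically, and for $\beta<\beta^{\#}$ some sequence of likelihood ratio tests completely separates them asymptotically. For $s\in\mathbb{R}$ define $\phi_s:[0,\infty)\to\mathbb{R}\cup\{\infty\}$ by $\phi_0(x)=x-\log(x)-1$, $\phi_1(x)=x(\log(x)-1)+1$, and $\phi_s(x)=\dfrac{1-s+sx-x^s}{s(1-s)}$ for $s\neq0,1$. For $u,v\in(0,1)$ put $K_s(u,v)=v\,\phi_s(u/v)+(1-v)\,\phi_s((1-u)/(1-v))$. Let $\mathbb{F}_n(x)=n^{-1}\sum_{i=1}^n\mathbf{1}\{X_{n,i}\le x\}$ and let $X_{1:n}\le\ldots\le X_{n:n}$ be the order statistics. The test statistic is $S_n(s)=\sup_{X_{1:n}\le x<X_{n:n}}K_s(\mathbb{F}_n(x),F_0(x))$. *)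

(* Defs.v *)
From HB Require Import structures.
From mathcomp Require Import all_boot all_order all_algebra.
From mathcomp Require Import all_classical all_reals all_analysis.
From mathcomp Require Import measurable_realfun.
Set Implicit Arguments.
Unset Strict Implicit.
Unset Printing Implicit Defensive.
Import Order.TTheory GRing.Theory Num.Theory.
Import numFieldNormedType.Exports.
Local Open Scope classical_set_scope.
Local Open Scope ring_scope.

Section product_power.
Context d (T : measurableType d) (R : realType).

Definition tuple_cons n (xt : T * n.-tuple T) : n.+1.-tuple T :=
  [tuple of xt.1 :: xt.2].

Lemma measurable_tuple_cons n : measurable_fun setT (@tuple_cons n).
Proof. exact: measurable_cons. Qed.

HB.instance Definition _ n :=
  isMeasurableFun.Build _ _ _ _ (@tuple_cons n) (@measurable_tuple_cons n).

(* P^n as a probability on n.-tuple T; the library only has binary products. *)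
Fixpoint power_prob (P : probability T R) n : probability (n.-tuple T) R :=
  if n is m.+1 then
    distribution (P \x power_prob P m)%E (@tuple_cons m)
  else \d_([tuple] : 0.-tuple T).

End product_power.

Section mixture.
Context d (T : measurableType d) (R : realType).
Variables (e : R) (P mu : probability T R).

(* Outside 0 <= e <= 1 the value P is a dummy that keeps [mixture] total. *)
Definition mixture (A : set T) : \bar R :=
  if 0 <= e <= 1 then ((1 - e)%:E * P A + e%:E * mu A)%E else P A.

Let mixture0 : mixture set0 = 0%E.
Proof. by rewrite /mixture !measure0 !mule0 adde0 if_same. Qed.

Let mixture_ge0 A : (0 <= mixture A)%E.
Proof.
rewrite /mixture; case: ifPn => // /andP[e0 e1].
by rewrite adde_ge0// mule_ge0// lee_fin subr_ge0.
Qed.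

Let mixture_sigma_additive : semi_sigma_additive mixture.
Proof.
rewrite /mixture; have [/andP[e0 e1]|_] := boolP (0 <= e <= 1);
  last first.
  exact: measure_semi_sigma_additive.
have e1' : 0 <= 1 - e by rewrite subr_ge0.
have : semi_sigma_additive
    (measure_add (mscale (NngNum e1') P) (mscale (NngNum e0) mu)).
  exact: measure_semi_sigma_additive.
have -> // : (measure_add (mscale (NngNum e1') P) (mscale (NngNum e0) mu)
  : set T -> \bar R) = (fun A => (1 - e)%:E * P A + e%:E * mu A)%E.
by apply/funext => A; rewrite measure_addE.
Qed.

HB.instance Definition _ := isMeasure.Build _ _ _ mixture
  mixture0 mixture_ge0 mixture_sigma_additive.

Let mixture_setT : mixture setT = 1%E.
Proof.
rewrite /mixture !probability_setT; case: ifP => // _.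
by rewrite !mule1 -EFinD subrK.
Qed.

HB.instance Definition _ :=
  Measure_isProbability.Build _ _ _ mixture mixture_setT.

End mixture.

(* f is a version of the Radon-Nikodym density of nu with respect to P. *)
Definition is_density d (T : measurableType d) (R : realType)
    (P nu : probability T R) (f : T -> \bar R) :=
  [/\ measurable_fun setT f, forall x, (0 <= f x)%E &
      forall A, measurable A -> nu A = (\int[P]_(x in A) f x)%E].

Section tests.
Context d (T : measurableType d) (R : realType).
Implicit Types (P Q : probability T R) (n : nat).

Definition is_test n (phi : n.-tuple T -> R) :=
  measurable_fun setT phi /\ forall t, 0 <= phi t <= 1.

Definition error_sum P Q n (phi : n.-tuple T -> R) : \bar R :=
  ('E_(power_prob P n)[phi] + 'E_(power_prob Q n)[fun t => (1 - phi t)%R])%E.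

Definition completely_separates P (Q : nat -> probability T R)
    (phi : forall n, n.-tuple T -> R) :=
  (forall n, is_test (phi n)) /\
  error_sum P (Q n) (phi n) @[n --> \oo] --> 0%E.

Definition cannot_distinguish P (Q : nat -> probability T R)
    (phi : forall n, n.-tuple T -> R) :=
  error_sum P (Q n) (phi n) @[n --> \oo] --> 1%E.

Definition is_lr_test P Q n (phi : n.-tuple T -> R) :=
  exists (L : n.-tuple T -> \bar R) (c : R),
    is_density (power_prob P n) (power_prob Q n) L /\
    phi = \1_[set t | (c%:E < L t)%E].

End tests.

Section sparse_mixture.
Context (R : realType).
Local Notation RT := (measurableTypeR R).

Definition P0 : probability RT R := normal_prob (0 : R) 1.

Definition F0 (x : R) : R := fine (P0 `]-oo, x]%classic).

Definition alternative (mu : nat -> probability RT R) (beta : R) (n : nat) :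
    probability RT R :=
  mixture (n%:R `^ (- beta)) P0 (mu n).

Definition h_tilde (f : nat -> R -> \bar R) (n : nat) (x : R) : \bar R :=
  lne (f n (x * Num.sqrt (2 * ln n%:R))).

Definition detection_threshold (mu : nat -> probability RT R) (bs : R) :=
  forall beta : R, 2^-1 < beta <= 1 ->
    (bs < beta -> forall phi : (forall n, n.-tuple RT -> R),
       (forall n, is_test (phi n)) ->
       cannot_distinguish P0 (alternative mu beta) phi) /\
    (beta < bs -> exists phi : (forall n, n.-tuple RT -> R),
       (forall n, is_lr_test P0 (alternative mu beta n) (phi n)) /\
       completely_separates P0 (alternative mu beta) phi).

(* For s <= 0, phi_s(0) = +oo; the convention ln 0 = 0 yields phi_1(0) = 1. *)
Definition phi_div (s x : R) : \bar R :=
  if (x == 0) && (s <= 0) then +oo%E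
  else if s == 0 then (x - ln x - 1)%:E
  else if s == 1 then (x * (ln x - 1) + 1)%:E
  else ((1 - s + s * x - x `^ s) / (s * (1 - s)))%:E.

Definition K_div (s u v : R) : \bar R :=
  (v%:E * phi_div s (u / v) + (1 - v)%:E * phi_div s ((1 - u) / (1 - v)))%E.

Definition empirical_cdf n (X : n.-tuple RT) (x : R) : R :=
  (\sum_(i < n) ((tnth X i : R) <= x)%R%:R) / n%:R.

(* k-th order statistic, for 1 <= k <= n *)
Definition order_stat n (X : n.-tuple RT) (k : nat) : R :=
  nth 0 (sort <=%R (X : seq R)) k.-1.

Definition S_stat (s : R) n (X : n.-tuple RT) : \bar R :=
  ereal_sup [set K_div s (empirical_cdf X x) (F0 x) |
    x in [set x : R | order_stat X 1 <= x < order_stat X n]].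

End sparse_mixture.

(* Main.v *)
Require Import Defs.
From HB Require Import structures.
From mathcomp Require Import all_boot all_order all_algebra.
From mathcomp Require Import all_classical all_reals all_analysis.
From mathcomp Require Import measurable_realfun.
From mathcomp Require Import ring lra.
Import Order.TTheory GRing.Theory Num.Theory.
Import numFieldNormedType.Exports.
Set Implicit Arguments.
Unset Strict Implicit.
Unset Printing Implicit Defensive.
Local Open Scope classical_set_scope.
Local Open Scope ring_scope.

(** The testing problem is governed by the one-dimensional distance between P0
    and Q_n = (1 - n^(- beta)) P0 + n^(- beta) mu_n.  In the coordinate
    x = y / sqrt (2 ln n), the density of P0 is n^(- x^2) and the one of mu_n is
    n^(h(x) - x^2), where h is the normalised log-likelihood ratio, up to factors
    sqrt (ln n); all estimates are thus about exponents of n, and a strict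
    inequality between exponents absorbs constants and powers of ln n.

    Above the threshold ([no_separation]).  By [error_sum_near1] it suffices that
    n times the squared Hellinger distance between P0 and Q_n tends to 0.  This
    distance is an integral of (sqrt q - 1)^2 with q = dQ_n / dP0
    ([hellinger_le_regions]).  For |x| <= 1 it is bounded by a second moment of the
    density of mu_n, for |x| > 1 by the mass of mu_n; the essential upper bound on
    h(x) - x^2 + min(x^2, 1) / 2 is exactly what makes both small.  Only the
    integrability for large |x| needs an additional argument, which is either the
    comparison of all large indices with a fixed one ([far_integral_compare]) or
    the Gaussian factor exp(- lambda_n x^2) ([far_integral_le_decay]).

    Below the threshold.  The level sets of h(x) - x^2 + min(x^2, 1) / 2 have
    measure bounded away from 0.  Cutting the line into finitely many cells, one
    cell keeps a fixed part of the level set, and the half-line that starts at this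
    cell carries too much mass under Q_n: the excess is larger, by a power of n,
    than both 1 / n and the standard deviation of its empirical mass under P0
    ([level_sets_detectable]).  Hence n S_n(s) exceeds a power of n under Q_n
    ([S_stat_alt_prob]), because phi_s grows at least like
    min((x - 1)^2, x - 1) to the right of 1.  Under P0 the empirical and true
    tail masses have ratios bounded by small powers of n, which reduces K_s to the
    squared higher criticism score, and a Chernoff bound at n quantiles shows
    that n S_n(s) is at most an arbitrarily small power of n
    ([S_stat_null_prob]).  So S_n(s) separates with a critical value between the two
    ([S_test_separates]).  The likelihood ratio test with threshold 1 minimises the
    sum of the error probabilities ([lr_test_optimal]), hence it separates
    too. *)

(** * Densities and product probabilities *)

Section density.
Context d (T : measurableType d) (R : realType).
Variables (mu nu : {measure set T -> \bar R}) (g : T -> R).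
Hypotheses (mg : measurable_fun setT g) (g0 : forall x, 0 <= g x).
Hypothesis nuE : forall A, measurable A -> nu A = (\int[mu]_(x in A) (g x)%:E)%E.
Import HBNNSimple.
Local Open Scope ereal_scope.

(** The identity nu(A) = int_A g dmu is linear in the indicator of A, so it
    passes to simple functions, and then to f by monotone convergence. *)
Lemma ge0_integral_density (f : T -> \bar R) :
  measurable_fun setT f -> (forall x, 0 <= f x) ->
  \int[nu]_x f x = \int[mu]_x (f x * (g x)%:E).
Proof.
move=> mf f0.
pose h := nnsfun_approx measurableT mf.
have mh n r : measurable (h n @^-1` [set r]) by [].
have mge : measurable_fun setT (EFin \o g) by exact/measurable_EFinP.
have -> : \int[nu]_x f x = lim (\int[nu]_x (h n x)%:E @[n --> \oo]).
  have fE x : f x = lim ((h n x)%:E @[n --> \oo]).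
    by apply/esym/cvg_lim => //; exact: cvg_nnsfun_approx.
  under eq_integral => x _ do rewrite fE.
  apply: monotone_convergence => //.
  - by move=> n; exact/measurable_EFinP/measurable_funP.
  - by move=> n x _; rewrite lee_fin.
  - by move=> x _ a b ab; rewrite lee_fin; exact/lefP/nd_nnsfun_approx.
have -> : \int[mu]_x (f x * (g x)%:E) =
    lim (\int[mu]_x ((h n x)%:E * (g x)%:E) @[n --> \oo]).
  have fg x : f x * (g x)%:E = lim (((h n x)%:E * (g x)%:E) @[n --> \oo]).
    apply/esym/cvg_lim => //; apply: cvgeZr; first by [].
    by apply: cvg_nnsfun_approx => //.
  under eq_integral => x _ do rewrite fg.
  apply: monotone_convergence => //.
  - move=> n; apply: emeasurable_funM => //.
    exact/measurable_EFinP/measurable_funP.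
  - by move=> n x _; rewrite mule_ge0 ?lee_fin.
  - move=> x _ a b ab; rewrite lee_wpmul2r ?lee_fin//.
    exact/lefP/nd_nnsfun_approx.
suff suf n : \int[nu]_x (h n x)%:E = \int[mu]_x ((h n x)%:E * (g x)%:E).
  by under eq_fun do rewrite suf.
transitivity (\int[nu]_x
   (\sum_(y \in range (h n)) (y * \1_(h n @^-1` [set y]) x)%:E)).
  by apply: eq_integral => t _; rewrite /= fimfunE -fsumEFin.
have indich r : measurable_fun setT (fun x => (r * \1_(h n @^-1` [set r]) x)%:E).
  exact/measurable_EFinP/measurable_funM.
rewrite ge0_integral_fsum//; last by move=> m y Ey; exact: nnfun_muleindic_ge0.
transitivity (\int[mu]_x (\sum_(y \in range (h n))
    (y * \1_(h n @^-1` [set y]) x)%:E * (g x)%:E)); last first.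
  apply: eq_integral => x _.
  rewrite -ge0_mule_fsuml => [|y]; last exact: nnfun_muleindic_ge0.
  by rewrite fsumEFin // -(fimfunE _ x).
rewrite ge0_integral_fsum//; last 2 first.
  - by move=> y; apply: emeasurable_funM.
  - move=> m y Ey; apply: mule_ge0; last by rewrite lee_fin.
    exact: nnfun_muleindic_ge0.
apply: eq_fsbigr => r rhn.
under eq_integral do rewrite EFinM.
rewrite integralZl_indic_nnsfun => //.
under [RHS]eq_integral do rewrite EFinM -muleA.
rewrite ge0_integralZl//.
- under [in RHS]eq_integral do rewrite muleC.
  rewrite [in RHS](eq_integral ((EFin \o g) \_ (h n @^-1` [set r]))); last first.
    move=> x xE; by rewrite epatch_indic.
  by rewrite -integral_mkcond -nuE// integral_indic// setIT.
- by apply: emeasurable_funM => //; exact/measurable_EFinP.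
- by move=> t Et; rewrite mule_ge0 ?lee_fin.
- by move: rhn; rewrite inE => -[t _ <-]; rewrite lee_fin.
Qed.

End density.

Section power.
Context d (T : measurableType d) (R : realType).
Implicit Types P Q : probability T R.
Local Open Scope ereal_scope.

Lemma measurable_prod_tuple n (g : T -> R) : measurable_fun setT g ->
  measurable_fun setT (fun t : n.-tuple T => \prod_(x <- t) g x)%R.
Proof.
move=> mg.
have -> : (fun t : n.-tuple T => \prod_(x <- t) g x)%R =
  (fun t => \prod_(i <- index_enum 'I_n) g (tnth t i))%R.
  by apply/funext => t; rewrite big_tuple.
apply: measurable_prod => i _; apply: measurableT_comp => //.
exact: measurable_tnth.
Qed.

Lemma integral_power0 P (F : 0.-tuple T -> \bar R) :
  measurable_fun setT F -> \int[power_prob P 0]_t F t = F [tuple].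
Proof. by move=> mF; rewrite integral_dirac// diracT mul1e. Qed.

Lemma integral_powerS P n (F : n.+1.-tuple T -> \bar R) :
  measurable_fun setT F -> (forall t, 0 <= F t) ->
  \int[power_prob P n.+1]_t F t =
  \int[P]_x \int[power_prob P n]_t F (tuple_cons (x, t)).
Proof.
move=> mF F0; rewrite [LHS]ge0_integral_distribution//.
rewrite fubini_tonelli1//; last by move=> x; exact: F0.
by apply: measurableT_comp => //; exact: measurable_tuple_cons.
Qed.

Lemma integral_power_prod P n (g : T -> R) :
  measurable_fun setT g -> (forall x, 0 <= g x)%R ->
  \int[power_prob P n]_t (\prod_(x <- t) g x)%:E = (\int[P]_x (g x)%:E) ^+ n.
Proof.
move=> mg g0.
have i0 : 0 <= \int[P]_x (g x)%:E.
  by apply: integral_ge0 => x _; rewrite lee_fin.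
have pr0 m (t : m.-tuple T) : (0 <= \prod_(x <- t) g x)%R by apply: prodr_ge0 => x _.
elim: n => [|n ih].
  rewrite integral_power0; last by apply/measurable_EFinP; apply: measurable_prod_tuple.
  by rewrite big_nil expe0.
rewrite integral_powerS; first last.
- by move=> t; rewrite lee_fin.
- by apply/measurable_EFinP; apply: measurable_prod_tuple.
have {}ih x : \int[power_prob P n]_t (\prod_(x <- tuple_cons (x, t)) g x)%:E =
    (g x)%:E * (\int[P]_x (g x)%:E) ^+ n.
  rewrite -ih -ge0_integralZl//=.
  - by apply: eq_integral => t _; rewrite big_cons EFinM.
  - by apply/measurable_EFinP; apply: measurable_prod_tuple.
  - by move=> t _; rewrite lee_fin.
  - by rewrite lee_fin.
transitivity (\int[P]_x ((g x)%:E * (\int[P]_x (g x)%:E) ^+ n)).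
  by apply: eq_integral => x _; exact: ih.
rewrite ge0_integralZr//; last 3 first.
- exact/measurable_EFinP.
- by move=> x _; rewrite lee_fin.
- by rewrite expe_ge0.
by rewrite expeS.
Qed.

(** Peel off the first coordinate: by Tonelli the inner integral over the last
    n coordinates is handled by induction, and the outer one is a change of
    density from Q to P. *)
Lemma power_density P Q (q : T -> R) n :
  measurable_fun setT q -> (forall x, 0 <= q x)%R ->
  (forall A, measurable A -> Q A = \int[P]_(x in A) (q x)%:E) ->
  forall A, measurable A ->
  power_prob Q n A = \int[power_prob P n]_(t in A) (\prod_(x <- t) q x)%:E.
Proof.
move=> mq q0 QE.
have pr0 m (t : m.-tuple T) : (0 <= \prod_(x <- t) q x)%R by apply: prodr_ge0 => x _.
have mpr m : measurable_fun setT (fun t : m.-tuple T => (\prod_(x <- t) q x)%:E).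
  by apply/measurable_EFinP; apply: measurable_prod_tuple.
elim: n => [|n ih] A mA.
  rewrite integral_mkcond integral_power0; last first.
    by apply/(measurable_restrictT _ mA); apply: measurable_funTS; exact: mpr.
  rewrite [LHS]diracE /= patchE.
  by case: ifPn => // _; rewrite big_nil.
rewrite integral_mkcond.
have -> : power_prob Q n.+1 A = \int[power_prob Q n.+1]_t (\1_A t)%:E.
  by rewrite integral_indic// setIT.
rewrite integral_powerS//; last exact/measurable_EFinP.
rewrite integral_powerS; last 2 first.
- by apply/(measurable_restrictT _ mA); apply: measurable_funTS; exact: mpr.
- by move=> t; apply: erestrict_ge0 => s _; rewrite lee_fin.
have mcons x : measurable_fun setT (fun t : n.-tuple T => tuple_cons (x, t)).
  apply: (@measurableT_comp _ _ _ _ _ _ (@tuple_cons _ T n) _ (pair x)).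
    exact: measurable_tuple_cons.
  exact: pair1_measurable.
have step x : \int[power_prob Q n]_t (\1_A (tuple_cons (x, t)))%:E =
   \int[power_prob P n]_t ((\1_A (tuple_cons (x, t)))%:E * (\prod_(y <- t) q y)%:E).
  apply: ge0_integral_density => //.
  - by apply: measurable_prod_tuple.
  - by apply/measurable_EFinP; apply: (measurableT_comp _ (mcons x)).
transitivity (\int[Q]_x \int[power_prob P n]_t
    ((\1_A (tuple_cons (x, t)))%:E * (\prod_(y <- t) q y)%:E)).
  by apply: eq_integral => x _; exact: step.
rewrite (ge0_integral_density mq q0 QE); first last.
- move=> x; apply: integral_ge0 => t _.
  by rewrite mule_ge0// lee_fin.
- pose G (z : T * n.-tuple T) := (\1_A (tuple_cons z))%:E * (\prod_(y <- z.2) q y)%:E.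
  apply: (measurable_fun_fubini_tonelli_F G) => //; last first.
    by move=> z; rewrite mule_ge0// lee_fin.
  apply: emeasurable_funM.
    apply/measurable_EFinP.
    apply: (@measurableT_comp _ _ _ _ _ _ (\1_A : _ -> R) _ (@tuple_cons _ T n)).
      exact: measurable_indic.
    exact: measurable_tuple_cons.
  apply/measurable_EFinP.
  apply: (@measurableT_comp _ _ _ _ _ _
    (fun t : n.-tuple T => \prod_(y <- t) q y)%R _ snd) => //.
  exact: measurable_prod_tuple.
apply: eq_integral => x _.
rewrite -ge0_integralZr//; last 3 first.
- apply: emeasurable_funM; last exact: mpr.
  apply/measurable_EFinP.
  by apply: (@measurableT_comp _ _ _ _ _ _ (\1_A : _ -> R) _ _ _ (mcons x)).
- by move=> t _; rewrite mule_ge0// lee_fin.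
- by rewrite lee_fin.
apply: eq_integral => t _; rewrite patchE /=.
rewrite indicE; case: (tuple_cons (x, t) \in A); last by rewrite !mul0e.
by rewrite mul1e big_cons muleC EFinM.
Qed.

End power.

(** * Likelihood ratio tests and the Hellinger distance *)

Lemma measurable_sqrt (R : realType) : measurable_fun setT (@Num.sqrt R).
Proof. by apply: continuous_measurable_fun; exact: sqrt_continuous. Qed.

Section power_tests.
Context d (T : measurableType d) (R : realType).
Variables (P Q : probability T R) (q : T -> R) (n : nat).
Hypotheses (mq : measurable_fun setT q) (q0 : forall x, 0 <= q x).
Hypothesis QE : forall A, measurable A -> Q A = (\int[P]_(x in A) (q x)%:E)%E.
Local Open Scope ereal_scope.

Let L (t : n.-tuple T) : R := (\prod_(x <- t) q x)%R.
Let Pn := power_prob P n.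
Let Qn := power_prob Q n.

Let mL : measurable_fun setT L.
Proof. exact: measurable_prod_tuple. Qed.

Let L0 t : (0 <= L t)%R.
Proof. by apply: prodr_ge0 => x _. Qed.

Let QnE A : measurable A -> Qn A = \int[Pn]_(t in A) (L t)%:E.
Proof. exact: power_density. Qed.

Let integral_L : \int[Pn]_t (L t)%:E = 1.
Proof. by rewrite -QnE// probability_setT. Qed.

(** Both error probabilities become integrals under P^n once Q^n is replaced by
    its density L; the optimality and the triviality of tests can then be read
    off pointwise from the integrand phi + (1 - phi) L. *)
Lemma error_sumE (phi : n.-tuple T -> R) : is_test phi ->
  error_sum P Q phi = \int[Pn]_t (phi t + (1 - phi t) * L t)%:E.
Proof.
case=> mphi phi01.
have phi0 t : (0 <= phi t)%R by case/andP: (phi01 t).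
have phi1 t : (0 <= 1 - phi t)%R by rewrite subr_ge0; case/andP: (phi01 t).
have m1phi : measurable_fun setT (fun t => 1 - phi t)%R.
  by apply: measurable_funB.
rewrite /error_sum !unlock -/Pn -/Qn.
rewrite (ge0_integral_density mL L0 QnE); last 2 first.
- exact/measurable_EFinP.
- by move=> t; rewrite lee_fin.
rewrite -ge0_integralD//; last 4 first.
- by move=> t _; rewrite lee_fin.
- exact/measurable_EFinP.
- by move=> t _; rewrite mule_ge0 ?lee_fin.
- by apply/measurable_EFinP; exact: measurable_funM.
Qed.

Let psi : n.-tuple T -> R := \1_[set t | 1 < (L t)%:E].

Let measurable_reject : measurable [set t : n.-tuple T | 1 < (L t)%:E].
Proof.
rewrite -[X in measurable X]setTI.
have -> : [set t : n.-tuple T | 1 < (L t)%:E] = L @^-1` `]1%R, +oo[.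
  by apply/seteqP; split => t /=; rewrite lte_fin in_itv/= andbT.
exact: mL.
Qed.

Lemma is_lr_test_prod : is_lr_test P Q psi.
Proof.
exists (fun t => (L t)%:E), 1%R; split => //; split.
- exact/measurable_EFinP.
- by move=> t; rewrite lee_fin.
- exact: QnE.
Qed.

Lemma is_test_indic (A : set (n.-tuple T)) : measurable A ->
  is_test (\1_A : n.-tuple T -> R).
Proof.
move=> mA; split; first exact: measurable_indic.
by move=> t; rewrite indicE; case: (t \in A); rewrite ?lexx ?ler01.
Qed.

Lemma is_test_lr : is_test psi.
Proof. by apply: is_test_indic; exact: measurable_reject. Qed.

(** Neyman-Pearson for the unweighted error sum: phi + (1 - phi) L is a convex
    combination of 1 and L, hence at least min(1, L), and rejecting for L > 1
    attains this minimum. *)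
Lemma lr_test_optimal (phi : n.-tuple T -> R) : is_test phi ->
  error_sum P Q psi <= error_sum P Q phi.
Proof.
move=> tphi; rewrite !error_sumE//; last exact: is_test_indic.
have [mphi phi01] := tphi.
have m (f : n.-tuple T -> R) : measurable_fun setT f ->
    measurable_fun setT (fun t => f t + (1 - f t) * L t)%R.
  move=> mf; apply: measurable_funD => //; apply: measurable_funM => //.
  exact: measurable_funB.
have pos t : forall a : R, (0 <= a <= 1)%R -> (0 <= a + (1 - a) * L t)%R.
  move=> a /andP[a0 a1]; rewrite addr_ge0// mulr_ge0// subr_ge0//.
apply: ge0_le_integral => //.
- by move=> t _; rewrite lee_fin pos// /psi indicE; case: (_ \in _); rewrite ?lexx ?ler01.
- apply/measurable_EFinP; apply: m; exact: measurable_indic.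
- apply/measurable_EFinP; exact: m.
move=> t _; rewrite lee_fin.
have /andP[p0 p1] := phi01 t.
rewrite /psi indicE; have [h|h] := ltP 1%R (L t).
  rewrite mem_set/= ?lte_fin// subrr mul0r addr0.
  by have := ltW h; nra.
rewrite memNset/= ?lte_fin; last by move/(le_lt_trans h); rewrite ltxx.
rewrite subr0 mul1r add0r.
by nra.
Qed.

(** H bounds the squared Hellinger distance of one observation; the
    affinities multiply over the n coordinates. *)
Variable H : R.
Hypothesis hellinger_le : \int[P]_x ((Num.sqrt (q x) - 1) ^+ 2)%:E <= H%:E.

Let msq : measurable_fun setT (fun x => Num.sqrt (q x)).
Proof. by apply: measurableT_comp => //; exact: measurable_sqrt. Qed.

Let intsq := \int[P]_x (Num.sqrt (q x))%:E.

Let int_q1 : \int[P]_x (q x + 1)%:E = 2.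
Proof.
under eq_integral do rewrite EFinD.
rewrite ge0_integralD//; last 2 first.
- by move=> x _; rewrite lee_fin.
- exact/measurable_EFinP.
rewrite -QE// probability_setT integral_cst//= probability_setT mule1.
by rewrite -EFinD.
Qed.

Let affinity_ge : 2 <= 2 * intsq + H%:E.
Proof.
rewrite -[X in X <= _]int_q1.
have -> : \int[P]_x (q x + 1)%:E =
   \int[P]_x (2%:E * (Num.sqrt (q x))%:E + ((Num.sqrt (q x) - 1) ^+ 2)%:E).
  apply: eq_integral => x _; rewrite -EFinM -EFinD; congr EFin.
  rewrite -{1}(sqr_sqrtr (q0 x)); ring.
rewrite ge0_integralD//; last 3 first.
- by apply: emeasurable_funM => //; exact/measurable_EFinP.
- by move=> x _; rewrite lee_fin sqr_ge0.
- by apply/measurable_EFinP/measurable_funX/measurable_funB.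
rewrite ge0_integralZl//; last exact/measurable_EFinP.
by rewrite leeD2l.
Qed.

Let sqrt_prod (s : seq T) :
  Num.sqrt (\prod_(x <- s) q x)%R = (\prod_(x <- s) Num.sqrt (q x))%R.
Proof.
elim: s => [|x s ih]; first by rewrite !big_nil sqrtr1.
by rewrite !big_cons sqrtrM// ih.
Qed.

Lemma bernoulli_ineq (x : R) (m : nat) : (0 <= x)%R -> (1 + m%:R * (x - 1) <= x ^+ m)%R.
Proof.
move=> x0; elim: m => [|m ih]; first by rewrite mul0r addr0 expr0.
rewrite exprS -natr1.
have : (x * (1 + m%:R * (x - 1)) <= x * x ^+ m)%R by rewrite ler_wpM2l.
have m0 : (0 <= m%:R :> R)%R by [].
apply: le_trans.
have -> : (x * (1 + m%:R * (x - 1)) = 1 + (m%:R + 1) * (x - 1) + m%:R * (x - 1) ^+ 2)%R by ring.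
by rewrite lerDl mulr_ge0// sqr_ge0.
Qed.

(** When n H is small every test is nearly worthless.  The affinity of P^n and
    Q^n is the n-th power of rho >= 1 - H / 2, so it is close to 1 by Bernoulli's
    inequality, and |L - 1| = |sqrt L - 1| (sqrt L + 1) is small in mean by a
    weighted arithmetic-geometric inequality. *)
Lemma error_sum_near1 (phi : n.-tuple T -> R) (e : R) : is_test phi ->
  (0 < e)%R -> (n%:R * H <= e ^+ 2 / 4)%R ->
  (1 - e)%:E <= error_sum P Q phi <= (1 + e)%:E.
Proof.
move=> tphi e0 nH; have [mphi phi01] := tphi.
have intsq_ge0 : 0 <= intsq.
  by apply: integral_ge0 => x _; rewrite lee_fin sqrtr_ge0.
have intL1 : \int[Pn]_t (L t + 1)%:E = 2.
  under eq_integral do rewrite EFinD.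
  rewrite ge0_integralD//; last 2 first.
  - by move=> x _; rewrite lee_fin.
  - exact/measurable_EFinP.
  by rewrite integral_L integral_cst//= probability_setT mule1 -EFinD.
have intsqL : \int[Pn]_t (Num.sqrt (L t))%:E = intsq ^+ n.
  rewrite -integral_power_prod//.
  by apply: eq_integral => t _; rewrite sqrt_prod.
have [rho rhoE rho0] : exists2 r : R, intsq = r%:E & (0 <= r)%R.
  have : intsq <= 2.
    rewrite -[X in _ <= X]int_q1; apply: ge0_le_integral => //.
    - exact/measurable_EFinP.
    - by apply/measurable_EFinP/measurable_funD.
    move=> x _; rewrite lee_fin -{2}(sqr_sqrtr (q0 x)).
    have := sqr_ge0 (Num.sqrt (q x) - 2^-1)%R; nra.
  move: intsq_ge0; case: intsq => [r r0 _| |]//; exists r => //.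
have rhoH : (2 <= 2 * rho + H)%R.
  by move: affinity_ge; rewrite rhoE -EFinM -EFinD lee_fin.
have rhon : (1 - e ^+ 2 / 8 <= rho ^+ n)%R.
  apply: le_trans (bernoulli_ineq n rho0).
  have n0 : (0 <= n%:R :> R)%R by [].
  have : (n%:R * (2 - 2 * rho) <= n%:R * H)%R by rewrite ler_wpM2l//; lra.
  nra.
have mabs : measurable_fun setT (fun t => `|L t - 1|%R).
  by apply: measurableT_comp => //; exact: measurable_funB.
have msqL : measurable_fun setT (fun t => Num.sqrt (L t)).
  by apply: measurableT_comp => //; exact: measurable_sqrt.
(* The weight s in 2 x y <= s x^2 + y^2 / s that balances the two terms. *)
pose s := (4 / e)%R.
have s0 : (0 < s)%R by rewrite divr_gt0.
have tv : \int[Pn]_t (`|L t - 1|)%:E <= e%:E.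
  have : \int[Pn]_t (`|L t - 1|)%:E + s%:E * (rho ^+ n)%:E <= (s / 2 + s^-1)%:E * 2.
    rewrite EFin_expe -rhoE -intsqL -intL1.
    rewrite -!ge0_integralZl//; last 5 first.
    - by apply/measurable_EFinP/measurable_funD.
    - by move=> t _; rewrite lee_fin addr_ge0.
    - by rewrite lee_fin addr_ge0// ?divr_ge0 ?invr_ge0// ltW.
    - exact/measurable_EFinP.
    - by rewrite lee_fin ltW.
    rewrite -ge0_integralD//; last 3 first.
    - exact/measurable_EFinP.
    - by move=> t _; rewrite mule_ge0// lee_fin ?sqrtr_ge0// ltW.
    - by apply: emeasurable_funM => //; exact/measurable_EFinP.
    apply: ge0_le_integral => //.
    - by move=> t _; rewrite adde_ge0// mule_ge0// lee_fin ?sqrtr_ge0// ltW.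
    - apply: emeasurable_funD; first exact/measurable_EFinP.
      by apply: emeasurable_funM => //; exact/measurable_EFinP.
    - by apply: emeasurable_funM => //; apply/measurable_EFinP/measurable_funD.
    move=> t _; rewrite -!EFinM -EFinD lee_fin.
    set x := Num.sqrt (L t); have -> : L t = (x ^+ 2)%R by rewrite sqr_sqrtr.
    have x0 : (0 <= x)%R by rewrite sqrtr_ge0.
    have -> : (x ^+ 2 - 1 = (x - 1) * (x + 1))%R by ring.
    rewrite normrM (ger0_norm (_ : 0 <= x + 1)%R); last by rewrite addr_ge0.
    have n2 : (`|x - 1| ^+ 2 = (x - 1) ^+ 2)%R by rewrite real_normK// num_real.
    set y := `|x - 1|%R in n2 *.
    rewrite -subr_ge0.
    have -> : ((s / 2 + s^-1) * (x ^+ 2 + 1) - (y * (x + 1) + s * x) =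
       s / 2 * (y - (x + 1) / s) ^+ 2 + (2 * (x ^+ 2 + 1) - (x + 1) ^+ 2) / (2 * s))%R.
      have -> : (s / 2 * (y - (x + 1) / s) ^+ 2 =
        s / 2 * (x - 1) ^+ 2 - y * (x + 1) + (x + 1) ^+ 2 / (2 * s))%R.
        by rewrite -n2; field; rewrite gt_eqF.
      by field; rewrite gt_eqF.
    rewrite addr_ge0//.
      by rewrite mulr_ge0 ?sqr_ge0 ?divr_ge0// ltW.
    rewrite divr_ge0//; last by rewrite mulr_ge0// ltW.
    have -> : (2 * (x ^+ 2 + 1) - (x + 1) ^+ 2 = (x - 1) ^+ 2)%R by ring.
    exact: sqr_ge0.
  move=> h.
  have : \int[Pn]_t (`|L t - 1|)%:E <= ((s / 2 + s^-1) * 2 - s * rho ^+ n)%:E.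
    by rewrite EFinB leeBrDr// EFinM EFinM.
  move=> /le_trans; apply; rewrite lee_fin.
  have : (s * (1 - e ^+ 2 / 8) <= s * rho ^+ n)%R by rewrite ler_wpM2l// ltW.
  have -> : (s * (1 - e ^+ 2 / 8) = s - e / 2)%R.
    by rewrite /s; field; rewrite gt_eqF.
  have -> : (s^-1 = e / 4)%R by rewrite /s; field; rewrite gt_eqF.
  lra.
rewrite error_sumE//.
have mI : measurable_fun setT (fun t => phi t + (1 - phi t) * L t)%R.
  apply: measurable_funD => //; apply: measurable_funM => //.
  exact: measurable_funB.
have I0 t : (0 <= phi t + (1 - phi t) * L t)%R.
  have /andP[p0 p1] := phi01 t.
  by rewrite addr_ge0// mulr_ge0// subr_ge0.
have int1 : \int[Pn]_t 1%:E = 1.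
  by rewrite integral_cst//= probability_setT mule1.
apply/andP; split.
  have : \int[Pn]_t 1%:E <=
      \int[Pn]_t (phi t + (1 - phi t) * L t)%:E + \int[Pn]_t (`|L t - 1|)%:E.
    rewrite -ge0_integralD//; last 3 first.
    - by move=> t _; rewrite lee_fin.
    - exact/measurable_EFinP.
    - exact/measurable_EFinP.
    apply: ge0_le_integral => //.
    - by apply: emeasurable_funD; exact/measurable_EFinP.
    move=> t _; rewrite -EFinD lee_fin.
    have /andP[p0 p1] := phi01 t.
    have := ler_norm (1 - L t); rewrite distrC => h.
    have : (0 <= `|L t - 1|)%R by [].
    nra.
  rewrite int1 => h; rewrite EFinB leeBlDr//; apply: (le_trans h).
  by rewrite leeD2l.
have h : \int[Pn]_t (phi t + (1 - phi t) * L t)%:E <=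
    \int[Pn]_t 1%:E + \int[Pn]_t (`|L t - 1|)%:E.
  rewrite -ge0_integralD//; last exact/measurable_EFinP.
  apply: ge0_le_integral => //.
  - by move=> t _; rewrite lee_fin.
  - exact/measurable_EFinP.
  - by apply: emeasurable_funD => //; exact/measurable_EFinP.
  move=> t _; rewrite -EFinD lee_fin.
  have /andP[p0 p1] := phi01 t.
  have := ler_norm (L t - 1) => h.
  have : (0 <= `|L t - 1|)%R by [].
  nra.
rewrite EFinD -int1; apply: (le_trans h); exact: leeD2l.
Qed.

End power_tests.

(** * Concentration of the number of sample points in a set *)

Lemma measurable_superlevel d (T : measurableType d) (R : realType) (f : T -> R)
  (c : R) : measurable_fun setT f -> measurable [set t | c <= f t].
Proof.
move=> mf; rewrite -[X in measurable X]setTI.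
have -> : [set t | c <= f t] = f @^-1` `[c, +oo[.
  by apply/seteqP; split => t /=; rewrite in_itv/= andbT.
exact: mf.
Qed.

Section counting.
Context d (T : measurableType d) (R : realType).
Implicit Types (P : probability T R) (A : set T).

Definition hits A n (t : n.-tuple T) : R := \sum_(x <- t) \1_A x.

Lemma measurable_hits A n : measurable A -> measurable_fun setT (@hits A n).
Proof.
move=> mA.
have -> : @hits A n = fun t => \sum_(i <- index_enum 'I_n) \1_A (tnth t i).
  by apply/funext => t; rewrite /hits big_tuple.
apply: measurable_sum => i.
apply: (@measurableT_comp _ _ _ _ _ _ (\1_A : T -> R) _ (fun t : n.-tuple T => tnth t i)).
  exact: measurable_indic.
exact: measurable_tnth.
Qed.

Lemma expR_le_quad (x : R) : `|x| <= 2^-1 -> expR x <= 1 + x + 2 * x ^+ 2.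
Proof.
rewrite ler_norml => /andP[x1 x2].
have h : 1 - x <= expR (- x) by have := expR_ge1Dx (- x).
have x0 : 0 < 1 - x by lra.
have e1 : expR x * expR (- x) = 1 by rewrite expRxMexpNx_1.
have e0 := expR_gt0 x.
have : expR x * (1 - x) <= 1 by rewrite -[leRHS]e1 ler_wpM2l// ltW.
have q : 1 <= (1 + x + 2 * x ^+ 2) * (1 - x).
  have -> : (1 + x + 2 * x ^+ 2) * (1 - x) = 1 + x ^+ 2 * (1 - 2 * x) by ring.
  by rewrite lerDl mulr_ge0 ?sqr_ge0//; lra.
move=> h2; rewrite -(ler_pM2r x0); exact: le_trans h2 q.
Qed.

Local Open Scope ereal_scope.

(** The number of hits is a sum of n independent indicators, so its exponential
    moment is an n-th power; the quadratic bound on the exponential function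
    turns it into the one of a centred variable with variance proxy 4 n P(A). *)
Lemma integral_expR_hits P A n (th : R) : measurable A -> (`|th| <= 2^-1)%R ->
  \int[power_prob P n]_t (expR (th * (hits A t - n%:R * fine (P A))))%:E <=
  (expR (2 * (n%:R * fine (P A)) * th ^+ 2))%:E.
Proof.
move=> mA th1; set p := fine (P A).
have Pp : P A = p%:E by rewrite fineK// fin_num_measure.
have p0 : (0 <= p)%R by rewrite -lee_fin -Pp.
pose g (x : T) : R := expR (th * \1_A x).
have mg : measurable_fun setT g.
  apply: measurableT_comp; first exact: measurable_expR.
  by apply: measurable_funM => //; exact: measurable_indic.
have ig : \int[P]_x (g x)%:E = (1 + p * (expR th - 1))%:E.
  have -> : \int[P]_x (g x)%:E =
      \int[P]_x ((expR th)%:E * (\1_A x)%:E + (\1_(~` A) x)%:E).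
    apply: eq_integral => x _; rewrite -EFinM -EFinD; congr EFin.
    rewrite /g !indicE in_setC; case: (x \in A) => /=.
      by rewrite !mulr1 addr0.
    by rewrite !mulr0 expR0 add0r.
  rewrite ge0_integralD//; last 2 first.
  - by apply: emeasurable_funM => //; apply/measurable_EFinP; exact: measurable_indic.
  - by apply/measurable_EFinP; apply: measurable_indic; exact: measurableC.
  rewrite ge0_integralZl//; last first.
    by apply/measurable_EFinP; exact: measurable_indic.
  rewrite !integral_indic//; last exact: measurableC.
  rewrite !setIT [X in _ + X](probability_setC P mA)
    [X in _ * X + _]Pp [X in _ - X]Pp -EFinB -EFinM -EFinD; congr EFin.
  ring.
have -> : \int[power_prob P n]_t (expR (th * (hits A t - n%:R * p)))%:E =
   \int[power_prob P n]_t ((expR (- (th * (n%:R * p))))%:E * (\prod_(x <- t) g x)%:E).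
  apply: eq_integral => t _; rewrite -EFinM; congr EFin.
  rewrite mulrBr addrC expRD /hits mulr_sumr expR_sum//.
rewrite ge0_integralZl//; last 2 first.
- by apply/measurable_EFinP; exact: measurable_prod_tuple.
- by move=> t _; rewrite lee_fin; apply: prodr_ge0 => x _; exact: expR_ge0.
rewrite integral_power_prod//; last by move=> x; exact: expR_ge0.
rewrite ig -EFin_expe -EFinM lee_fin.
have h1 : (1 + p * (expR th - 1) <= expR (p * (th + 2 * th ^+ 2)))%R.
  apply: (le_trans (y := (1 + p * (th + 2 * th ^+ 2))%R)).
    by rewrite lerD2l ler_wpM2l//; have := expR_le_quad th1; lra.
  exact: expR_ge1Dx.
have h0 : (0 <= 1 + p * (expR th - 1))%R.
  rewrite -lee_fin -ig; apply: integral_ge0 => x _.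
  by rewrite lee_fin expR_ge0.
have h2 : ((1 + p * (expR th - 1)) ^+ n <= expR (p * (th + 2 * th ^+ 2)) ^+ n)%R.
  by apply: lerXn2r => //; rewrite nnegrE// expR_ge0.
apply: (le_trans (ler_wpM2l (expR_ge0 _) h2)).
rewrite -expRM_natl -expRD ler_expR.
have -> // : (- (th * (n%:R * p)) + n%:R * (p * (th + 2 * th ^+ 2)) =
   2 * (n%:R * p) * th ^+ 2)%R by ring.
Qed.

(** The order of the fluctuations of a binomial variable with mean y: the
    standard deviation, but at least 1 so that the Poisson regime y < 1 is
    covered as well. *)
Definition dev_scale (y : R) : R := Num.max (Num.sqrt y) 1%R.

Lemma dev_scale_ge1 y : (1 <= dev_scale y)%R.
Proof. by rewrite /dev_scale le_max lexx orbT. Qed.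

Lemma dev_scale_sqr_ge y : (0 <= y)%R -> (y <= dev_scale y ^+ 2)%R.
Proof.
move=> y0; rewrite -{1}(sqr_sqrtr y0) lerXn2r ?nnegrE ?sqrtr_ge0//.
  by rewrite (le_trans ler01)// dev_scale_ge1.
by rewrite /dev_scale le_max lexx.
Qed.

Let chernoff_one_sided P A n (th a : R) : measurable A -> (`|th| <= 2^-1)%R ->
  power_prob P n [set t | (a <= th * (hits A t - n%:R * fine (P A)))%R] <=
  (expR (2 * (n%:R * fine (P A)) * th ^+ 2 - a))%:E.
Proof.
move=> mA th1.
have mf : measurable_fun setT (fun t : n.-tuple T => th * (hits A t - n%:R * fine (P A)))%R.
  apply: measurable_funM => //; apply: measurable_funB => //.
  exact: measurable_hits.
set B := [set t | _].
have mB : measurable B by exact: measurable_superlevel.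
rewrite expRD EFinM.
have mE : measurable_fun setT
    (fun t : n.-tuple T => (expR (th * (hits A t - n%:R * fine (P A))))%:E).
  by apply/measurable_EFinP; apply: measurableT_comp => //; exact: measurable_expR.
have -> : power_prob P n B = \int[power_prob P n]_t (\1_B t)%:E.
  by rewrite integral_indic// setIT.
apply: (@le_trans _ _ (\int[power_prob P n]_t
   ((expR (th * (hits A t - n%:R * fine (P A))))%:E * (expR (- a))%:E))).
  apply: ge0_le_integral => //.
  - by apply/measurable_EFinP; exact: measurable_indic.
  - by apply: emeasurable_funM.
  move=> t _; rewrite -EFinM lee_fin -expRD indicE.
  case: (boolP (t \in B)) => [|_]; last exact: expR_ge0.
  rewrite inE /B/= => tB; rewrite -[leLHS]expR0 ler_expR; lra.
rewrite ge0_integralZr//.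
by rewrite lee_wpmul2r ?lee_fin ?expR_ge0//; exact: integral_expR_hits.
Qed.

(** Chernoff's bound with the tilt 1 / (2 dev_scale (n P(A))): this tilt is at
    most 1/2, and it keeps the quadratic term of the exponent below 1/2.  The
    exponential tail is what allows a union bound over n quantiles. *)
Lemma hits_concentration P A n (r : R) : measurable A ->
  power_prob P n [set t | (r * dev_scale (n%:R * fine (P A)) <=
                   `|hits A t - n%:R * fine (P A)|)%R] <=
  (2 * expR ((1 - r) / 2))%:E.
Proof.
move=> mA; set y := (n%:R * fine (P A))%R; set m := dev_scale y.
have y0 : (0 <= y)%R by rewrite mulr_ge0// fine_ge0.
have m1 : (1 <= m)%R by exact: dev_scale_ge1.
have m0 : (0 < m)%R by apply: lt_le_trans m1.
pose th := (2 * m)^-1%R.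
have th0 : (0 < th)%R by rewrite invr_gt0 mulr_gt0.
have th1 : (`|th| <= 2^-1)%R.
  rewrite ger0_norm; last exact: ltW.
  rewrite /th lef_pV2 ?posrE ?mulr_gt0//; lra.
have ym : (2 * y * th ^+ 2 <= 2^-1)%R.
  have : (y <= m ^+ 2)%R by exact: dev_scale_sqr_ge.
  rewrite -(ler_pM2r (_ : 0 < th ^+ 2))%R ?exprn_gt0//.
  have -> : (m ^+ 2 * th ^+ 2 = 4^-1)%R by rewrite /th; field; rewrite gt_eqF.
  lra.
have mh : measurable_fun setT (fun t : n.-tuple T => hits A t - y)%R.
  by apply: measurable_funB => //; exact: measurable_hits.
pose B1 := [set t : n.-tuple T | (r / 2 <= th * (hits A t - y))%R].
pose B2 := [set t : n.-tuple T | (r / 2 <= (- th) * (hits A t - y))%R].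
have mB1 : measurable B1 by apply: measurable_superlevel; exact: measurable_funM.
have mB2 : measurable B2 by apply: measurable_superlevel; exact: measurable_funM.
apply: (@le_trans _ _ (power_prob P n (B1 `|` B2))).
  apply: le_measure; rewrite ?inE//.
  - by apply: measurable_superlevel; apply: measurableT_comp.
  - exact: measurableU.
  move=> t /=; rewrite /B1 /B2/=.
  have -> : (r / 2 = th * (r * m))%R by rewrite /th; field; rewrite gt_eqF.
  rewrite mulNr -mulrN !ler_pM2l//.
  by rewrite ler_normr => /orP[]; [left|right].
apply: (le_trans (measureU2 _ _ _)) => //.
rewrite mulrDl mul1r EFinD; apply: leeD.
  apply: (le_trans (chernoff_one_sided P n (r / 2) mA th1)).
  by rewrite lee_fin ler_expR -/y; lra.
apply: (le_trans (chernoff_one_sided P n (r / 2) mA (_ : `|- th| <= 2^-1)%R)).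
  by rewrite normrN.
by rewrite lee_fin ler_expR -/y sqrrN; lra.
Qed.

(** The product of the indicators of the complement of A is 1 exactly on the
    samples that avoid A, and its mean (1 - P(A))^n is at least 1 - n P(A). *)
Lemma hits_nonzero_le P A n : measurable A ->
  power_prob P n [set t | (1 <= hits A t)%R] <= (n%:R * fine (P A))%:E.
Proof.
move=> mA; set p := fine (P A).
have Pp : P A = p%:E by rewrite fineK// fin_num_measure.
have mB : measurable [set t : n.-tuple T | (1 <= hits A t)%R].
  by apply: measurable_superlevel; exact: measurable_hits.
have mC : measurable_fun setT (\1_(~` A) : T -> R).
  by apply: measurable_indic; exact: measurableC.
have p1 : (0 <= 1 - p)%R.
  by rewrite subr_ge0 -lee_fin -Pp probability_le1.
set B := [set t | _] in mB *.
have e : \int[power_prob P n]_t (\prod_(x <- t) \1_(~` A) x)%:E = ((1 - p) ^+ n)%:E.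
  rewrite integral_power_prod// integral_indic//; last exact: measurableC.
  by rewrite setIT [X in X ^+ _](probability_setC P mA) [X in _ - X]Pp -EFinB EFin_expe.
have : power_prob P n B + ((1 - p) ^+ n)%:E <= 1.
  rewrite -e.
  have -> : power_prob P n B = \int[power_prob P n]_t (\1_B t)%:E.
    by rewrite integral_indic// setIT.
  have pr0 (t : n.-tuple T) : (0 <= \prod_(x <- t) \1_(~` A) x :> R)%R.
    by apply: prodr_ge0 => x _; rewrite indicE.
  rewrite -ge0_integralD//; last 3 first.
  - by apply/measurable_EFinP; exact: measurable_indic.
  - by move=> t _; rewrite lee_fin.
  - by apply/measurable_EFinP; exact: measurable_prod_tuple.
  apply: (@le_trans _ _ (\int[power_prob P n]_t 1)); last first.
    by rewrite integral_cst//= probability_setT mule1.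
  apply: ge0_le_integral => //.
  - by move=> t _; rewrite adde_ge0// lee_fin.
  - apply: emeasurable_funD; apply/measurable_EFinP.
      exact: measurable_indic.
    exact: measurable_prod_tuple.
  move=> t _; rewrite -EFinD lee_fin indicE.
  have prod1 (s : seq T) : (\prod_(x <- s) \1_(~` A) x <= 1 :> R)%R /\
      ((1 <= \sum_(x <- s) \1_A x :> R)%R -> \prod_(x <- s) \1_(~` A) x = 0 :> R)%R.
    elim: s => [|x s [ih1 ih2]].
      by rewrite !big_nil lexx; split => //; rewrite ler10.
    rewrite !big_cons !indicE in_setC; case: (x \in A) => /=.
      by rewrite mul0r ler01.
    by rewrite mul1r add0r.
  have [h1 h2] := prod1 t.
  case: (boolP (t \in B)); last by rewrite add0r.
  by rewrite inE => /h2 ->; rewrite addr0.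
move=> h; have : power_prob P n B <= (1 - (1 - p) ^+ n)%:E.
  by rewrite EFinB leeBrDr.
move=> /le_trans; apply; rewrite lee_fin.
by have := bernoulli_ineq n p1; lra.
Qed.

End counting.

Arguments hits {d T R} A {n} t.

(** * The divergences phi_s and K_s *)

Section phi_divergence.
Context (R : realType).
Implicit Types s x y u v l : R.

(** The finite branch of phi_s; on (0, oo) the case distinctions of [phi_div]
    disappear and one has phi_s(1) = phi_s'(1) = 0 and phi_s''(x) = x^(s - 2). *)
Definition phi_real s x : R :=
  if s == 0 then x - ln x - 1
  else if s == 1 then x * (ln x - 1) + 1
  else (1 - s + s * x - x `^ s) / (s * (1 - s)).

Definition dphi s x : R :=
  if s == 0 then 1 - x^-1
  else if s == 1 then ln x
  else (1 - x `^ (s - 1)) / (1 - s).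

Lemma phi_divE s x : 0 < x -> phi_div s x = (phi_real s x)%:E.
Proof.
move=> x0; rewrite /phi_div /phi_real gt_eqF//=.
by case: ifP => // _; case: ifP.
Qed.

Lemma phi_real1 s : phi_real s 1 = 0.
Proof.
rewrite /phi_real powR1 ln1; case: ifP => _; first by ring.
by case: ifP => _; [ring|rewrite [X in X / _](_ : _ = 0) ?mul0r//; ring].
Qed.

Lemma dphi1 s : dphi s 1 = 0.
Proof.
rewrite /dphi powR1 ln1 invr1 subrr mul0r.
by case: ifP => // _; case: ifP.
Qed.

Lemma is_derive_phi s x : 0 < x -> is_derive x 1 (phi_real s) (dphi s x).
Proof.
move=> x0; have dln := is_derive1_ln x0.
have did : is_derive x 1 (@id R) 1 by exact: is_derive_id.
rewrite /phi_real /dphi; case: ifPn => s0.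
  have -> : (fun x => x - ln x - 1) = (@id R) - (@ln R) - cst 1 by [].
  apply: is_derive_eq; by rewrite subr0.
case: ifPn => s1.
  have -> : (fun x => x * (ln x - 1) + 1) = ((@id R) * ((@ln R) - cst 1)) + cst 1 by [].
  apply: is_derive_eq.
  rewrite /= /GRing.scale/= subr0 addr0 mulr1 mulfV ?gt_eqF//.
  rewrite -[((@ln R) - cst 1) x]/(ln x - 1); ring.
have dpow := is_derive1_powR s x0.
have -> : (fun x => (1 - s + s * x - x `^ s) / (s * (1 - s))) =
   (s * (1 - s))^-1 *: (cst (1 - s) + s *: (@id R) - (@powR R ^~ s)).
  by apply/funext => y; rewrite mulrC.
have := is_deriveZ (s * (1 - s))^-1
  (is_deriveB (is_deriveD (is_derive_cst (1 - s) x 1) (is_deriveZ s did)) dpow).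
move=> dphi_s; apply: (is_derive_eq dphi_s).
rewrite /GRing.scale/= add0r mulr1.
by field; rewrite subr_eq0 eq_sym s1 s0.
Qed.

Lemma is_derive_dphi s x : 0 < x -> is_derive x 1 (dphi s) (x `^ (s - 2)).
Proof.
move=> x0; have dln := is_derive1_ln x0.
have did : is_derive x 1 (@id R) 1 by exact: is_derive_id.
rewrite /dphi; case: (boolP (s == 0)) => s0.
  have -> : (fun x => 1 - x^-1) = cst 1 - (fun x : R => x^-1) by [].
  have dV : is_derive x 1 (fun x : R => x^-1) (- x ^- 2 *: 1).
    by apply: is_deriveV; rewrite gt_eqF.
  apply: is_derive_eq.
  rewrite (eqP s0) !sub0r /GRing.scale/= mulr1 opprK.
  by rewrite powR_invn// ltW.
case: (boolP (s == 1)) => s1.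
  by rewrite (eqP s1) (_ : 1 - 2 = - 1) ?powR_inv1 ?ltW//; ring.
have dpow := is_derive1_powR (s - 1) x0.
have -> : (fun x => (1 - x `^ (s - 1)) / (1 - s)) =
   (1 - s)^-1 *: (cst 1 - (@powR R ^~ (s - 1))).
  by apply/funext => y; rewrite mulrC.
apply: is_derive_eq.
rewrite /GRing.scale/= add0r (_ : s - 1 - 1 = s - 2); last by ring.
by field; rewrite subr_eq0 eq_sym s1.
Qed.

Lemma mvt_pos (f df : R -> R) a b : (forall x, 0 < x -> is_derive x 1 f (df x)) ->
  0 < a -> a <= b -> exists2 c, a <= c <= b & f b - f a = df c * (b - a).
Proof.
move=> fdf a0 ab.
have [||c] := @MVT_segment R f df a b ab.
- move=> x; rewrite in_itv/= => /andP[ax _]; apply: fdf; exact: lt_trans ax.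
- apply: derivable_within_continuous => x; rewrite in_itv/= => /andP[ax _].
  by have [] := fdf _ (lt_le_trans a0 ax).
by rewrite in_itv/= => cab e; exists c.
Qed.

Lemma mvt_pos' (f df : R -> R) a b : (forall x, 0 < x -> is_derive x 1 f (df x)) ->
  0 < a -> 0 < b ->
  exists2 c, (a <= c <= b) || (b <= c <= a) & f b - f a = df c * (b - a).
Proof.
move=> fdf a0 b0; have [ab|/ltW ba] := leP a b.
  by have [c cab e] := mvt_pos fdf a0 ab; exists c; rewrite ?cab.
have [c cab e] := mvt_pos fdf b0 ba; exists c; first by rewrite cab orbT.
by rewrite -opprB e -mulrN opprB.
Qed.

Lemma powR_le_max l p x : 1 <= l -> l^-1 <= x <= l -> x `^ p <= l `^ `|p|.
Proof.
move=> l1 /andP[lx xl].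
have l0 : 0 < l by apply: lt_le_trans l1.
have x0 : 0 < x by apply: lt_le_trans lx; rewrite invr_gt0.
have [p0|/ltW p0] := leP 0 p.
  rewrite (ger0_norm p0); apply: ge0_ler_powR => //; exact: ltW.
rewrite (ler0_norm p0) -[p in leLHS]opprK powRN -[leRHS]invrK.
rewrite lef_pV2 ?posrE ?invr_gt0 ?powR_gt0//.
have -> : (l `^ (- p))^-1 = (l^-1) `^ (- p).
  have li : 0 <= l by exact: ltW.
  apply: (mulfI (x := l `^ (- p))); first by rewrite gt_eqF// powR_gt0.
  by rewrite -powRM ?invr_ge0// !divff ?powR1// gt_eqF// powR_gt0.
by apply: ge0_ler_powR; rewrite ?oppr_ge0// nnegrE ?invr_ge0 ltW.
Qed.

(** Two applications of the mean value theorem write phi_s(x) as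
    c'^(s - 2) (c - 1) (x - 1) with c between 1 and x and c' between 1 and c;
    the quadratic growth is thus uniform in the ratio x as long as x and its
    inverse stay below l. *)
Lemma phi_real_bounds s l x : 1 <= l -> l^-1 <= x <= l ->
  0 <= phi_real s x <= l `^ `|s - 2| * (x - 1) ^+ 2.
Proof.
move=> l1 lxl; have /andP[lx xl] := lxl.
have l0 : 0 < l by apply: lt_le_trans l1.
have li1 : l^-1 <= 1 by rewrite invf_le1.
have x0 : 0 < x by apply: lt_le_trans lx; rewrite invr_gt0.
have [c cx] := mvt_pos' (is_derive_phi s) ltr01 x0.
rewrite phi_real1 subr0 => ->.
have c0 : 0 < c by case/orP : cx => /andP[? ?];
  [exact: lt_le_trans ltr01 _|exact: lt_le_trans x0 _].
have [c' cx'] := mvt_pos' (is_derive_dphi s) ltr01 c0.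
rewrite dphi1 subr0 => ->.
have c'l : l^-1 <= c' <= l.
  apply/andP; case/orP : cx => /andP[? ?]; case/orP : cx' => /andP[? ?]; split; lra.
have h0 := powR_ge0 c' (s - 2).
have h1 := powR_le_max (s - 2) l1 c'l.
have p0 : 0 <= (c - 1) * (x - 1).
  by case/orP : cx => /andP[? ?]; nra.
have p1 : (c - 1) * (x - 1) <= (x - 1) ^+ 2.
  by case/orP : cx => /andP[? ?]; nra.
rewrite -mulrA mulr_ge0//=; exact: ler_pM.
Qed.

Lemma phi_real_ge0 s x : 0 < x -> 0 <= phi_real s x.
Proof.
move=> x0; pose l := Num.max x x^-1.
have lx : x <= l by rewrite le_max lexx.
have lxV : x^-1 <= l by rewrite le_max lexx orbT.
have l1 : 1 <= l.
  have [x1|/ltW x1] := leP 1 x; first exact: le_trans lx.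
  by apply: le_trans lxV; rewrite invf_ge1.
have l0 : 0 < l by exact: lt_le_trans l1.
have lxl : l^-1 <= x <= l by rewrite lx andbT -[x]invrK lef_pV2 ?posrE ?invr_gt0.
by have /andP[] := phi_real_bounds s l1 lxl.
Qed.

(** The minimum of phi_s'' = x^(s - 2) on [1, 2]. *)
Definition phi_curv s : R := Num.min 1 (2 `^ (s - 2)).

Lemma phi_curv_gt0 s : 0 < phi_curv s.
Proof. by rewrite lt_min ltr01 powR_gt0. Qed.

(** Far from 1 no quadratic lower bound can hold for all s, but convexity still
    yields linear growth.  Evaluating the derivative at the midpoint of 1 and x
    gives both regimes at once. *)
Lemma phi_real_lower s x : 1 <= x ->
  phi_curv s / 4 * Num.min ((x - 1) ^+ 2) (x - 1) <= phi_real s x.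
Proof.
move=> x1; have x0 : 0 < x by exact: lt_le_trans x1.
have m0 := phi_curv_gt0 s; set m := phi_curv s in m0 *.
have curv c : 1 <= c <= 2 -> m <= c `^ (s - 2).
  move=> /andP[c1 c2]; have [s2|/ltW s2] := leP 2 s.
    apply: (@le_trans _ _ 1); first by rewrite ge_min lexx.
    by rewrite -[leLHS](powRr0 c) ler_powR// subr_ge0.
  apply: (@le_trans _ _ (2 `^ (s - 2))); first by rewrite ge_min lexx orbT.
  rewrite -[s - 2]opprK !(powRN _ (- _)) lef_pV2 ?posrE ?powR_gt0//; last lra.
  by apply: ge0_ler_powR; rewrite ?nnegrE//; lra.
pose y := (1 + x) / 2.
have y1 : 1 <= y by rewrite /y; lra.
have yx : y <= x by rewrite /y; lra.
have y0 : 0 < y by exact: lt_le_trans y1.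
have mono a b : 1 <= a -> a <= b -> dphi s a <= dphi s b.
  move=> a1 ab.
  have [c _] := mvt_pos (is_derive_dphi s) (lt_le_trans ltr01 a1) ab.
  move=> h; rewrite -subr_ge0 h mulr_ge0 ?powR_ge0// subr_ge0//.
have dy2 z : 1 <= z <= 2 -> m * (z - 1) <= dphi s z.
  move=> /andP[z1 z2].
  have [c /andP[c1 cz]] := mvt_pos (is_derive_dphi s) ltr01 z1.
  rewrite dphi1 subr0 => ->; apply: ler_wpM2r; first lra.
  by apply: curv; rewrite c1 (le_trans cz).
have dy : m * Num.min (y - 1) 1 <= dphi s y.
  have [y2|/ltW y2] := leP y 2.
    apply: le_trans (dy2 y _); last by rewrite y1.
    by rewrite ler_pM2l// ge_min lexx.
  apply: (@le_trans _ _ m); first by rewrite ger_pMr// ge_min lexx orbT.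
  apply: le_trans (mono 2 y _ y2); last lra.
  by apply: le_trans (dy2 2 _); [rewrite (_ : 2 - 1 = 1) ?mulr1//; ring|lra].
have [c /andP[yc cx] e] := mvt_pos (is_derive_phi s) y0 yx.
have dc : m * Num.min (y - 1) 1 <= dphi s c.
  exact: le_trans dy (mono _ _ y1 yc).
have : dphi s c * (x - y) <= phi_real s x.
  by rewrite -e lerBlDr lerDl phi_real_ge0.
apply: le_trans.
apply: (@le_trans _ _ (m * Num.min (y - 1) 1 * (x - y))); last first.
  by rewrite ler_wpM2r// subr_ge0.
rewrite /y -!mulrA ler_pM2l//.
have -> : x - (1 + x) / 2 = (x - 1) / 2 by field.
have -> : (1 + x) / 2 - 1 = (x - 1) / 2 by field.
rewrite /Num.min; case: ifP => h1; case: ifP => h2; nra.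
Qed.

Lemma K_divC s u v : K_div s (1 - u) (1 - v) = K_div s u v.
Proof. by rewrite /K_div addeC !subKr. Qed.

Lemma K_divE s u v : 0 < u < 1 -> 0 < v < 1 ->
  K_div s u v = (v * phi_real s (u / v) +
                 (1 - v) * phi_real s ((1 - u) / (1 - v)))%:E.
Proof.
move=> /andP[u0 u1] /andP[v0 v1].
by rewrite /K_div !phi_divE ?divr_gt0// ?subr_gt0.
Qed.

(** Summing the two quadratic bounds produces the squared higher criticism
    score, since (u - v)^2 / v + (u - v)^2 / (1 - v) =
    (u - v)^2 / (v (1 - v)). *)
Lemma K_div_le s l u v : 0 < u < 1 -> 0 < v < 1 -> 1 <= l ->
  l^-1 <= u / v <= l -> l^-1 <= (1 - u) / (1 - v) <= l ->
  (K_div s u v <= (l `^ `|s - 2| * ((u - v) ^+ 2 / (v * (1 - v))))%:E)%E.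
Proof.
move=> u01 v01 l1 h1 h2; rewrite K_divE// lee_fin.
have /andP[v0 v1] := v01.
have w0 : 0 < 1 - v by rewrite subr_gt0.
have /andP[_ b1] := phi_real_bounds s l1 h1.
have /andP[_ b2] := phi_real_bounds s l1 h2.
apply: (le_trans (lerD (ler_wpM2l (ltW v0) b1) (ler_wpM2l (ltW w0) b2))).
rewrite le_eqVlt; apply/orP; left; apply/eqP.
by field; rewrite !gt_eqF.
Qed.

(** One tail with an excess u - v suffices: the other summand of K_s is
    nonnegative. *)
Lemma K_div_ge s u v : 0 < u < 1 -> 0 < v < 1 -> v <= u ->
  ((phi_curv s / 4 * Num.min ((u - v) ^+ 2 / v) (u - v))%:E <= K_div s u v)%E.
Proof.
move=> u01 v01 vu; rewrite K_divE// lee_fin.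
have /andP[v0 v1] := v01; have /andP[u0 u1] := u01.
have x1 : 1 <= u / v by rewrite ler_pdivlMr// mul1r.
apply: (@le_trans _ _ (v * phi_real s (u / v))); last first.
  rewrite lerDl mulr_ge0//; first lra.
  by apply: phi_real_ge0; rewrite divr_gt0 ?subr_gt0.
apply: le_trans (ler_wpM2l (ltW v0) (phi_real_lower s x1)).
rewrite mulrCA ler_pM2l ?divr_gt0 ?phi_curv_gt0//.
rewrite minr_pMr; last exact: ltW.
have -> : v * (u / v - 1) ^+ 2 = (u - v) ^+ 2 / v by field; rewrite gt_eqF.
by have -> : v * (u / v - 1) = u - v by field; rewrite gt_eqF.
Qed.

End phi_divergence.

(** * Scaling of Lebesgue measure and the standard normal law *)

Section lebesgue_scaling.
Context (R : realType).
Local Notation RT := (measurableTypeR R).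
Local Notation leb := (@lebesgue_measure R).
Local Open Scope ereal_scope.

Lemma measurable_scaling (s : R) :
  measurable_fun [set: RT] (fun x : RT => s * x : RT)%R.
Proof. exact: mulrl_measurable. Qed.

(** The image of Lebesgue measure under the dilation by s, renormalised; it
    agrees with Lebesgue measure on intervals. *)
Let scaled (s : {posnum R}) : {measure set RT -> \bar R} :=
  mscale (NngNum (ge0 s))
    (measure_function_pushforward__canonical__measure_function_Measure
      leb (measurable_scaling s%:num)).

Let scaledE s A : measurable A -> leb A = scaled s A.
Proof.
move=> mA; apply: lebesgue_measure_unique => //= _ [[a b]] _ <-.
rewrite /mscale/= /pushforward.
have -> : (fun x : RT => s%:num * x)%R @^-1` `]a, b]%classic =
    `](a / s%:num)%R, (b / s%:num)%R]%classic.
  by apply/seteqP; split => x /=; rewrite !in_itv/= ltr_pdivrMr// ler_pdivlMr//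
    ![(x * _)%R]mulrC.
rewrite !lebesgue_measure_itv/= !lte_fin ltr_pM2r ?invr_gt0//.
case: ifP => _; last by rewrite mule0.
by rewrite -!EFinD -EFinM; congr EFin; field.
Qed.

Lemma lebesgue_measure_scaling (s : R) (A : set R) : (0 < s)%R -> measurable A ->
  s%:E * leb ((fun x => s * x)%R @^-1` A) = leb A.
Proof. by move=> s0 mA; rewrite (scaledE (PosNum s0) mA). Qed.

Lemma ge0_integral_scaling (s : R) (f : R -> \bar R) : (0 < s)%R ->
  measurable_fun [set: R] f -> (forall x, 0 <= f x) ->
  \int[leb]_x f x = s%:E * \int[leb]_x f (s * x)%R.
Proof.
move=> s0 mf f0.
rewrite (eq_measure_integral (scaled (PosNum s0))); last first.
  by move=> A mA _; exact: scaledE.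
rewrite ge0_integral_mscale//=; congr (_ * _).
rewrite ge0_integral_pushforward//; last exact: measurable_scaling.
Qed.

End lebesgue_scaling.

Section standard_normal.
Context (R : realType).
Local Notation RT := (measurableTypeR R).
Local Notation leb := (@lebesgue_measure R).
Local Notation phi := (normal_pdf (0 : R) 1).
Local Notation P0 := (P0 R).

Lemma normal_peak1_gt0 : 0 < normal_peak 1 :> R.
Proof. by apply: normal_peak_gt0; rewrite oner_eq0. Qed.

Lemma normal_peak1_lt1 : normal_peak 1 <= 1 :> R.
Proof.
rewrite /normal_peak expr1n mul1r invf_le1.
  rewrite -[leLHS]sqrtr1 ler_sqrt; have := pi_ge2 R; rewrite -mulr_natr; lra.
by rewrite sqrtr_gt0 mulrn_wgt0// pi_gt0.
Qed.

Lemma phiE x : phi x = normal_peak 1 * expR (- (x ^+ 2 / 2)).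
Proof.
rewrite normal_pdfE ?oner_eq0// /normal_fun subr0 expr1n; congr (_ * expR _).
by rewrite mulNr.
Qed.

Lemma phi_ge0 x : 0 <= phi x. Proof. exact: normal_pdf_ge0. Qed.

Lemma phi_le1 x : phi x <= 1.
Proof.
apply: le_trans normal_peak1_lt1; apply: normal_pdf_ub; exact: oner_neq0.
Qed.

Lemma measurable_phi : measurable_fun setT phi.
Proof. exact: measurable_normal_pdf. Qed.

Lemma P0E A : P0 A = (\int[leb]_(x in A) (phi x)%:E)%E.
Proof. by []. Qed.

Lemma ge0_integral_P0 (f : R -> \bar R) : measurable_fun setT f ->
  (forall x, 0 <= f x)%E ->
  (\int[P0]_x f x = \int[leb]_x (f x * (phi x)%:E))%E.
Proof.
move=> mf f0; apply: ge0_integral_density => //; first exact: measurable_phi.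
exact: phi_ge0.
Qed.

Lemma P0_le_width (a b : R) : a <= b -> (P0 `]a, b]%classic <= (b - a)%:E)%E.
Proof.
move=> ab; rewrite P0E.
apply: (@le_trans _ _ (\int[leb]_(x in `]a, b]) 1)%E).
  apply: ge0_le_integral => //.
  - by move=> x _; rewrite lee_fin phi_ge0.
  - by apply/measurable_EFinP; apply: measurable_funTS; exact: measurable_phi.
  - by move=> x _; rewrite lee_fin phi_le1.
rewrite integral_cst//= mul1e lebesgue_measure_itv/= lte_fin.
case: ifP => [_|]; first by rewrite EFinB.
by move=> _; rewrite lee_fin subr_ge0.
Qed.

Lemma P0_itv_gt0 (a b : R) : a < b -> (0 < P0 `]a, b]%classic)%E.
Proof.
move=> ab; rewrite P0E.
pose m := Num.max `|a| `|b|.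
pose c := normal_peak 1 * expR (- (m ^+ 2 / 2)).
have c0 : 0 < c by rewrite mulr_gt0 ?normal_peak1_gt0 ?expR_gt0.
apply: (@lt_le_trans _ _ (\int[leb]_(x in `]a, b]) c%:E)%E).
  rewrite integral_cst//= lebesgue_measure_itv/= lte_fin ab.
  by rewrite -EFinD -EFinM lte_fin mulr_gt0// subr_gt0.
apply: ge0_le_integral => //.
- by move=> x _; rewrite lee_fin ltW.
- by apply/measurable_EFinP; apply: measurable_funTS; exact: measurable_phi.
- move=> x /=; rewrite in_itv/= => /andP[ax xb].
  rewrite lee_fin phiE ler_pM2l ?normal_peak1_gt0// ler_expR lerN2.
  rewrite ler_pM2r// -[leLHS]real_normK ?num_real// lerXn2r ?nnegrE//.
    by rewrite /m le_max normr_ge0.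
  have h1 : x <= `|b| by apply: (le_trans xb); exact: ler_norm.
  have h2 : - x <= `|a|.
    by rewrite -normrN (le_trans _ (ler_norm _))// lerN2 ltW.
  by rewrite ler_norml lerNl /m !le_max h1 h2 orbT.
Qed.

(** For x > t the normal density is at most exp(- t^2 / 2) times the normal
    density centred at t, because t (x - t) >= 0; the latter has mass one. *)
Lemma P0_tail_right (t : R) : 0 <= t ->
  (P0 `]t, +oo[%classic <= (expR (- (t ^+ 2 / 2)))%:E)%E.
Proof.
move=> t0; rewrite P0E.
have mt : measurable_fun setT (normal_pdf t 1) by exact: measurable_normal_pdf.
apply: (@le_trans _ _ (\int[leb]_(x in `]t, +oo[)
   ((expR (- (t ^+ 2 / 2)))%:E * (normal_pdf t 1 x)%:E))%E).
  apply: ge0_le_integral => //.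
  - by move=> x _; rewrite lee_fin phi_ge0.
  - by apply/measurable_EFinP; apply: measurable_funTS; exact: measurable_phi.
  - by apply: emeasurable_funM => //; apply/measurable_EFinP; exact: measurable_funTS.
  move=> x /=; rewrite in_itv/= andbT => tx.
  rewrite -EFinM lee_fin phiE normal_pdfE ?oner_eq0// /normal_fun mulrCA.
  rewrite ler_pM2l ?normal_peak1_gt0// -expRD ler_expR expr1n.
  have h : 0 <= t * (x - t) by rewrite mulr_ge0// subr_ge0 ltW.
  rewrite -[1 *+ 2]/2; nra.
rewrite ge0_integralZl//; last 2 first.
- by apply/measurable_EFinP; exact: measurable_funTS.
- by move=> x _; rewrite lee_fin normal_pdf_ge0.
rewrite -[leRHS]mule1; apply: lee_wpmul2l; first by rewrite lee_fin expR_ge0.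
rewrite -(integral_normal_pdf t 1); apply: ge0_subset_integral => //.
- exact/measurable_EFinP.
- by move=> x _; rewrite lee_fin normal_pdf_ge0.
Qed.

Lemma P0_tail_left (t : R) : 0 <= t ->
  (P0 `]-oo, (- t)%R]%classic <= (expR (- (t ^+ 2 / 2)))%:E)%E.
Proof.
move=> t0; rewrite P0E.
have mt : measurable_fun setT (normal_pdf (- t) 1) by exact: measurable_normal_pdf.
apply: (@le_trans _ _ (\int[leb]_(x in `]-oo, (- t)%R])
   ((expR (- (t ^+ 2 / 2)))%:E * (normal_pdf (- t) 1 x)%:E))%E).
  apply: ge0_le_integral => //.
  - by move=> x _; rewrite lee_fin phi_ge0.
  - by apply/measurable_EFinP; apply: measurable_funTS; exact: measurable_phi.
  - by apply: emeasurable_funM => //; apply/measurable_EFinP; exact: measurable_funTS.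
  move=> x /=; rewrite in_itv/= => tx.
  rewrite -EFinM lee_fin phiE normal_pdfE ?oner_eq0// /normal_fun mulrCA.
  rewrite ler_pM2l ?normal_peak1_gt0// -expRD ler_expR expr1n.
  have h : 0 <= t * (- t - x) by rewrite mulr_ge0// subr_ge0.
  rewrite -[1 *+ 2]/2; nra.
rewrite ge0_integralZl//; last 2 first.
- by apply/measurable_EFinP; exact: measurable_funTS.
- by move=> x _; rewrite lee_fin normal_pdf_ge0.
rewrite -[leRHS]mule1; apply: lee_wpmul2l; first by rewrite lee_fin expR_ge0.
rewrite -(integral_normal_pdf (- t) 1); apply: ge0_subset_integral => //.
- exact/measurable_EFinP.
- by move=> x _; rewrite lee_fin normal_pdf_ge0.
Qed.

Lemma F0E (x : R) : P0 `]-oo, x]%classic = (F0 x)%:E.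
Proof. by rewrite /F0 fineK// fin_num_measure. Qed.

Lemma P0_right (x : R) : P0 `]x, +oo[%classic = (1 - F0 x)%:E.
Proof.
rewrite -setCitvl probability_setC// EFinB; congr (_ - _)%E; exact: F0E.
Qed.

Lemma P0_itv (a b : R) : a <= b -> P0 `]a, b]%classic = (F0 b - F0 a)%:E.
Proof.
move=> ab; rewrite EFinB -!F0E.
have -> : `]-oo, b]%classic = `]-oo, a] `|` `]a, b] :> set R.
  by rewrite -itv_bndbnd_setU// ?bnd_simp.
rewrite measureU//.
  by rewrite addeAC subee ?add0e// fin_num_measure.
by apply/seteqP; split => // x [] /=; rewrite !in_itv/=; lra.
Qed.

Lemma F0_lt (a b : R) : a < b -> F0 a < F0 b.
Proof.
by move=> ab; rewrite -subr_gt0 -lte_fin -P0_itv ?ltW// P0_itv_gt0.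
Qed.

Lemma F0_le (a b : R) : a <= b -> F0 a <= F0 b.
Proof. by rewrite le_eqVlt => /orP[/eqP->//|/F0_lt/ltW]. Qed.

(** The Lipschitz constant is a bound on the normal density. *)
Lemma F0_lipschitz (a b : R) : `|F0 a - F0 b| <= `|a - b|.
Proof.
wlog ab : a b / a <= b.
  have [ab h|/ltW ba h] := leP a b; first exact: h.
  by rewrite distrC [leRHS]distrC; exact: h.
rewrite distrC [leRHS]distrC !ger0_norm ?subr_ge0 ?F0_le//.
by rewrite -lee_fin -P0_itv// P0_le_width.
Qed.

Lemma F0_gt0 (x : R) : 0 < F0 x.
Proof.
have h : x - 1 < x by rewrite ltrBlDr ltrDl.
by apply: le_lt_trans (F0_lt h); rewrite fine_ge0.
Qed.

Lemma F0_lt1 (x : R) : F0 x < 1.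
Proof.
have h : x < x + 1 by rewrite ltrDl.
apply: lt_le_trans (F0_lt h) _; by rewrite -lee_fin -F0E probability_le1.
Qed.

Lemma continuous_F0 : continuous (@F0 R).
Proof.
move=> x; apply/cvgrPdist_le => e e0; near=> y.
apply: (le_trans (F0_lipschitz _ _)).
near: y; have : (fun y : R => y) @ x --> x by [].
by move/cvgrPdist_le; apply.
Unshelve. all: by end_near. Qed.

(** Intermediate value theorem; the tail bounds provide explicit points below
    and above the level p. *)
Lemma F0_quantile (p : R) : 0 < p < 1 -> exists x, F0 x = p.
Proof.
move=> /andP[p0 p1].
have tailE (q : R) : 0 < q < 1 -> exists2 t, 0 <= t & expR (- (t ^+ 2 / 2)) = q.
  move=> /andP[q0 q1]; have lq : ln q < 0 by rewrite ln_lt0// q0.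
  exists (Num.sqrt (- (2 * ln q))); first exact: sqrtr_ge0.
  rewrite sqr_sqrtr; last lra.
  by rewrite (_ : - (_ / 2) = ln q) ?lnK//; field.
have [t t0 te] := tailE p (introT andP (conj p0 p1)).
have [u u0 ue] : exists2 u, 0 <= u & expR (- (u ^+ 2 / 2)) = 1 - p.
  by apply: tailE; lra.
have h1 : F0 (- t) <= p by rewrite -te -lee_fin -F0E P0_tail_left.
have h2 : p <= F0 u.
  by have := P0_tail_right u0; rewrite P0_right lee_fin ue; lra.
have [c _ <-] : exists2 c, c \in `[- t, u] & F0 c = p; last by exists c.
apply: IVT; first lra.
  exact/continuous_subspaceT/continuous_F0.
by rewrite ge_min h1/= le_max h2 orbT.
Qed.

End standard_normal.

(** * The statistic S_n(s) in terms of counts *)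

Section order_statistics.
Context (R : realType).
Local Notation RT := (measurableTypeR R).
Local Notation hitsR A X := (@hits _ RT R A _ X).
Implicit Types (n : nat) (x : R).

Lemma hits_count (A : set RT) n (X : n.-tuple RT) :
  hitsR A X = (count (fun y => y \in A) X)%:R.
Proof.
rewrite /hits -sum1_count natr_sum [RHS]big_mkcond/=.
by apply: eq_bigr => y _; rewrite indicE; case: (y \in A).
Qed.

Lemma hits_lt_bound (A : set RT) n (X : n.-tuple RT) : 0 <= hitsR A X <= n%:R.
Proof.
rewrite hits_count ler0n ler_nat -[leqRHS](size_tuple X).
exact: count_size.
Qed.

Lemma hits_ge1 (A : set RT) n (X : n.-tuple RT) :
  (1 <= hitsR A X) = has (fun y => y \in A) X.
Proof. by rewrite hits_count ler1n has_count. Qed.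

Lemma hits_lt1 (A : set RT) n (X : n.-tuple RT) :
  hitsR A X < 1 -> hitsR A X = 0.
Proof. by rewrite hits_count ltrn1 ltnS leqn0 => /eqP ->. Qed.

Lemma hits_setC (A : set RT) n (X : n.-tuple RT) :
  hitsR (~` A) X = n%:R - hitsR A X.
Proof.
rewrite !hits_count -{2}(size_tuple X) -(count_predC (fun y => y \in A) X).
rewrite natrD addrAC subrr add0r; congr (_%:R); apply: eq_count => y /=.
by rewrite in_setC.
Qed.

Lemma hits_right x n (X : n.-tuple RT) :
  hitsR `]x, +oo[%classic X = n%:R - hitsR `]-oo, x]%classic X.
Proof. by rewrite -hits_setC setCitvl. Qed.

Lemma hits_subset (A B : set RT) n (X : n.-tuple RT) :
  A `<=` B -> hitsR A X <= hitsR B X.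
Proof.
move=> AB; rewrite !hits_count ler_nat; apply: sub_count => y.
by rewrite !inE; exact: AB.
Qed.

Lemma empirical_cdf_hits n (X : n.-tuple RT) x :
  empirical_cdf X x = hitsR `]-oo, x]%classic X / n%:R.
Proof.
rewrite /empirical_cdf /hits big_tuple; congr (_ / _).
apply: eq_bigr => i _; rewrite indicE; congr ((_ : bool)%:R).
by apply/idP/idP; rewrite inE/= in_itv.
Qed.

Let sorted_sort (s : seq R) : sorted <=%R (sort <=%R s).
Proof. by apply: sort_sorted; exact: le_total. Qed.

Lemma order_stat1_le n (X : n.-tuple RT) x : (0 < n)%N ->
  (order_stat X 1 <= x) = (1 <= hitsR `]-oo, x]%classic X).
Proof.
move=> n0; rewrite hits_ge1 /order_stat/=.
have sz : (0 < size (sort <=%R (X : seq R)))%N by rewrite size_sort size_tuple.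
apply/idP/idP => [h|/hasP[y yX]].
  apply/hasP; exists (nth 0 (sort <=%R (X : seq R)) 0).
    by rewrite -(mem_sort <=%R); exact: mem_nth.
  by rewrite inE/= in_itv.
rewrite inE/= in_itv/=; apply: le_trans.
move: yX; rewrite -(mem_sort <=%R) => yX.
have e := nth_index 0 yX.
rewrite -[leRHS]e; apply: (sorted_leq_nth le_trans le_refl _ (sorted_sort _)) => //.
by rewrite inE index_mem.
Qed.

Lemma lt_order_stat n (X : n.-tuple RT) x : (0 < n)%N ->
  (x < order_stat X n) = (1 <= hitsR `]x, +oo[%classic X).
Proof.
move=> n0; rewrite hits_ge1 /order_stat/=.
have sz : size (sort <=%R (X : seq R)) = n by rewrite size_sort size_tuple.
have n1 : (n.-1 < n)%N by rewrite prednK.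
apply/idP/idP => [h|/hasP[y yX]].
  apply/hasP; exists (nth 0 (sort <=%R (X : seq R)) n.-1).
    by rewrite -(mem_sort <=%R); apply: mem_nth; rewrite sz.
  by rewrite inE/= in_itv/= andbT.
rewrite inE/= in_itv/= andbT => xy; apply: (lt_le_trans xy).
move: yX; rewrite -(mem_sort <=%R) => yX.
have e := nth_index 0 yX.
rewrite -[leLHS]e; apply: (sorted_leq_nth le_trans le_refl _ (sorted_sort _)) => //.
- by rewrite inE index_mem.
- by rewrite inE sz.
- by move: yX; rewrite -index_mem sz -[in X in _ -> X]ltnS prednK.
Qed.

(** This covers n = 0 too: there the order statistics take the default
    value 0 and neither side can hold. *)
Lemma sample_range n (X : n.-tuple RT) x :
  (order_stat X 1 <= x < order_stat X n) =
  (1 <= hitsR `]-oo, x]%classic X <= n%:R - 1).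
Proof.
case: n X => [|n] X.
  have e k : order_stat X k = 0.
    by rewrite /order_stat nth_default// size_sort size_tuple.
  rewrite !e; transitivity false; [|symmetry]; apply/negP => /andP[h1 h2].
    by have := le_lt_trans h1 h2; rewrite ltxx.
  by have := le_trans h1 h2; lra.
rewrite order_stat1_le// lt_order_stat// hits_right.
by congr (_ && _); apply/idP/idP; lra.
Qed.

(** All properties of S_n(s) are derived from this description, in which the
    sample only enters through the counting function. *)
Lemma S_stat_gtP s n (X : n.-tuple RT) (c : \bar R) :
  (c < S_stat s X)%E <->
  exists2 x, 1 <= hitsR `]-oo, x]%classic X <= n%:R - 1 &
    (c < K_div s (hitsR `]-oo, x]%classic X / n%:R) (F0 x))%E.
Proof.
rewrite /S_stat; split.
  move=> /ereal_sup_gt[_ [x xr <-] cx]; exists x.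
    by rewrite -sample_range.
  by rewrite -empirical_cdf_hits.
move=> [x xr cx]; apply: (lt_le_trans cx); apply: ereal_sup_ubound.
by exists x; [rewrite /= sample_range|rewrite empirical_cdf_hits].
Qed.

Lemma hits_right_constant n (X : n.-tuple RT) x :
  exists2 e, 0 < e & forall y, x <= y < x + e ->
    hitsR `]-oo, y]%classic X = hitsR `]-oo, x]%classic X.
Proof.
suff [e e0 He] : exists2 e, 0 < e & forall z, z \in (X : seq R) -> x < z -> x + e <= z.
  exists e => // y /andP[xy ye]; rewrite !hits_count; congr (_%:R).
  apply: eq_in_count => z zX; apply/idP/idP; rewrite !inE/= !in_itv/=.
    move=> zy; rewrite leNgt; apply/negP => /(He _ zX) h.
    by have := lt_le_trans ye (le_trans h zy); rewrite ltxx.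
  by move=> zx; exact: le_trans xy.
elim: (X : seq R) => [|a s [e e0 He]]; first by exists 1.
have [xa|ax] := ltP x a; last first.
  exists e => // z; rewrite inE => /orP[/eqP ->|]; last exact: He.
  by rewrite ltNge ax.
exists (Num.min e (a - x)); first by rewrite lt_min e0 subr_gt0.
move=> z; rewrite inE => /orP[/eqP -> _|zs xz].
  by rewrite -lerBrDl ge_min lexx orbT.
apply: (le_trans _ (He z zs xz)); by rewrite lerD2l ge_min lexx.
Qed.

Lemma continuous_phi_real s (x : R) : 0 < x -> {for x, continuous (phi_real s)}.
Proof.
move=> x0; apply: differentiable_continuous; apply/derivable1_diffP.
by have [] := is_derive_phi s x0.
Qed.

Lemma K_div_near_gt s u (x : R) (c : \bar R) : 0 < u < 1 ->
  (c < K_div s u (F0 x))%E ->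
  exists2 e, 0 < e & forall y, x <= y < x + e -> (c < K_div s u (F0 y))%E.
Proof.
move=> u01; have /andP[u0 u1] := u01.
have v01 (y : R) : 0 < F0 y < 1 by rewrite F0_gt0 F0_lt1.
pose k y := F0 y * phi_real s (u / F0 y) +
  (1 - F0 y) * phi_real s ((1 - u) / (1 - F0 y)).
have kE y : K_div s u (F0 y) = (k y)%:E by rewrite K_divE.
have F0x : {for x, continuous (@F0 R)} by exact: continuous_F0.
have ck : k @ x --> k x.
  have f0 := F0_gt0 x; have f1 := F0_lt1 x.
  have c1 : u / F0 y @[y --> x] --> u / F0 x.
    by apply: cvgM; [exact: cvg_cst|apply: cvgV => //; rewrite gt_eqF].
  have c2 : (1 - F0 y) @[y --> x] --> 1 - F0 x.
    by apply: cvgB => //; exact: cvg_cst.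
  have c3 : (1 - u) / (1 - F0 y) @[y --> x] --> (1 - u) / (1 - F0 x).
    apply: cvgM; first exact: cvg_cst.
    by apply: cvgV => //; rewrite gt_eqF// subr_gt0.
  apply: cvgD; apply: cvgM => //.
    apply: (cvg_comp _ _ c1); apply: continuous_phi_real.
    by rewrite divr_gt0.
  apply: (cvg_comp _ _ c3); apply: continuous_phi_real.
  by rewrite divr_gt0 ?subr_gt0.
rewrite kE; case: c => [c| |]//; last first.
  by move=> _; exists 1 => // y _; rewrite kE ltNyr.
rewrite lte_fin => ckx.
have : \forall y \near x, c < k y by apply: cvgr_gt ck _ _.
move=> /nbhs_ballP[e /= e0 He]; exists e => // y /andP[xy ye].
rewrite kE lte_fin; apply: He; rewrite /ball/= distrC ger0_norm ?subr_ge0//.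
by rewrite ltrBlDl.
Qed.

(** The supremum over all real x may be restricted to rational x: the counting
    function is constant just to the right of x and K_s is continuous in its
    second argument, so a value above c is still above c at a rational point a
    little to the right.  For a fixed rational q only the count of the points
    up to q matters, which takes integer values k. *)
Lemma measurable_S_stat_gt s n (c : \bar R) :
  measurable [set X : n.-tuple RT | (c < S_stat s X)%E].
Proof.
have -> : [set X : n.-tuple RT | (c < S_stat s X)%E] =
  \bigcup_(q : rat) \bigcup_(k : nat)
    ([set X | hitsR `]-oo, (ratr q : R)]%classic X = k%:R] `&`
     [set X : n.-tuple RT | (1 <= (k%:R : R) <= n%:R - 1) /\
       (c < K_div s (k%:R / n%:R) (F0 (ratr q)))%E]).
  apply/seteqP; split => X /=.
    move=> /S_stat_gtP[x xr cx].
    have /andP[h1 h2] := xr.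
    have n0 : 0 < n%:R :> R by lra.
    have u01 : 0 < hitsR `]-oo, x]%classic X / n%:R < 1.
      by rewrite divr_gt0 ?ltr_pdivrMr ?mul1r//; lra.
    have [e1 e10 H1] := hits_right_constant X x.
    have [e2 e20 H2] := K_div_near_gt u01 cx.
    have [|q] := @rat_in_itvoo R x (x + Num.min e1 e2).
      by rewrite ltrDl lt_min e10.
    rewrite in_itv/= => /andP[xq qx].
    have q1 : x <= ratr q < x + e1.
      by rewrite ltW//= (lt_le_trans qx)// lerD2l ge_min lexx.
    have q2 : x <= ratr q < x + e2.
      by rewrite ltW//= (lt_le_trans qx)// lerD2l ge_min lexx orbT.
    pose k := count (fun y => y \in `]-oo, (ratr q : R)]%classic) X.
    have hk : hitsR `]-oo, (ratr q : R)]%classic X = k%:R by rewrite hits_count.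
    exists q; first exact: I.
    exists k; first exact: I.
    split; first exact: hk.
    by split; rewrite -hk (H1 _ q1); [exact: xr|exact: H2].
  move=> [q _ [k _ [/= hk [kn cK]]]]; apply/S_stat_gtP.
  by exists (ratr q); rewrite hk.
apply: bigcupT_measurable_rat => q; apply: bigcupT_measurable => k.
apply: measurableI; last first.
  set P := (X in [set _ | X]).
  have [p|np] := pselect P.
    by rewrite (_ : [set _ | _] = setT)//; apply/seteqP; split.
  by rewrite (_ : [set _ | _] = set0)//; apply/seteqP; split.
rewrite -[X in measurable X]setTI.
have mA : measurable (`]-oo, (ratr q : R)]%classic : set RT).
  exact: measurable_itv.
exact: (@measurable_hits _ RT R _ n mA measurableT _ (measurable_set1 (k%:R : R))).
Qed.

Lemma is_test_S_stat s n (c : \bar R) :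
  is_test (\1_[set X : n.-tuple RT | (c < S_stat s X)%E] : n.-tuple RT -> R).
Proof. by apply: is_test_indic; exact: measurable_S_stat_gt. Qed.

End order_statistics.

(** * The statistic S_n(s) under the null hypothesis *)

Section sandwich.
Context (R : realType).
Implicit Types y w r N v : R.
Local Notation dev_scale := (@dev_scale R).

Lemma dev_scale_le y w : y <= w -> dev_scale y <= dev_scale w.
Proof.
move=> yw; rewrite /dev_scale ge_max le_max ler_wsqrtr//=.
by rewrite le_max lexx orbT.
Qed.

Lemma dev_scale_add1 y : 0 <= y -> dev_scale (y + 1) <= 2 * dev_scale y.
Proof.
move=> y0; have d1 := dev_scale_ge1 y; have d2 := dev_scale_sqr_ge y0.
rewrite {1}/dev_scale ge_max; apply/andP; split; last lra.
rewrite -(@ger0_norm _ (2 * dev_scale y)); last lra.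
rewrite -sqrtr_sqr ler_sqrt; nra.
Qed.

Lemma dev_scale_le_mul y r : 1 <= r -> r^-1 <= y -> dev_scale y <= r * y.
Proof.
move=> r1 ry; have r0 : 0 < r by lra.
have y0 : 0 < y by apply: lt_le_trans ry; rewrite invr_gt0.
have yr : 1 <= r * y by rewrite mulrC -ler_pdivrMr// mul1r.
rewrite /dev_scale ge_max yr andbT.
rewrite -(@ger0_norm _ (r * y)); last lra.
rewrite -sqrtr_sqr ler_sqrt; nra.
Qed.

Lemma dev_scale_sqr_le y r : 1 <= r -> r^-1 <= y -> dev_scale y ^+ 2 <= r * y.
Proof.
move=> r1 ry; have r0 : 0 < r by lra.
have y0 : 0 < y by apply: lt_le_trans ry; rewrite invr_gt0.
have yr : 1 <= r * y by rewrite mulrC -ler_pdivrMr// mul1r.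
rewrite /dev_scale /Num.max; case: ifP => _; first by rewrite expr1n.
by rewrite (sqr_sqrtr (ltW y0)); nra.
Qed.

(** Here y is the expected and N the observed number of points in a tail.  If y
    is below 36 r^2 the bounds y >= 1 / r and N >= 1 already control the ratio;
    above this value the fluctuation 3 r sqrt y is at most y / 2. *)
Lemma count_ratio y N r : 1 <= r -> r^-1 <= y -> 1 <= N ->
  `|N - y| <= 3 * r * dev_scale y ->
  (36 * r ^+ 2)^-1 <= N / y <= 36 * r ^+ 2.
Proof.
move=> r1 ry N1; rewrite ler_norml => /andP[h1 h2].
have r0 : 0 < r by lra.
have rr : 1 <= r ^+ 2 by nra.
have y0 : 0 < y by apply: lt_le_trans ry; rewrite invr_gt0.
have dy := dev_scale_le_mul r1 ry.
apply/andP; split; last first.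
  rewrite ler_pdivrMr//.
  have : 3 * r * dev_scale y <= 3 * r * (r * y) by rewrite ler_wpM2l//; lra.
  have -> : 3 * r * (r * y) = 3 * (r ^+ 2 * y) by ring.
  have : y <= r ^+ 2 * y by rewrite ler_pMl.
  lra.
rewrite ler_pdivlMr// mulrC ler_pdivrMr; last lra.
have [yr|yr] := leP y (36 * r ^+ 2).
  by apply: (le_trans yr); rewrite ler_pMl//; lra.
have sy : 6 * r <= Num.sqrt y.
  rewrite -(@ger0_norm _ (6 * r)); last lra.
  rewrite -sqrtr_sqr ler_sqrt//; nra.
have dE : dev_scale y = Num.sqrt y.
  by rewrite /dev_scale; apply/max_idPl; lra.
rewrite dE in h1 h2.
have sq : Num.sqrt y * Num.sqrt y = y by rewrite -expr2 sqr_sqrtr// ltW.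
have : 6 * r * Num.sqrt y <= y by rewrite -{2}sq ler_wpM2r// sqrtr_ge0.
nra.
Qed.

(** The higher criticism score, squared and divided by n.  The factor r beyond
    the square of the fluctuation comes from the range where the expected count
    is between 1 / r and 1. *)
Lemma quadratic_bound (n v N r : R) : 0 < n -> 0 < v < 1 -> 1 <= r ->
  r^-1 <= n * Num.min v (1 - v) ->
  `|N - n * v| <= 3 * r * dev_scale (n * Num.min v (1 - v)) ->
  (N / n - v) ^+ 2 / (v * (1 - v)) <= 18 * r ^+ 3 / n.
Proof.
move=> n0 /andP[v0 v1] r1; set w := Num.min v (1 - v) => rw h.
have r0 : 0 < r by lra.
have w0 : 0 < w by rewrite lt_min v0 subr_gt0.
have wv : w <= 2 * (v * (1 - v)).
  by rewrite /w /Num.min; case: ifP => h'; nra.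
have vv : 0 < v * (1 - v) by rewrite mulr_gt0// subr_gt0.
have d0 : 0 <= dev_scale (n * w) by have := dev_scale_ge1 (n * w); lra.
have h2 : (N - n * v) ^+ 2 <= 9 * r ^+ 2 * (r * (n * w)).
  rewrite -real_normK ?num_real//.
  apply: (@le_trans _ _ ((3 * r * dev_scale (n * w)) ^+ 2)).
    by rewrite lerXn2r// nnegrE// mulr_ge0//; lra.
  rewrite exprMn (_ : (3 * r) ^+ 2 = 9 * r ^+ 2); last by ring.
  by rewrite ler_wpM2l ?dev_scale_sqr_le//; nra.
rewrite ler_pdivrMr// (_ : N / n - v = (N - n * v) / n); last first.
  by field; rewrite gt_eqF.
rewrite expr_div_n ler_pdivrMr ?exprn_gt0//.
apply: (le_trans h2).
have -> : 18 * r ^+ 3 / n * (v * (1 - v)) * n ^+ 2 =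
    9 * r ^+ 3 * n * (2 * (v * (1 - v))) by field; rewrite gt_eqF.
have -> : 9 * r ^+ 2 * (r * (n * w)) = 9 * r ^+ 3 * n * w by ring.
by rewrite ler_wpM2l// !mulr_ge0 ?exprn_ge0 ?ltW.
Qed.

End sandwich.

Lemma hits_le_right (R : realType) n (X : n.-tuple (measurableTypeR R)) (x y : R) :
  x <= y -> hits `]-oo, x]%classic X <= hits `]-oo, y]%classic X :> R.
Proof. by move=> xy; apply: hits_subset; apply: subset_itvl; rewrite bnd_simp. Qed.

Section S_stat_null.
Context (R : realType).
Local Notation RT := (measurableTypeR R).
Local Notation hitsR A X := (@hits _ RT R A _ X).
Variables (n : nat) (s r : R).
Hypotheses (n2 : (2 <= n)%N) (r1 : 1 <= r).

Let nR : R := n%:R.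
Let nR2 : 2 <= nR. Proof. by rewrite ler_nat. Qed.
Let nR0 : 0 < nR. Proof. exact: lt_le_trans nR2. Qed.
Let r0 : 0 < r. Proof. exact: lt_le_trans r1. Qed.

(** The critical value: K_div_le with ratio bound 36 r^2 and score bound
    18 r^3 / n.  It is 1 / n up to a power of r, and r is later a small power
    of n. *)
Definition null_level : R :=
  (36 * r ^+ 2) `^ `|s - 2| * (18 * r ^+ 3) / nR.

Let wmin (v : R) := Num.min v (1 - v).

Let grid_ok (X : n.-tuple RT) (q : R) := `|hitsR `]-oo, q]%classic X - nR * F0 q| <=
  r * dev_scale (nR * wmin (F0 q)).

(** Control at the quantiles of level j / n extends to all x: between two
    consecutive quantiles the counting function is monotone and its mean moves
    by at most one. *)
Let between (X : n.-tuple RT) (q : nat -> R) (x : R) :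
  (forall j, (0 < j < n)%N -> F0 (q j) = j%:R / nR) ->
  (forall j, (0 < j < n)%N -> grid_ok X (q j)) ->
  `|hitsR `]-oo, x]%classic X - nR * F0 x| <=
    3 * r * dev_scale (nR * wmin (F0 x)).
Proof.
move=> qE ok; set N := hits _ _; set v := F0 x.
have /andP[v0 v1] : 0 < v < 1 by rewrite F0_gt0 F0_lt1.
have w0 : 0 <= nR * wmin v by rewrite mulr_ge0 ?ltW// lt_min v0 subr_gt0.
set D := dev_scale _.
have D1 : 1 <= D by exact: dev_scale_ge1.
have rD : 1 <= r * D by rewrite -[leLHS]mulr1 ler_pM.
have step j : (0 < j < n)%N -> - 1 <= j%:R - nR * v -> j%:R - nR * v <= 1 ->
    r * dev_scale (nR * wmin (F0 (q j))) <= 2 * (r * D).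
  move=> jn h1 h2.
  rewrite mulrCA ler_pM2l//; apply: le_trans (dev_scale_add1 w0).
  apply: dev_scale_le; rewrite qE// /wmin.
  rewrite !minr_pMr ?(ltW nR0)// !mulrBr mulr1 [nR * (_ / _)]mulrCA divff ?gt_eqF// mulr1.
  rewrite /Num.min; case: ifP => h3; case: ifP => h4; lra.
have [/andP[N0 Nn]] : 0 <= N <= nR by exact: hits_lt_bound.
pose j := Num.truncn (nR * v).
have /andP[jv vj] : j%:R <= nR * v < j.+1%:R.
  by apply: truncn_itv; rewrite mulr_ge0//; exact: ltW.
rewrite ler_norml; apply/andP; split.
  have [j0|j0] := posnP j; first by rewrite j0 in vj; lra.
  have jn : (0 < j < n)%N.
    by rewrite j0 -(ltr_nat R) (le_lt_trans jv)// gtr_pMr.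
  have qx : q j <= x.
    rewrite leNgt; apply/negP => /F0_lt; rewrite qE//.
    by rewrite ltr_pdivlMr// mulrC ltNge jv.
  have := ok _ jn; rewrite /grid_ok ler_norml => /andP[h1 _].
  rewrite -natr1 in vj.
  have h2 : r * dev_scale (nR * wmin (F0 (q j))) <= 2 * (r * D).
    by apply: step => //; lra.
  have hN : hitsR `]-oo, q j]%classic X <= N by exact: hits_le_right.
  rewrite qE// in h1 h2; rewrite [nR * (_ / _)]mulrCA divff ?gt_eqF// mulr1 in h1.
  move: N {N0 Nn} hN h1 => N hN h1; move: (hits _ _) hN h1 => H hN h1.
  move: (dev_scale _) h1 h2 => d h1 h2.
  rewrite -[3 * r * D]mulrA; move: (nR * v) (r * D) rD jv vj h2 => y E E1 jv vj h2.
  move: (j%:R) jv vj h1 => J jv vj h1.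
  lra.
have [jn|nj] := ltnP j.+1 n; last first.
  have : nR <= j.+1%:R by rewrite ler_nat.
  rewrite -natr1; lra.
have jn' : (0 < j.+1 < n)%N by [].
have xq : x <= q j.+1.
  rewrite leNgt; apply/negP => /F0_lt; rewrite qE//.
  by rewrite ltr_pdivrMr// mulrC ltNge (ltW vj).
have := ok _ jn'; rewrite /grid_ok ler_norml => /andP[_ h1].
have h2 : r * dev_scale (nR * wmin (F0 (q j.+1))) <= 2 * (r * D).
  by rewrite -natr1 in vj; apply: step => //; rewrite -natr1; lra.
have hN : N <= hitsR `]-oo, q j.+1]%classic X by exact: hits_le_right.
rewrite qE// in h1 h2; rewrite [nR * (_ / _)]mulrCA divff ?gt_eqF// mulr1 in h1.
rewrite -natr1 in vj h1; rewrite -natr1 in h2.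
move: N {N0 Nn} hN h1 => N hN h1; move: (hits _ _) hN h1 => H hN h1.
move: (dev_scale _) h1 h2 => d h1 h2.
rewrite -[3 * r * D]mulrA; move: (nR * v) (r * D) rD vj jv h2 => y E E1 vj jv h2.
move: (j%:R) vj jv h1 => J vj jv h1.
lra.
Qed.

Let dev_prob (q : R) : (power_prob (P0 R) n
    [set X | (r * dev_scale (nR * wmin (F0 q)) <=
              `|hitsR `]-oo, q]%classic X - nR * F0 q|)%R] <= (2 * expR ((1 - r) / 2))%:E)%E.
Proof.
rewrite /wmin /Num.min; case: ifP => _.
  exact: (hits_concentration (P0 R) n r (A := `]-oo, q]%classic)).
have e := hits_concentration (P0 R) n r (A := `]q, +oo[%classic).
rewrite P0_right/= in e.
have -> : [set X : n.-tuple RT | r * dev_scale (nR * (1 - F0 q)) <=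
    `|hitsR `]-oo, q]%classic X - nR * F0 q|] =
  [set t | r * dev_scale (n%:R * (1 - F0 q)) <=
    `|hitsR `]q, +oo[%classic t - n%:R * (1 - F0 q)|].
  have e2 (X : n.-tuple RT) : hitsR `]q, +oo[%classic X - n%:R * (1 - F0 q) =
      - (hitsR `]-oo, q]%classic X - nR * F0 q).
    by rewrite hits_right /nR; ring.
  by apply/seteqP; split => X /=; rewrite e2 normrN.
exact: e.
Qed.

(** Outside an event of small probability no point has F0-value below 1 / (n r)
    or above 1 - 1 / (n r), and the counts at all the quantiles of level j / n
    deviate from their means by at most r times their natural scale.  Then
    K_s is below the critical value on the whole range of the sample. *)
Lemma S_stat_null_prob :
  (power_prob (P0 R) n [set X | null_level%:E < S_stat s X] <=
   (2 / r + n%:R * (2 * expR ((1 - r) / 2)))%:E)%E.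
Proof.
have nr1 : 0 < (nR * r)^-1 < 1.
  have h : 2 * 1 <= nR * r by rewrite ler_pM.
  by rewrite invr_gt0 mulr_gt0//= invf_lt1 ?mulr_gt0//; lra.
have /andP[nr0 nr1'] := nr1.
(* Quantiles of level j / n; the value at the other indices is arbitrary. *)
have [q qE] : exists q : nat -> R, forall j, (0 < j < n)%N -> F0 (q j) = j%:R / nR.
  have : forall j, exists y : R, (0 < j < n)%N -> F0 y = j%:R / nR.
    move=> j; have [/andP[j0 jn]|_] := boolP (0 < j < n)%N; last by exists 0.
    have [|y ye] := @F0_quantile R (j%:R / nR); last by exists y.
    apply/andP; split; first by rewrite divr_gt0// ltr0n.
    by rewrite ltr_pdivrMr// mul1r ltr_nat.
  by move=> /choice[q qE]; exists q.
have [a aE] := F0_quantile nr1.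
have [b bE] : exists b, F0 b = 1 - (nR * r)^-1.
  by apply: F0_quantile; lra.
pose A1 := [set X : n.-tuple RT | 1 <= hitsR `]-oo, a]%classic X].
pose A2 := [set X : n.-tuple RT | 1 <= hitsR `]b, +oo[%classic X].
pose B (j : nat) := [set X : n.-tuple RT | r * dev_scale (nR * wmin (F0 (q j))) <=
       `|hitsR `]-oo, (q j)]%classic X - nR * F0 (q j)|].
have mB j : measurable (B j).
  apply: measurable_superlevel; apply: measurableT_comp => //.
  by apply: measurable_funB => //; exact: measurable_hits.
have mA1 : measurable A1 by apply: measurable_superlevel; exact: measurable_hits.
have mA2 : measurable A2 by apply: measurable_superlevel; exact: measurable_hits.
have mBU : measurable (\big[setU/set0]_(j < n) B j) by apply: bigsetU_measurable.
apply: (@le_trans _ _ (power_prob (P0 R) n ((A1 `|` A2) `|` \big[setU/set0]_(j < n) B j))).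
  apply: le_measure; rewrite ?inE.
  - exact: measurable_S_stat_gt.
  - by apply: measurableU => //; exact: measurableU.
  move=> X /=; apply: contraPP => bad; apply/negP; rewrite -leNgt leNgt; apply/negP.
  move=> /S_stat_gtP[x /andP[x1 xn]]; apply/negP; rewrite -leNgt.
  have nA1 : hitsR `]-oo, a]%classic X < 1.
    by rewrite ltNge; apply/negP => h; apply: bad; left; left.
  have nA2 : hitsR `]b, +oo[%classic X < 1.
    by rewrite ltNge; apply/negP => h; apply: bad; left; right.
  have nB j : (0 < j < n)%N -> grid_ok X (q j).
    move=> /andP[j0 jn]; rewrite /grid_ok leNgt; apply/negP => /ltW h; apply: bad; right.
    by rewrite -bigcup_mkord; exists j.
  have ax : a <= x.
    rewrite leNgt; apply/negP => /ltW /(hits_le_right X) h.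
    by have := le_lt_trans h nA1; rewrite ltNge x1.
  have xb : x <= b.
    rewrite leNgt; apply/negP => /ltW /(hits_le_right X) h.
    by rewrite hits_right in nA2; move: h nA2 xn => /=; lra.
  set N := hits _ _ in x1 xn *.
  have dev := @between X q x qE nB.
  rewrite -/N in dev.
  have av := F0_le ax; rewrite aE in av.
  have vb := F0_le xb; rewrite bE in vb.
  set v := F0 x in dev av vb *.
  have v01 : 0 < v < 1 by rewrite F0_gt0 F0_lt1.
  have /andP[v0 v1] := v01.
  have er : r^-1 = nR * (nR * r)^-1 by field; rewrite !gt_eqF.
  have rnv : r^-1 <= nR * v by rewrite er ler_pM2l.
  have rnw : r^-1 <= nR * (1 - v) by rewrite er ler_pM2l//; lra.
  have wv : wmin v <= v by rewrite /wmin ge_min lexx.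
  have ww : wmin v <= 1 - v by rewrite /wmin ge_min lexx orbT.
  have u01 : 0 < N / nR < 1.
    by rewrite divr_gt0 ?ltr_pdivrMr ?mul1r//; rewrite /nR; lra.
  have dle y : wmin v <= y -> 3 * r * dev_scale (nR * wmin v) <= 3 * r * dev_scale (nR * y).
    by move=> wy; rewrite ler_wpM2l ?mulr_ge0 ?(ltW r0)// dev_scale_le// ler_pM2l.
  have R1 := count_ratio r1 rnv x1 (le_trans dev (dle _ wv)).
  have R2 : (36 * r ^+ 2)^-1 <= (nR - N) / (nR * (1 - v)) <= 36 * r ^+ 2.
    apply: count_ratio => //; first by rewrite /nR; lra.
    apply: le_trans (dle _ ww); rewrite distrC.
    by rewrite (_ : _ - _ = N - nR * v)//; ring.
  have l1 : 1 <= 36 * r ^+ 2 by have := r1; nra.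
  have rnwm : r^-1 <= nR * wmin v.
    by rewrite /wmin /Num.min; case: ifP.
  have Q := quadratic_bound nR0 v01 r1 rnwm dev.
  apply: (le_trans (K_div_le s u01 v01 l1 _ _)).
  - by rewrite -mulrA -invfM.
  - have -> // : (1 - N / nR) / (1 - v) = (nR - N) / (nR * (1 - v)).
    have v10 : 1 - v != 0 by rewrite subr_eq0 gt_eqF.
    by field; apply/andP; split => //; exact: lt0r_neq0 nR0.
  - by rewrite lee_fin /null_level -[leRHS]mulrA; exact: (ler_wpM2l (powR_ge0 _ _) Q).
apply: (le_trans (measureU2 _ _ _)) => //; first exact: measurableU.
rewrite EFinD; apply: leeD.
  apply: (le_trans (measureU2 _ _ _)) => //.
  rewrite (_ : 2 / r = r^-1 + r^-1); last by field; rewrite gt_eqF.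
  rewrite EFinD; apply: leeD.
    apply: (le_trans (hits_nonzero_le (P0 R) n (A := `]-oo, a]%classic) _)) => //.
    rewrite -/nR -[fine _]/(F0 a) aE lee_fin le_eqVlt; apply/orP; left; apply/eqP.
    by field; rewrite !gt_eqF.
  apply: (le_trans (hits_nonzero_le (P0 R) n (A := `]b, +oo[%classic) _)) => //.
  rewrite P0_right/= -/nR bE lee_fin le_eqVlt; apply/orP; left; apply/eqP.
  by field; rewrite !gt_eqF.
apply: (le_trans (Boole_inequality _ _)) => //.
apply: (@le_trans _ _ (\sum_(j < n) (2 * expR ((1 - r) / 2))%:E)%E).
  by apply: lee_sum => j _; exact: dev_prob.
by rewrite sumEFin lee_fin sumr_const card_ord [leRHS]mulr_natl.
Qed.

End S_stat_null.
(** * The statistic S_n(s) when one tail carries too much mass *)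

Section S_stat_alternative.
Context (R : realType).
Local Notation RT := (measurableTypeR R).
Local Notation hitsR A X := (@hits _ RT R A _ X).

Lemma hits_pos_ge1 (A : set RT) n (X : n.-tuple RT) :
  0 < hitsR A X -> 1 <= hitsR A X.
Proof. by move=> h; rewrite leNgt; apply/negP => /hits_lt1 e; rewrite e ltxx in h. Qed.

Lemma hits_lt_le (A : set RT) n (X : n.-tuple RT) :
  hitsR A X < n%:R -> hitsR A X <= n%:R - 1.
Proof.
move=> h; have := @hits_pos_ge1 (~` A) n X; rewrite hits_setC subr_gt0 => /(_ h).
by lra.
Qed.

(** If under Q the mass p of a half-line exceeds its null mass v by much more
    than the fluctuations, then the empirical mass is with high probability
    above the midpoint of v and p, and it is below 1, so that x lies in the
    range of the sample and K_s is large at x. *)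
Lemma S_stat_alt_prob (Q : probability RT R) (n : nat) (s r c x : R) (right : bool) :
  let A : set RT := if right then `]x, +oo[%classic else `]-oo, x]%classic in
  let v := if right then 1 - F0 x else F0 x in
  let p := fine (Q A) in
  (0 < n)%N -> v < p ->
  r * dev_scale (n%:R * p) <= n%:R * ((p - v) / 2) ->
  r * dev_scale (n%:R * p) <= n%:R * (1 - p) ->
  c < phi_curv s / 4 * Num.min (((p - v) / 2) ^+ 2 / v) ((p - v) / 2) ->
  (power_prob Q n (~` [set X | c%:E < S_stat s X]) <=
   (2 * expR ((1 - r) / 2))%:E)%E.
Proof.
move=> A v p n0 vp rd r1p cK.
have nR0 : 0 < n%:R :> R by rewrite ltr0n.
have mA : measurable A by rewrite /A; case: (right).
have v01 : 0 < v < 1.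
  have f0 := F0_gt0 x; have f1 := F0_lt1 x.
  by rewrite /v; case: (right); lra.
apply: le_trans (hits_concentration Q n r mA); apply: le_measure; rewrite ?inE.
- by apply: measurableC; exact: measurable_S_stat_gt.
- apply: measurable_superlevel; apply: measurableT_comp => //.
  by apply: measurable_funB => //; exact: measurable_hits.
move=> X /=; apply: contra_notP => /negP; rewrite -ltNge -/p => dev.
have [d1 d2] : n%:R * (v + (p - v) / 2) < hitsR A X /\ hitsR A X < n%:R.
  by move: dev; rewrite ltr_norml => /andP[h1 h2]; split; nra.
have u1 : v + (p - v) / 2 < hitsR A X / n%:R by rewrite ltr_pdivlMr// mulrC.
have u2 : hitsR A X / n%:R < 1 by rewrite ltr_pdivrMr// mul1r.
have h1 : 1 <= hitsR A X.
  by apply: hits_pos_ge1; apply: lt_trans d1; rewrite mulr_gt0//; lra.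
have h2 : hitsR A X <= n%:R - 1 by exact: hits_lt_le.
set u := hitsR A X / n%:R in u1 u2 *.
have u01 : 0 < u < 1 by apply/andP; split => //; lra.
have /andP[v0 v1] := v01.
have vu : v <= u by lra.
have Kc : (c%:E < K_div s u v)%E.
  apply: lt_le_trans (K_div_ge s u01 v01 vu); rewrite lte_fin.
  apply: (lt_le_trans cK); rewrite ler_pM2l ?divr_gt0 ?phi_curv_gt0//.
  have a1 : (p - v) / 2 <= u - v by lra.
  have a2 : ((p - v) / 2) ^+ 2 / v <= (u - v) ^+ 2 / v.
    by rewrite ler_pM2r ?invr_gt0// lerXn2r ?nnegrE//; lra.
  by rewrite le_min !ge_min a1 a2 orbT.
apply/S_stat_gtP; exists x.
  move: h1 h2; rewrite /A; case: (right) => h1 h2; last by rewrite h1.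
  by rewrite hits_right in h1 h2; apply/andP; split; lra.
move: Kc; rewrite /u /v /A; case: (right) => //; rewrite hits_right => Kc.
(* The right tail is the left tail after u -> 1 - u and v -> 1 - v. *)
rewrite -K_divC; move: Kc; congr (_ < K_div _ _ _)%E.
by field; exact: lt0r_neq0.
Qed.

End S_stat_alternative.
(** * Separation by S_n(s) from an excess in one tail *)

Section asymptotics.
Context (R : realType).
Implicit Types (a b K e : R).

Lemma ln_nat_large K : \forall n \near \oo, K <= ln (n%:R : R).
Proof.
near=> n; rewrite -[leLHS]expRK ler_ln ?posrE ?expR_gt0//; last first.
  apply: (lt_le_trans (expR_gt0 K)).
  by near: n; exact: nbhs_infty_ger.
by near: n; exact: nbhs_infty_ger.
Unshelve. all: by end_near. Qed.

(** Powers of n are written as exponentials of multiples of ln n: a strictly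
    larger exponent absorbs every constant. *)
Lemma expR_ln_dominates a b K : a < b ->
  \forall n \near \oo, K * expR (a * ln (n%:R : R)) <= expR (b * ln (n%:R : R)).
Proof.
move=> ab; have ba : 0 < b - a by rewrite subr_gt0.
near=> n; set L := ln _.
have -> : b * L = (b - a) * L + a * L by ring.
rewrite expRD ler_pM2r ?expR_gt0//; apply: le_trans (expR_ge1Dx _).
have : K / (b - a) <= L by rewrite ?/L; near: n; exact: ln_nat_large.
by rewrite ler_pdivrMr// mulrC => h; lra.
Unshelve. all: by end_near. Qed.

Lemma expR_ln_large a K : 0 < a ->
  \forall n \near \oo, K <= expR (a * ln (n%:R : R)).
Proof.
move=> a0; have := expR_ln_dominates K a0.
by apply: filterS => n; rewrite mul0r expR0 mulr1.
Qed.

(** With r = n^a this is the union bound over the n quantiles; the quadratic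
    lower bound of exp(a ln n) beats the linear term ln n. *)
Lemma chernoff_term_small a e : 0 < a -> 0 < e ->
  \forall n \near \oo,
   n%:R * (2 * expR ((1 - expR (a * ln (n%:R : R))) / 2)) <= e.
Proof.
move=> a0 e0; near=> n; set L := ln _.
have n0 : 0 < n%:R :> R by rewrite ltr0n; near: n; exact: nbhs_infty_gt.
have L0 : 0 <= L by rewrite ?/L; near: n; exact: ln_nat_large.
have -> : n%:R = expR L by rewrite lnK.
have q : (a * L) ^+ 2 / 2 <= expR (a * L).
  have := @expR_ge1Dxn R (a * L) 1 (mulr_ge0 (ltW a0) L0).
  by rewrite (_ : 2`! = 2)%N//; lra.
have aL : 4 <= a ^+ 2 * L / 2.
  have : 8 / a ^+ 2 <= L by rewrite ?/L; near: n; exact: ln_nat_large.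
  by rewrite ler_pdivrMr ?exprn_gt0// mulrC; lra.
have qL : 2 * L <= expR (a * L) / 2.
  have : 4 * L <= a ^+ 2 * L / 2 * L by rewrite ler_wpM2r.
  have -> : a ^+ 2 * L / 2 * L = (a * L) ^+ 2 / 2 by ring.
  lra.
have big : 4 / e <= expR L.
  have : 4 / e <= L by rewrite ?/L; near: n; exact: ln_nat_large.
  have := expR_ge1Dx L; lra.
have h : expR L * expR ((1 - expR (a * L)) / 2) <= 2 * expR (- L).
  apply: (@le_trans _ _ (expR (1 / 2) * expR (- L))).
    by rewrite -!expRD ler_expR; lra.
  rewrite ler_pM2r ?expR_gt0//.
  have h : `|1 / 2 : R| <= 2^-1 by rewrite ger0_norm; lra.
  by apply: (le_trans (expR_le_quad h)); lra.
rewrite mulrCA.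
apply: (@le_trans _ _ (2 * (2 * expR (- L)))); first by rewrite ler_pM2l.
rewrite expRN -ler_pdivlMl// -ler_pdivlMl//.
rewrite -[leRHS]invrK lef_pV2 ?posrE ?expR_gt0//; last first.
  by rewrite invr_gt0 !mulr_gt0.
apply: le_trans big; rewrite !invfM !invrK le_eqVlt; apply/orP; left; apply/eqP.
by field; rewrite gt_eqF.
Unshelve. all: by end_near. Qed.

End asymptotics.

Section S_test.
Context (R : realType).
Local Notation RT := (measurableTypeR R).

Definition half_line (right : bool) (x : R) : set RT :=
  if right then `]x, +oo[%classic else `]-oo, x]%classic.

Lemma measurable_half_line right x : measurable (half_line right x).
Proof. by rewrite /half_line; case: right. Qed.

Lemma P0_half_line right x :
  fine (P0 R (half_line right x)) = if right then 1 - F0 x else F0 x.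
Proof. by case: right => //=; rewrite P0_right. Qed.

(** With D = n (p - v) the hypotheses give n p G <= 2 D^2, hence the scale of the
    fluctuations of the count is at most D times a constant over sqrt G. *)
Lemma tail_margins (N v p G r rho : R) : 1 <= N -> 0 < v -> v < p -> 0 < G -> 1 <= r ->
  G <= N * (p - v) -> v * G <= N * (p - v) ^+ 2 -> p <= 1 - rho ->
  8 * r ^+ 2 <= G -> r <= rho * Num.sqrt N -> 0 <= rho ->
  [/\ r * dev_scale (N * p) <= N * ((p - v) / 2),
      r * dev_scale (N * p) <= N * (1 - p) &
      G / 4 <= N * Num.min (((p - v) / 2) ^+ 2 / v) ((p - v) / 2)].
Proof.
move=> N1 v0 vp G0 r1 Gd Gv prho rG rN rho0.
have N0 : 0 < N by exact: lt_le_trans N1.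
have r0 : 0 < r by exact: lt_le_trans r1.
have p0 : 0 < p by exact: lt_trans vp.
set D := N * (p - v) in Gd.
have D0 : 0 < D by apply: lt_le_trans Gd.
have np : N * p * G <= 2 * D ^+ 2.
  have -> : N * p * G = N * (v * G) + D * G by rewrite /D; ring.
  have h1 : N * (v * G) <= D ^+ 2 by rewrite /D exprMn expr2 -mulrA ler_pM2l.
  have h2 : D * G <= D ^+ 2 by rewrite expr2 ler_pM2l.
  by rewrite mulrDl mul1r lerD.
split.
- have -> : N * ((p - v) / 2) = D / 2 by rewrite /D; ring.
  rewrite -ler_pdivlMl// /dev_scale ge_max; apply/andP; split.
    rewrite -(@ger0_norm _ (_ * (D / 2))); last first.
      by rewrite mulr_ge0 ?invr_ge0 ?divr_ge0// ltW.
    rewrite -sqrtr_sqr ler_sqrt; last exact: sqr_ge0.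
    rewrite exprMn exprVn [leRHS]mulrC ler_pdivlMr ?exprn_gt0//.
    rewrite -(ler_pM2r G0).
    have h1 := ler_wpM2r (sqr_ge0 r) np.
    have D2 : 0 <= D ^+ 2 / 4 by rewrite divr_ge0// sqr_ge0.
    have h2 := ler_wpM2r D2 rG.
    have -> : (D / 2) ^+ 2 * G = G * (D ^+ 2 / 4) by field.
    apply: le_trans h2; apply: (le_trans _ (le_trans h1 _)).
      by rewrite le_eqVlt; apply/orP; left; apply/eqP; ring.
    by rewrite le_eqVlt; apply/orP; left; apply/eqP; field.
  rewrite ler_pdivlMl// mulr1 ler_pdivlMr//.
  apply: le_trans Gd; apply: le_trans rG.
  apply: (@le_trans _ _ (8 * r)).
    by rewrite mulrC ler_pM2r// ler_nat.
  by rewrite ler_pM2l// expr2 ler_peMl// ltW.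
- have sN : Num.sqrt N * Num.sqrt N = N by rewrite -expr2 sqr_sqrtr// ltW.
  have dN : dev_scale (N * p) <= Num.sqrt N.
    rewrite /dev_scale ge_max; apply/andP; split; last first.
      by rewrite -[leLHS]sqrtr1 ler_wsqrtr.
    rewrite ler_wsqrtr// ler_piMr//; first exact: ltW.
    by apply: (le_trans prho); rewrite gerBl.
  apply: (le_trans (ler_wpM2l (ltW r0) dN)).
  apply: (@le_trans _ _ (rho * N)).
    by rewrite -[X in rho * X]sN mulrA ler_wpM2r// sqrtr_ge0.
  by rewrite mulrC ler_pM2l// lerBrDr -lerBrDl.
rewrite [leRHS]mulrC minr_pMl; last exact: ltW.
rewrite le_min; apply/andP; split.
  rewrite mulrAC ler_pdivlMr// expr_div_n mulrC.
  have -> : (p - v) ^+ 2 / 2 ^+ 2 * N = N * (p - v) ^+ 2 / 4 by field.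
  by rewrite mulrA ler_pM2r.
have -> : (p - v) / 2 * N = D / 2 by rewrite /D; ring.
apply: (@le_trans _ _ (D / 4)); first by rewrite ler_pM2r.
by rewrite ler_pM2l// lef_pV2 ?posrE ?ler_nat.
Qed.

Lemma P0_half_line_itv right x : 0 < fine (P0 R (half_line right x)) < 1.
Proof.
have f0 := F0_gt0 x; have f1 := F0_lt1 x.
by rewrite P0_half_line; case: right; rewrite ?f0// subr_gt0 f1 gtrBl.
Qed.

(** For some half-line with null mass v and mass p under Q, the excess p - v is
    at least n^g both in units of 1 / n and, after squaring, in units of the
    variance v / n.  The last condition keeps sample points outside of the
    half-line. *)
Definition detectable_tail (Q : probability RT R) (n : nat) (g rho : R) :=
  exists right x,
    let v := fine (P0 R (half_line right x)) in
    let p := fine (Q (half_line right x)) in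
    [/\ v < p, expR (g * ln n%:R) <= n%:R * (p - v),
     v * expR (g * ln n%:R) <= n%:R * (p - v) ^+ 2 & p <= 1 - rho].

Lemma error_sum_indic (P Q : probability RT R) n (A : set (n.-tuple RT)) :
  measurable A ->
  error_sum P Q (\1_A : n.-tuple RT -> R) =
  (power_prob P n A + power_prob Q n (~` A))%E.
Proof.
move=> mA; rewrite /error_sum expectation_indic//; congr (_ + _)%E.
rewrite -expectation_indic; last exact: measurableC.
congr expectation; apply/funext => t; rewrite !indicE in_setC.
by case: (t \in A) => /=; rewrite ?subrr ?subr0.
Qed.

Lemma error_sum_ge0 (P Q : probability RT R) n (phi : n.-tuple RT -> R) :
  is_test phi -> (0 <= error_sum P Q phi)%E.
Proof.
case=> _ phi01; apply: adde_ge0; apply: expectation_ge0 => t.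
  by have /andP[] := phi01 t.
by rewrite subr_ge0; have /andP[] := phi01 t.
Qed.

(** Take r = n^eta.  The critical value is a constant times
    n^(eta (2 |s - 2| + 3) - 1), whereas the statistic reaches a constant times
    n^(g - 1) under Q; eta is chosen so that the first exponent stays below
    g / 2 - 1. *)
Lemma S_test_separates (Q : nat -> probability RT R) (g rho s : R) :
  0 < g -> g <= 1 -> 0 < rho ->
  (\forall n \near \oo, detectable_tail (Q n) n g rho) ->
  exists c : nat -> R, forall e : R, 0 < e -> \forall n \near \oo,
   (error_sum (P0 R) (Q n) (\1_[set X : n.-tuple RT | ((c n)%:E < S_stat s X)%E] : _ -> R)
     <= e%:E)%E.
Proof.
move=> g0 g1 rho0 sig.
pose eta := g / (2 * (2 * `|s - 2| + 4)).
have den0 : 0 < 2 * (2 * `|s - 2| + 4) by have := normr_ge0 (s - 2); lra.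
have eta0 : 0 < eta by rewrite divr_gt0.
have eta8 : eta <= g / 8.
  by rewrite /eta ler_pM2l// lef_pV2 ?posrE//; have := normr_ge0 (s - 2); lra.
have etag : eta * (2 * `|s - 2| + 3) <= g / 2.
  by rewrite /eta mulrAC ler_pdivrMr//; lra.
pose r n : R := expR (eta * ln n%:R).
exists (fun n => null_level n s (r n)) => e e0.
have ss := normr_ge0 (s - 2).
pose K := 36 `^ `|s - 2| * 18.
have m0 := phi_curv_gt0 s.
near=> n; set L : R := ln n%:R.
have n2 : (2 <= n)%N by near: n; exact: nbhs_infty_ge.
have n0 : (0 < n)%N by apply: leq_trans n2.
have nR0 : 0 < n%:R :> R by rewrite ltr0n.
have L0 : 0 <= L by rewrite ?/L; near: n; exact: ln_nat_large.
have r1 : 1 <= r n by rewrite -expR0 ler_expR mulr_ge0// ltW.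
have r0 : 0 < r n by exact: expR_gt0.
have tail : detectable_tail (Q n) n g rho by near: n.
have c1 : 2 / r n <= e / 3.
  rewrite ler_pdivrMr// -ler_pdivrMl; last lra.
  by rewrite ?/L; near: n; exact: expR_ln_large.
have c2 : n%:R * (2 * expR ((1 - r n) / 2)) <= e / 3.
  by near: n; apply: chernoff_term_small => //; lra.
have c3 : 2 * expR ((1 - r n) / 2) <= e / 3.
  apply: le_trans c2; rewrite ler_pMl ?mulr_gt0 ?expR_gt0//.
  by rewrite ler1n.
have c4 : 8 * r n ^+ 2 <= expR (g * L).
  have -> : r n ^+ 2 = expR (2 * eta * L).
    by rewrite /r -expRM_natl; congr expR; rewrite mulrA.
  by rewrite ?/L; near: n; apply: expR_ln_dominates; lra.
have c5 : r n <= rho * Num.sqrt n%:R.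
  have -> : Num.sqrt (n%:R : R) = expR (2^-1 * L).
    have -> : expR (2^-1 * L) = Num.sqrt (expR (2^-1 * L) ^+ 2).
      by rewrite sqrtr_sqr ger0_norm// expR_ge0.
    congr Num.sqrt; rewrite -expRM_natl mulrA divff// mul1r lnK//.
  rewrite -ler_pdivrMl//.
  by rewrite ?/L; near: n; apply: expR_ln_dominates; lra.
have c6 : K * (16 / phi_curv s * 2) * expR (g / 2 * L) <= expR (g * L).
  by rewrite ?/L; near: n; apply: expR_ln_dominates; lra.
have K0 : 0 < K by rewrite mulr_gt0// powR_gt0.
have lev : null_level n s (r n) <= K * expR (g / 2 * L) / n%:R.
  rewrite /null_level ler_pM2r ?invr_gt0//.
  rewrite powRM//; last by rewrite exprn_ge0// ltW.
  rewrite -mulrA /K -[leRHS]mulrA ler_pM2l ?powR_gt0//.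
  rewrite mulrCA ler_pM2l//.
  have -> : (r n ^+ 2) `^ `|s - 2| = expR (2 * eta * `|s - 2| * L).
    rewrite /r -expRM_natl -expRM; congr expR; rewrite /L; ring.
  rewrite /r -expRM_natl -expRD ler_expR.
  have -> : 2 * eta * `|s - 2| * L + 3 * (eta * ln n%:R) =
     eta * (2 * `|s - 2| + 3) * L by rewrite /L; ring.
  by rewrite ler_wpM2r.
rewrite error_sum_indic; last exact: measurable_S_stat_gt.
have -> : e = (e / 3 + e / 3) + e / 3 by field.
rewrite EFinD; apply: leeD.
  apply: (le_trans (S_stat_null_prob s n2 r1)).
  by rewrite lee_fin lerD.
have [right [x [vp Gd Gv prho]]] := tail.
set v := fine (P0 R _) in vp Gd Gv prho; set p := fine (Q n _) in vp Gd Gv prho.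
have /andP[v0 v1] : 0 < v < 1 by exact: P0_half_line_itv.
have N1 : 1 <= n%:R :> R by rewrite ler1n.
have [dev1 dev2 gap] := tail_margins N1 v0 vp (expR_gt0 _) r1 Gd Gv prho c4 c5 (ltW rho0).
have cK : null_level n s (r n) <
    phi_curv s / 4 * Num.min (((p - v) / 2) ^+ 2 / v) ((p - v) / 2).
  apply: (le_lt_trans lev); rewrite ltr_pdivrMr//.
  rewrite -[ltRHS]mulrA; set m := Num.min _ _ in gap *.
  rewrite [m * _]mulrC -ltr_pdivrMl ?divr_gt0//; apply: lt_le_trans gap.
  rewrite ltr_pdivlMr//; apply: lt_le_trans c6.
  have E0 : 0 < K * expR (g / 2 * L) by rewrite mulr_gt0// expR_gt0.
  have -> : K * (16 / phi_curv s * 2) * expR (g / 2 * L) =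
    2 * ((phi_curv s / 4)^-1 * (K * expR (g / 2 * L)) * 4) by field; rewrite gt_eqF.
  have m4 : 0 < (phi_curv s / 4)^-1 by rewrite invr_gt0 divr_gt0.
  by rewrite ltr_pMl ?ltr1n// mulr_gt0// mulr_gt0.
have := @S_stat_alt_prob R (Q n) n s (r n) (null_level n s (r n)) x right n0.
rewrite -/(half_line right x) -P0_half_line -/v -/p => /(_ vp dev1 dev2 cK).
by move=> /le_trans; apply; rewrite lee_fin.
Unshelve. all: by end_near. Qed.

End S_test.

(** * The mass that the level sets force into one tail *)

Section level_sets.
Context (R : realType).

(** Turns a level set of the logarithmic density, in extended reals, into a
    level set of the density itself; the values 0 and +oo cause no exception. *)
Lemma lne_level_ge (l a b m : R) (z : \bar R) : 0 < l -> (0 <= z)%E ->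
  (a%:E <= lne z / l%:E - b%:E + m%:E)%E = ((expR (l * (a + b - m)))%:E <= z)%E.
Proof.
move=> l0 z0; rewrite inver gt_eqF//.
have l1 : 0 < l^-1 by rewrite invr_gt0.
case: z z0 => [z| |]//=; rewrite ?lee_fin => z0; last first.
  by rewrite gt0_mulye ?lte_fin// !addye// !leey.
have [->|z1] := eqVneq z 0.
  by rewrite lexx gt0_mulNye ?lte_fin// leNgt ltNyr [RHS]leNgt expR_gt0.
have {z0 z1}z0 : 0 < z by rewrite lt_neqAle eq_sym z1.
rewrite [(z <= 0)]leNgt z0/= -EFinM -EFinB -EFinD lee_fin.
rewrite -[in RHS](lnK (x := z)) ?posrE// ler_expR.
rewrite -ler_pdivlMl// [in RHS]mulrC.
by apply/idP/idP; lra.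
Qed.

Lemma limn_einf_gt0 (u : nat -> \bar R) : (0 < limn_einf u)%E ->
  exists2 c : R, 0 < c & \forall n \near \oo, (c%:E <= u n)%E.
Proof.
rewrite limn_einf_lim.
have nd : nondecreasing_seq (einfs u) by exact: nondecreasing_einfs.
have /cvg_lim -> // := ereal_nondecreasing_cvgn nd.
move=> /ereal_sup_gt[_ [N _ <-]] uN.
have uNn n : (N <= n)%N -> (einfs u N <= u n)%E.
  by move=> Nn; apply: ereal_inf_lbound; exists n.
case: (einfs u N) uN uNn => [c| |]// c0 cu.
  by exists c => //; exists N.
exists 1 => //; exists N => // n /= Nn.
by apply: le_trans (cu n Nn); rewrite leey.
Qed.

End level_sets.

Section signal.
Context (R : realType).
Local Notation RT := (measurableTypeR R).
Local Notation leb := (@lebesgue_measure R).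

(** In units of sqrt (2 ln n): the points of the half-line from j / k (or up to
    - j / k) whose square, truncated at 1, is at most the one of (j + 2) / k.
    For j = k there is no restriction, so the cells also cover the unbounded
    part of the line.  The step 2 rather than 1 leaves room for the open end
    of the half-line. *)
Definition cell (k : nat) (right : bool) (j : nat) : set R :=
  half_line right (if right then j%:R / k%:R else - (j%:R / k%:R)) `&`
  [set x | Num.min (x ^+ 2) 1 <= (Num.min (j.+2%:R / k%:R) 1) ^+ 2].

Lemma measurable_min_sqr : measurable_fun setT (fun x : R => Num.min (x ^+ 2) 1).
Proof. by apply: measurable_minr => //; exact: measurable_funX. Qed.

Lemma measurable_cell k right j : measurable (cell k right j).
Proof.
apply: measurableI; first exact: measurable_half_line.
rewrite -[X in measurable X]setTI.
rewrite (_ : [set x | _] = (fun x : R => Num.min (x ^+ 2) 1) @^-1`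
   `]-oo, (Num.min (j.+2%:R / k%:R) 1) ^+ 2]).
  exact: measurable_min_sqr.
by apply/seteqP; split => x /=; rewrite in_itv.
Qed.

Lemma cell_cover k (x : R) : (0 < k)%N ->
  exists right j, (j <= k)%N /\ cell k right j x.
Proof.
move=> k0; have kR : 0 < k%:R :> R by rewrite ltr0n.
pose t := Num.truncn (`|x| * k%:R).
have /andP[t1 t2] : t%:R <= `|x| * k%:R < t.+1%:R by apply: truncn_itv; rewrite mulr_ge0.
pose j := minn t.-1 k.
have jk : (j <= k)%N by rewrite geq_minr.
have jt : (j%:R : R) <= t.-1%:R by rewrite ler_nat geq_minl.
have jx : j%:R / k%:R <= `|x| /\ (0 < x -> j%:R / k%:R < x).
  split.
    rewrite ler_pdivrMr//; apply: le_trans t1; apply: (le_trans jt).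
    by rewrite ler_nat leq_pred.
  move=> x0; rewrite ltr_pdivrMr// (gtr0_norm x0) in t1 *.
  have [t0|t0] := posnP t.
    rewrite t0 /= in jt; apply: (le_lt_trans jt); exact: mulr_gt0.
  apply: (lt_le_trans _ t1); apply: (le_lt_trans jt).
  by rewrite ltr_nat prednK.
have bx : Num.min (x ^+ 2) 1 <= (Num.min (j.+2%:R / k%:R) 1) ^+ 2.
  have [jk1|] := leP 1 (j.+2%:R / k%:R : R).
    by rewrite expr1n ge_min lexx orbT.
  move=> j1; apply: (@le_trans _ _ (x ^+ 2)); first by rewrite ge_min lexx.
  rewrite -real_normK ?num_real// lerXn2r ?nnegrE ?divr_ge0//.
  have jt' : j = t.-1.
    rewrite /j; apply/minn_idPl; rewrite leqNgt; apply/negP => kt.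
    move: j1; rewrite /j (minn_idPr (ltnW kt)) ltr_pdivrMr// mul1r.
    by rewrite ltr_nat ltnNge leqW.
  rewrite ler_pdivlMr//; apply: (le_trans (ltW t2)); rewrite jt' ler_nat.
  by case: (t).
have [x0|x0] := ltP 0 x.
  exists true, j; split => //; split => //=.
  by rewrite /half_line in_itv/= andbT; exact: jx.2.
exists false, j; split => //; split => //=.
by rewrite /half_line in_itv/= lerNr; have := jx.1; rewrite ler0_norm.
Qed.

Lemma cell_pigeonhole (B : set R) (k : nat) (c : R) : (0 < k)%N -> 0 < c ->
  measurable B -> (c%:E <= leb B)%E ->
  exists right j, (j <= k)%N /\
    ((c / (4 * k.+1%:R))%:E <= leb (B `&` cell k right j))%E.
Proof.
move=> k0 c0 mB cB; apply: contrapT => no.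
(* The 2 (k + 1) cells in one sequence: the parity is the side, the half is j. *)
pose A i := B `&` cell k (odd i) (i./2).
have mA i : measurable (A i) by apply: measurableI => //; exact: measurable_cell.
have BA : B `<=` \big[setU/set0]_(i < (k.+1).*2) A i.
  move=> x Bx; have [right [j [jk cx]]] := cell_cover x k0.
  rewrite -bigcup_mkord; exists (right + j.*2)%N => /=.
    by rewrite -ltn_half_double half_bit_double ltnS.
  by rewrite /A oddD odd_double half_bit_double addbF oddb; split.
have : (c%:E <= (c / 2)%:E)%E.
  apply: (le_trans cB).
  apply: (@le_trans _ _ (leb (\big[setU/set0]_(i < (k.+1).*2) A i))).
    apply: le_measure => //; rewrite inE//.
    by apply: bigsetU_measurable => i _; exact: mA.
  apply: (le_trans (Boole_inequality _ _)); first by move=> i _; exact: mA.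
  apply: (@le_trans _ _ (\sum_(i < (k.+1).*2) (c / (4 * k.+1%:R))%:E)%E).
    apply: lee_sum => i _; rewrite leNgt; apply/negP => /ltW h; apply: no.
    exists (odd i), i./2; split => //.
    by rewrite -ltnS -ltn_double (leq_ltn_trans _ (ltn_ord i))// -{2}(odd_double_half i) leq_addl.
  rewrite sumEFin lee_fin sumr_const card_ord -(mulr_natr _ (_.*2)) -(muln2 k.+1) natrM.
  have : k.+1%:R != 0 :> R by rewrite pnatr_eq0.
  move: (k.+1%:R : R) => K K0; rewrite le_eqVlt; apply/orP; left; apply/eqP.
  by field.
by rewrite lee_fin; lra.
Qed.

(** On the rescaled cell the normal density is exp(- l x^2) up to a constant, so
    that the density of mu with respect to Lebesgue measure is at least
    exp(l (a0 - min(x^2, 1) / 2)), which the cell bounds below uniformly. *)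
Lemma density_mass_cell (mu : probability RT R) (f : R -> \bar R) (sigma a0 l : R)
    (k j : nat) (right : bool) :
  is_density (P0 R) mu f -> 0 < sigma -> 0 <= l -> sigma ^+ 2 = 2 * l ->
  let a := j%:R / k%:R in let b := Num.min (j.+2%:R / k%:R) 1 in
  let B := [set x | ((expR (l * (a0 + x ^+ 2 - Num.min (x ^+ 2) 1 / 2)))%:E
             <= f (x * sigma)%R)%E] in
  measurable B ->
  ((normal_peak 1 * expR (l * (a0 - b ^+ 2 / 2)) * sigma)%:E *
     leb (B `&` cell k right j) <=
   mu (half_line right (if right then a * sigma else - (a * sigma))%R))%E.
Proof.
move=> [mf f0 muE] s0 l0 s2 a b B mB.
have si : 0 < sigma^-1 by rewrite invr_gt0.
pose C := B `&` cell k right j.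
have mC : measurable C by apply: measurableI => //; exact: measurable_cell.
pose D := (fun y => sigma^-1 * y) @^-1` C.
have mD : measurable D.
  by rewrite -[D]setTI; exact: measurable_scaling.
have lD : leb C = ((sigma^-1)%:E * leb D)%E by rewrite lebesgue_measure_scaling.
rewrite -/C lD muleA -EFinM mulfK ?gt_eqF//.
apply: (@le_trans _ _ (mu D)); last first.
  apply: le_measure; rewrite ?inE//; first exact: measurable_half_line.
  move=> y; rewrite /D/= => -[_ [+ _]]; rewrite /half_line -/a.
  by case: right {C mC D mD lD}; rewrite /= !in_itv/= ?andbT mulrC
    ?ltr_pdivlMr ?ler_pdivrMr// mulNr.
rewrite muE// -integral_cst//.
have -> : (\int[P0 R]_(x in D) f x = \int[leb]_(x in D) (f x * (normal_pdf 0 1 x)%:E))%E.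
  rewrite integral_mkcond [RHS]integral_mkcond ge0_integral_P0.
  - apply: eq_integral => x _; rewrite !patchE; case: ifPn => // _.
    by rewrite mul0e.
  - by apply/(measurable_restrictT _ mD); exact: measurable_funTS.
  - by move=> x; apply: erestrict_ge0.
have mphi : measurable_fun setT (fun x : R => (normal_pdf 0 1 x)%:E).
  by apply/measurable_EFinP; exact: measurable_phi.
apply: ge0_le_integral => //.
- by move=> x _; rewrite lee_fin mulr_ge0 ?expR_ge0 ?normal_peak_ge0.
- by apply: measurable_funTS; exact: emeasurable_funM.
move=> y [By [_ cy]].
have {}By : ((expR (l * (a0 + (sigma^-1 * y) ^+ 2 -
    Num.min ((sigma^-1 * y) ^+ 2) 1 / 2)))%:E <= f y)%E.
  by move: By; rewrite /B/= mulrAC mulVf ?mul1r// gt_eqF.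
apply: (@le_trans _ _ ((expR (l * (a0 + (sigma^-1 * y) ^+ 2 -
    Num.min ((sigma^-1 * y) ^+ 2) 1 / 2)))%:E * (normal_pdf 0 1 y)%:E)%E); last first.
  by rewrite lee_wpmul2r// lee_fin phi_ge0.
rewrite -EFinM lee_fin phiE mulrCA ler_pM2l ?normal_peak1_gt0//.
rewrite -expRD ler_expR.
have -> : y ^+ 2 / 2 = l * (sigma^-1 * y) ^+ 2.
  rewrite exprMn exprVn s2; field.
  by apply/eqP => l0'; move: s2; rewrite l0' mulr0 => /eqP; rewrite expf_eq0/= gt_eqF.
move: cy; rewrite /= -/b => cy.
have := ler_wpM2l l0 cy; lra.
Qed.

End signal.
Section signal_asymptotics.
Context (R : realType).
Local Notation RT := (measurableTypeR R).
Local Notation leb := (@lebesgue_measure R).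

Lemma measurable_rescaled (f : R -> \bar R) (sigma : R) :
  measurable_fun setT f -> measurable_fun setT (fun x : R => f (x * sigma)).
Proof.
move=> mf; apply: (@measurableT_comp _ _ _ _ _ _ f _ (fun x : R => x * sigma)) => //.
exact: mulrr_measurable.
Qed.

Lemma measurable_level (f : R -> \bar R) (sigma : R) (g : R -> R) :
  measurable_fun setT f -> measurable_fun setT g ->
  measurable [set x | ((expR (g x))%:E <= f (x * sigma)%R)%E].
Proof.
move=> mf mg; rewrite -[X in measurable X]setTI.
apply: measurable_lee => //; last exact: measurable_rescaled.
by apply/measurable_EFinP; apply: measurableT_comp => //; exact: measurable_expR.
Qed.

Lemma sparsityE (beta : R) n : (0 < n)%N ->
  n%:R `^ (- beta) = expR (- beta * ln n%:R) :> R.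
Proof. by move=> n0; rewrite /powR gt_eqF// ltr0n. Qed.

Lemma sparsity_itv (beta : R) n : 0 < beta -> 0 <= (n%:R : R) `^ (- beta) <= 1.
Proof.
move=> b0; rewrite powR_ge0/=; case: n => [|n].
  by rewrite powR0 ?ler01// oppr_eq0 gt_eqF.
rewrite sparsityE// -[leRHS]expR0 ler_expR mulNr oppr_le0 mulr_ge0//.
  exact: ltW.
by rewrite ln_ge0// ler1n.
Qed.

Lemma alternativeE (mu : nat -> probability RT R) (beta : R) n A :
  0 < beta -> measurable A ->
  let e := n%:R `^ (- beta) in
  alternative mu beta n A = ((1 - e)%:E * P0 R A + e%:E * mu n A)%E.
Proof.
by move=> b0 mA /=; rewrite /alternative /mixture sparsity_itv.
Qed.

Lemma fine_alternativeE (mu : nat -> probability RT R) (beta : R) n A :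
  0 < beta -> measurable A ->
  let e := n%:R `^ (- beta) in
  fine (alternative mu beta n A) = (1 - e) * fine (P0 R A) + e * fine (mu n A).
Proof.
move=> b0 mA e; rewrite alternativeE//.
by rewrite fineD ?fineM// ?fin_numM// fin_num_measure.
Qed.

Lemma square_increment_le (a b t u : R) : 0 <= a -> a <= 1 -> b <= 1 -> a <= b ->
  b <= a + t -> 2 * t <= u -> b ^+ 2 <= a ^+ 2 + u.
Proof. by move=> a0 a1 b1 ab bt tu; nra. Qed.

Lemma half_excess (x m v : R) : x <= m -> 2 * v <= m -> x / 2 <= m - v.
Proof. by lra. Qed.

Lemma mixture_mass_le (e m v rho : R) : e <= rho -> v <= 1 - 2 * rho ->
  0 <= e * v -> e * m <= e -> (1 - e) * v + e * m <= 1 - rho.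
Proof. by lra. Qed.

(** The exponents of n that occur below, with A2 and B2 the squares of the left
    and of the right end point of the cell. *)
Section exponents.
Variables (bs beta A2 B2 : R).
Let gam := bs - beta.
Hypotheses (b12 : 2^-1 < beta) (bbs : beta < bs) (A20 : 0 <= A2).
Hypothesis AB : B2 <= A2 + gam / 16.

Lemma signal_exponent_noise : - A2 + gam / 2 <= bs - gam / 8 - 2^-1 - B2 / 2.
Proof. by move: AB bbs A20 b12; rewrite /gam; lra. Qed.

Lemma signal_exponent_count : B2 <= 1 -> beta <= 1 ->
  gam - gam / 8 <= 1 + - beta + (bs - gam / 8 - 2^-1 - B2 / 2).
Proof. by move=> h1 h2; move: h1 h2 bbs; rewrite /gam; lra. Qed.

Lemma signal_exponent_ratio : - A2 + gam <=
  1 + (- beta - beta) + ((bs - gam / 8 - 2^-1 - B2 / 2) + (bs - gam / 8 - 2^-1 - B2 / 2)).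
Proof. by move: AB bbs; rewrite /gam; lra. Qed.

End exponents.

Variables (mu : nat -> probability RT R) (f : nat -> R -> \bar R).
Hypothesis hf : forall n, is_density (P0 R) (mu n) (f n).
Variable bstar : R.

Lemma level_set_h_tilde n a : 0 < ln (n%:R : R) ->
  [set x : R | (a%:E <= h_tilde f n x / (ln n%:R)%:E - (x ^+ 2)%:E
           + (Num.min (x ^+ 2) 1 / 2)%:E)%E] =
  [set x : R | ((expR (ln n%:R * (a + x ^+ 2 - Num.min (x ^+ 2) 1 / 2)))%:E <=
      f n (x * Num.sqrt (2 * ln n%:R))%R)%E].
Proof.
move=> L0; have [_ f0 _] := hf n.
by apply/seteqP; split => x /=; rewrite lne_level_ge.
Qed.

Hypothesis hinf : forall delta : R, 0 < delta ->
  (0 < limn_einf (fun n => leb [set x : R |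
     (bstar - delta - 2^-1)%:E <=
       h_tilde f n x / (ln n%:R)%:E - (x ^+ 2)%:E
       + (Num.min (x ^+ 2) 1 / 2)%:E]))%E.

(** A cell that captures a fixed part of the level set has signal mass of order
    n^(bstar - 1/2 - b^2 / 2) up to a small exponent, while its half-line has
    null mass at most n^(- a^2), with b close to a.  After multiplication by the
    sparsity n^(- beta) the excess beats both 1 / n and the standard deviation
    of the count, by a power of n that is governed by bstar - beta. *)
Lemma level_sets_detectable (beta : R) : 2^-1 < beta <= 1 -> beta < bstar ->
  exists g rho : R, [/\ 0 < g, g <= 1, 0 < rho &
    \forall n \near \oo, detectable_tail (alternative mu beta n) n g rho].
Proof.
move=> /andP[beta12 beta1] betas.
have beta0 : 0 < beta by lra.
pose gam := bstar - beta.
have gam0 : 0 < gam by rewrite subr_gt0.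
pose delta := gam / 8.
have delta0 : 0 < delta by rewrite divr_gt0.
pose k := (Num.truncn (64 / gam)).+1.
have k0 : (0 < k)%N by [].
have kR0 : 0 < k%:R :> R by rewrite ltr0n.
have k64 : 8 / k%:R <= gam / 8.
  have : 64 / gam < k%:R by exact: truncnS_gt.
  by rewrite ltr_pdivrMr// ler_pdivrMr// => h; lra.
have k4 : 2 * (2 / k%:R) <= gam / 16 by lra.
have [c c0 Hc] := limn_einf_gt0 (hinf delta0).
pose C := normal_peak 1 * (c / (4 * k.+1%:R)).
have C0 : 0 < C by rewrite mulr_gt0 ?normal_peak1_gt0// divr_gt0// mulr_gt0.
pose g := Num.min (gam / 2) 1.
have g_gam : g <= gam / 2 by rewrite ge_min lexx.
(* All half-lines below stay on one side of 0. *)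
pose rho := Num.min (F0 (0 : R)) (1 - F0 0) / 2.
have rho0 : 0 < rho by rewrite divr_gt0// lt_min F0_gt0 subr_gt0 F0_lt1.
have r1 : 2 * rho <= F0 0.
  by rewrite /rho mulrCA divff ?mulr1// ge_min lexx.
have r2 : F0 0 <= 1 - 2 * rho.
  rewrite lerBrDr -lerBrDl /rho mulrCA divff ?mulr1//.
  by rewrite ge_min lexx orbT.
exists g, rho; split => //.
- by rewrite lt_min ltr01 divr_gt0.
- by rewrite ge_min lexx orbT.
pose a0 := bstar - delta - 2^-1.
near=> n.
have n0 : (0 < n)%N by near: n; exact: nbhs_infty_gt.
have L1 : 1 <= ln (n%:R : R) by near: n; exact: ln_nat_large.
have cn : (c%:E <= leb [set x : R | a0%:E <=
       h_tilde f n x / (ln n%:R)%:E - (x ^+ 2)%:E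
       + (Num.min (x ^+ 2) 1 / 2)%:E])%E by near: n.
have A1 : 2 <= C * expR (gam / 2 * ln n%:R).
  rewrite -ler_pdivrMl// mulrC; near: n; exact: expR_ln_large (divr_gt0 gam0 _).
have A2 : 2 / C * expR (g * ln n%:R) <= expR ((gam - delta) * ln n%:R).
  by near: n; apply: expR_ln_dominates; rewrite /delta; lra.
have A3 : 4 / C ^+ 2 * expR (g * ln n%:R) <= expR (gam * ln n%:R).
  by near: n; apply: expR_ln_dominates; lra.
have A4 : expR (- beta * ln n%:R) <= rho.
  have : rho^-1 <= expR (beta * ln n%:R) by near: n; exact: expR_ln_large.
  by rewrite mulNr expRN -[leRHS]invrK lef_pV2 ?posrE ?invr_gt0// expR_gt0.
set L : R := ln n%:R in L1 cn A1 A2 A3 A4.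
have L0 : 0 < L by exact: lt_le_trans L1.
pose sigma := Num.sqrt (2 * L).
have s2 : sigma ^+ 2 = 2 * L by rewrite sqr_sqrtr// mulr_ge0// ltW.
have s1 : 1 <= sigma.
  by rewrite -[leLHS]sqrtr1 ler_wsqrtr// (le_trans L1)// mulr_natl mulr2n lerDl ltW.
have s0 : 0 < sigma by exact: lt_le_trans s1.
have [mf f0 muE] := hf n.
rewrite level_set_h_tilde// -/L -/sigma in cn.
set B := [set x | _] in cn.
have mB : measurable B.
  apply: measurable_level => //.
  apply: measurable_funM => //; apply: measurable_funB.
    by apply: measurable_funD => //; exact: measurable_funX.
  by apply: measurable_funM => //; exact: measurable_min_sqr.
have [right [j [jk cj]]] := cell_pigeonhole k0 c0 mB cn.
pose a : R := j%:R / k%:R; pose b : R := Num.min (j.+2%:R / k%:R) 1.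
have a_ge0 : 0 <= a by rewrite divr_ge0.
have a_le1 : a <= 1 by rewrite ler_pdivrMr// mul1r ler_nat.
have b_le1 : b <= 1 by rewrite ge_min lexx orbT.
have b_ge0 : 0 <= b by rewrite le_min divr_ge0//= ler01.
have ba : b <= a + 2 / k%:R.
  rewrite ge_min; apply/orP; left.
  by rewrite -mulrDl ler_pM2r ?invr_gt0// -natrD addn2.
have ab : a <= b by rewrite le_min a_le1 ler_pM2r ?invr_gt0// ler_nat ltnW.
have b21 : b ^+ 2 <= 1 by rewrite expr_le1.
have b2 : b ^+ 2 <= a ^+ 2 + gam / 16.
  exact: (square_increment_le a_ge0 a_le1 b_le1 ab ba k4).
pose A : set RT := half_line right (if right then a * sigma else - (a * sigma)).
have mA : measurable A by exact: measurable_half_line.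
pose E := expR ((a0 - b ^+ 2 / 2) * L).
pose m := fine (mu n A); pose v := fine (P0 R A).
have mE : C * E <= m.
  have h := @density_mass_cell R (mu n) (f n) sigma a0 L k j right (hf n) s0 (ltW L0) s2 mB.
  rewrite -/b [X in expR X]mulrC -/E in h.
  rewrite -lee_fin fineK ?fin_num_measure//; apply: le_trans h.
  apply: (@le_trans _ _ ((normal_peak 1 * E * sigma)%:E * (c / (4 * k.+1%:R))%:E)%E).
    rewrite -EFinM lee_fin.
    have -> : normal_peak 1 * E * sigma * (c / (4 * k.+1%:R)) = C * E * sigma.
      by rewrite /C; ring.
    by rewrite ler_peMr// mulr_ge0// ?expR_ge0// ltW.
  by apply: lee_wpmul2l => //; rewrite lee_fin !mulr_ge0 ?normal_peak_ge0 ?expR_ge0// ltW.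
have vV : v <= expR (- (a ^+ 2) * L).
  have e : (a * sigma) ^+ 2 / 2 = a ^+ 2 * L by rewrite exprMn s2; field.
  have as0 : 0 <= a * sigma by rewrite mulr_ge0// ltW.
  rewrite -lee_fin /v fineK ?fin_num_measure// mulNr -e /A /half_line.
  by case: (right); [exact: P0_tail_right|exact: P0_tail_left].
have v0 : 0 <= v by exact: fine_ge0.
have m1 : m <= 1 by rewrite -lee_fin fineK ?fin_num_measure// probability_le1.
have vm : 2 * v <= m.
  apply: le_trans mE.
  have : expR (- (a ^+ 2) * L) * expR (gam / 2 * L) <= E.
    rewrite /E -expRD -mulrDl ler_expR ler_wpM2r//; first exact: ltW.
    exact: (signal_exponent_noise beta12 betas (sqr_ge0 a) b2).
  move=> /(ler_wpM2l (ltW C0)); apply: le_trans.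
  rewrite mulrCA mulrC; apply: ler_pM => //.
have eE := sparsityE beta n0; rewrite -/L in eE.
set e := expR (- beta * L) in A4 eE.
have e0 : 0 < e by exact: expR_gt0.
have pE : fine (alternative mu beta n A) = (1 - e) * v + e * m.
  by rewrite fine_alternativeE// eE.
set p := fine (alternative mu beta n A) in pE.
have dE : p - v = e * (m - v) by rewrite pE; ring.
have d_ge : C / 2 * (e * E) <= p - v.
  have -> : C / 2 * (e * E) = e * (C * E / 2) by field.
  by rewrite dE ler_pM2l//; exact: half_excess.
have nE : n%:R = expR L by rewrite lnK// posrE ltr0n.
have EE0 : 0 < C / 2 * (e * E) by rewrite mulr_gt0 ?divr_gt0// mulr_gt0// expR_gt0.
have F0a : v <= 1 - 2 * rho.
  have as0 : 0 <= a * sigma by rewrite mulr_ge0// ltW.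
  rewrite /v P0_half_line; case: (right).
    by rewrite lerD2l lerN2; exact: le_trans r1 (F0_le as0).
  by apply: (le_trans _ r2); apply: F0_le; rewrite oppr_le0.
exists right, (if right then a * sigma else - (a * sigma)); rewrite -/A -/v -/p -/L.
split.
- by rewrite -subr_gt0; exact: lt_le_trans EE0 d_ge.
- apply: (@le_trans _ _ (n%:R * (C / 2 * (e * E)))); last first.
    by rewrite ler_wpM2l.
  have -> : n%:R * (C / 2 * (e * E)) = C / 2 * (n%:R * e * E) by ring.
  rewrite -ler_pdivrMl ?divr_gt0// invf_div; apply: (le_trans A2).
  rewrite nE /e /E -!expRD -[X in expR (X + _ + _)]mul1r -!mulrDl ler_expR.
  rewrite ler_wpM2r//; first exact: ltW.
  exact: (signal_exponent_count betas b21 beta1).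
- apply: (@le_trans _ _ (n%:R * (C / 2 * (e * E)) ^+ 2)); last first.
    rewrite ler_wpM2l//.
    rewrite lerXn2r// nnegrE; first exact: ltW.
    exact: le_trans (ltW EE0) d_ge.
  apply: (le_trans (ler_wpM2r (expR_ge0 _) vV)).
  have A3' : expR (g * L) <= C ^+ 2 / 4 * expR (gam * L).
    by rewrite -ler_pdivrMl ?divr_gt0 ?exprn_gt0// invf_div.
  apply: (le_trans (ler_wpM2l (expR_ge0 _) A3')).
  have -> : n%:R * (C / 2 * (e * E)) ^+ 2 = C ^+ 2 / 4 * (n%:R * (e * e) * (E * E)) by field.
  rewrite mulrCA ler_pM2l ?divr_gt0 ?exprn_gt0//.
  rewrite nE /e /E -!expRD -[X in expR (X + _ + _)]mul1r -!mulrDl ler_expR.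
  rewrite ler_wpM2r//; first exact: ltW.
  exact: (signal_exponent_ratio betas b2).
- have : e * m <= e by rewrite ler_piMr// ltW.
  have : 0 <= e * v by rewrite mulr_ge0// ltW.
  rewrite pE; exact: mixture_mass_le A4 F0a.
Unshelve. all: by end_near. Qed.

End signal_asymptotics.

(** * The Hellinger distance of a sparse mixture *)

Section hellinger.
Context (R : realType).
Local Notation RT := (measurableTypeR R).

(** A density with respect to a probability is integrable, hence finite almost
    everywhere; real densities make square roots available. *)
Lemma is_density_fine (P mu : probability RT R) (f : R -> \bar R) :
  is_density P mu f -> is_density P mu (fun x => (fine (f x))%:E).
Proof.
move=> [mf f0 muE].
have mff : measurable_fun setT (fun x => (fine (f x))%:E).
  by apply/measurable_EFinP; apply: measurableT_comp.
have intf : P.-integrable setT f.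
  apply/integrableP; split => //.
  rewrite (_ : (fun x => _) = f); last first.
    by apply/funext => x; rewrite gee0_abs.
  by rewrite -muE// probability_setT ltry.
split => // [x|A mA]; first by rewrite lee_fin fine_ge0.
rewrite muE//; apply: ae_eq_integral => //.
- exact: measurable_funTS.
- exact: measurable_funTS.
have := integrable_ae measurableT intf; apply: filterS => x /(_ I) fx _.
by rewrite fineK.
Qed.

Lemma alternative_density (mu : nat -> probability RT R) (beta : R) n (g : R -> R) :
  0 < beta -> is_density (P0 R) (mu n) (fun x => (g x)%:E) ->
  let e := n%:R `^ (- beta) in
  forall A, measurable A ->
   alternative mu beta n A = (\int[P0 R]_(x in A) (1 - e + e * g x)%:E)%E.
Proof.
move=> b0 [mg g0 muE] e A mA; rewrite alternativeE// -/e.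
have /andP[e0 e1] : 0 <= e <= 1 by exact: sparsity_itv.
under eq_integral do rewrite EFinD EFinM.
rewrite ge0_integralD//; last 3 first.
- by move=> x _; rewrite lee_fin subr_ge0.
- by move=> x _; rewrite mule_ge0.
- by apply: measurable_funTS; exact: emeasurable_funM.
by rewrite integral_cst// ge0_integralZl// -?muE//; exact: measurable_funTS.
Qed.

(** The square root brings values closer to 1.  This bound leads to a second
    moment and is the better one for moderate g. *)
Lemma sqrt_sub1_sqr_le_quad (e g : R) : 0 <= e <= 1 -> 0 <= g ->
  (Num.sqrt (1 - e + e * g) - 1) ^+ 2 <= e ^+ 2 + e ^+ 2 * g ^+ 2.
Proof.
move=> /andP[e0 e1] g0.
have eg : 0 <= e * g by rewrite mulr_ge0.
have q0 : 0 <= 1 - e + e * g by rewrite addr_ge0// subr_ge0.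
set r := Num.sqrt _; have r0 : 0 <= r by exact: sqrtr_ge0.
have rq : r ^+ 2 = 1 - e + e * g by rewrite sqr_sqrtr.
have h1 : (r - 1) ^+ 2 <= (r ^+ 2 - 1) ^+ 2.
  have -> : (r ^+ 2 - 1) ^+ 2 = (r - 1) ^+ 2 * (r + 1) ^+ 2 by ring.
  rewrite ler_peMr ?sqr_ge0//; have := r0; nra.
apply: (le_trans h1); rewrite rq.
have -> : (1 - e + e * g - 1) ^+ 2 = e ^+ 2 + e ^+ 2 * g ^+ 2 - 2 * e * (e * g) by ring.
by rewrite lerBlDr lerDl !mulr_ge0.
Qed.

(** A first moment bound, for the region where g has no useful second moment. *)
Lemma sqrt_sub1_sqr_le_lin (e g : R) : 0 <= e <= 1 -> 0 <= g ->
  (Num.sqrt (1 - e + e * g) - 1) ^+ 2 <= e ^+ 2 + e * g.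
Proof.
move=> e01 g0; have /andP[e0 e1] := e01.
have eg : 0 <= e * g by rewrite mulr_ge0.
have [g1|/ltW g1] := leP g 1.
  apply: (le_trans (sqrt_sub1_sqr_le_quad e01 g0)); rewrite lerD2l.
  have : e ^+ 2 * g ^+ 2 = (e * g) * (e * g) by ring.
  have : e * g <= 1 by rewrite mulr_ile1.
  by move=> h ->; rewrite ler_piMl.
have q0 : 0 <= 1 - e + e * g by rewrite addr_ge0// subr_ge0.
set r := Num.sqrt _; have r0 : 0 <= r by exact: sqrtr_ge0.
have rq : r ^+ 2 = 1 - e + e * g by rewrite sqr_sqrtr.
have r1 : 1 <= r.
  rewrite -[leLHS]sqrtr1 ler_wsqrtr//.
  have : e * 1 <= e * g by rewrite ler_wpM2l.
  lra.
have : (r - 1) ^+ 2 <= r ^+ 2 - 1 by nra.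
rewrite rq; have := sqr_ge0 e; lra.
Qed.

Variables (sigma l : R).
Hypotheses (s0 : 0 < sigma) (s2 : sigma ^+ 2 = 2 * l).
Local Notation leb := (@lebesgue_measure R).
Local Notation peak := (normal_peak (1 : R)).

(** In the coordinate x = y / sqrt (2 l) the standard normal density becomes
    exp(- l x^2) = n^(- x^2) for l = ln n. *)
Lemma P0_rescaled (D : set R) (h : R -> \bar R) : measurable D ->
  measurable_fun setT h -> (forall x, 0 <= h x)%E ->
  (\int[P0 R]_y (h y * (\1_D (y / sigma) : R)%:E) =
   (sigma * peak)%:E * \int[leb]_(x in D) (h (x * sigma)%R * (expR (- (l * x ^+ 2)))%:E))%E.
Proof.
move=> mD mh h0.
have mi : measurable_fun setT (fun y : R => (\1_D (y / sigma) : R)%:E).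
  apply/measurable_EFinP.
  apply: (@measurableT_comp _ _ _ _ _ _ (\1_D : R -> R) _ (fun y : R => y / sigma)).
    exact: measurable_indic.
  exact: mulrr_measurable.
have mhi : measurable_fun setT (fun y => (h y * (\1_D (y / sigma) : R)%:E)%E).
  exact: emeasurable_funM.
have mphi : measurable_fun setT (fun x : R => (normal_pdf 0 1 x)%:E).
  by apply/measurable_EFinP; exact: measurable_phi.
have mexp : measurable_fun setT (fun x : R => (expR (- (l * x ^+ 2)))%:E).
  apply/measurable_EFinP; apply: measurableT_comp; first exact: measurable_expR.
  apply: measurable_funN; apply: measurable_funM => //; exact: measurable_funX.
rewrite ge0_integral_P0//; last by move=> y; rewrite mule_ge0.
rewrite (ge0_integral_scaling s0); first last.
- by move=> y; rewrite !mule_ge0// lee_fin phi_ge0.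
- exact: emeasurable_funM.
rewrite EFinM -muleA; congr (_ * _)%E.
rewrite [in RHS]integral_mkcond -ge0_integralZl//; last 3 first.
- apply/(measurable_restrictT _ mD); apply: measurable_funTS.
  by apply: emeasurable_funM => //; exact: measurable_rescaled.
- move=> x _; apply: erestrict_ge0 => y _; rewrite mule_ge0// lee_fin expR_ge0//.
- by rewrite lee_fin normal_peak_ge0.
apply: eq_integral => x _; rewrite epatch_indic/=.
have -> : (sigma * x / sigma = x)%R by rewrite mulrAC divff ?mul1r// gt_eqF.
have -> : normal_pdf 0 1 (sigma * x)%R = (peak * expR (- (l * x ^+ 2)))%R.
  by rewrite phiE exprMn s2; congr (_ * expR (- _))%R; field.
rewrite [(sigma * x)%R]mulrC EFinM.
rewrite muleACA [X in (X * _)%E]muleC -muleA -[X in (_ = _ * X)%E]muleA.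
by congr (_ * (_ * _))%E; exact: muleC.
Qed.

End hellinger.
Section hellinger_regions.
Context (R : realType).
Local Notation RT := (measurableTypeR R).
Local Notation leb := (@lebesgue_measure R).
Local Notation peak := (normal_peak (1 : R)).

(** The three ranges of x in which the mixture is compared with P0 in different
    ways: second moment, first moment on a bounded set, first moment at
    infinity. *)
Definition core : set R := [set x | `|x| <= 1].
Definition middle (M : R) : set R := [set x | 1 < `|x| /\ `|x| < M].
Definition far (M : R) : set R := [set x | M <= `|x|].

Lemma measurable_core : measurable core.
Proof.
rewrite -[X in measurable X]setTI.
rewrite (_ : core = (fun x : R => `|x|) @^-1` `]-oo, 1]).
  exact: normr_measurable.
by apply/seteqP; split => x /=; rewrite in_itv.
Qed.

Lemma measurable_far M : measurable (far M).
Proof. by apply: measurable_superlevel; exact: normr_measurable. Qed.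

Lemma measurable_middle M : measurable (middle M).
Proof.
rewrite -[X in measurable X]setTI.
rewrite (_ : middle M = (fun x : R => `|x|) @^-1` `]1, M[).
  exact: normr_measurable.
by apply/seteqP; split => x /=; rewrite in_itv/= => /andP.
Qed.

Lemma regions_cover M x : [\/ core x, middle M x | far M x].
Proof.
have [x1|x1] := leP `|x| 1; first by constructor 1.
by have [xM|xM] := leP M `|x|; [constructor 3|constructor 2].
Qed.

Lemma ae_off_null (N : set R) (Q : R -> Prop) : measurable N -> leb N = 0%E ->
  (forall x, ~ N x -> Q x) -> {ae leb, forall x, Q x}.
Proof.
move=> mN N0 NQ; exists N; split => // x /= nQ.
by apply: contrapT => /NQ.
Qed.

Lemma ae_le_integral_bounded (D : set R) (M C : R) (h : R -> \bar R) :
  measurable D -> D `<=` `[- M, M]%classic -> 0 <= M -> 0 <= C ->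
  measurable_fun setT h -> (forall x, 0 <= h x)%E ->
  {ae leb, forall x, D x -> (h x <= C%:E)%E} ->
  (\int[leb]_(x in D) h x <= (C * (2 * M))%:E)%E.
Proof.
move=> mD DM M0 C0 mh h0 hC.
apply: (@le_trans _ _ (\int[leb]_(x in D) C%:E)%E).
  by apply: ae_ge0_le_integral => //; exact: measurable_funTS.
rewrite integral_cst// EFinM lee_wpmul2l// ?lee_fin//.
apply: (@le_trans _ _ (leb `[- M, M]%classic)); first by apply: le_measure; rewrite ?inE.
rewrite lebesgue_measure_itv/= lte_fin; case: ifP => _.
  by rewrite -EFinD lee_fin opprK mulr2n mulrDl mul1r.
by rewrite lee_fin mulr_ge0.
Qed.

Variables (sigma l M : R).
Hypotheses (s0 : 0 < sigma) (s2 : sigma ^+ 2 = 2 * l).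

(** The pointwise bounds on (sqrt q - 1)^2 are integrated region by region and
    rescaled. *)
Lemma hellinger_le_regions (e w1 w2 w3 : R) (f : R -> \bar R) :
  0 <= e <= 1 -> measurable_fun setT f -> (forall x, 0 <= f x)%E ->
  (\int[leb]_(x in core) ((fine (f (x * sigma)%R) ^+ 2)%:E * (expR (- (l * x ^+ 2)))%:E)
     <= w1%:E)%E ->
  (\int[leb]_(x in middle M) (f (x * sigma)%R * (expR (- (l * x ^+ 2)))%:E) <= w2%:E)%E ->
  (\int[leb]_(x in far M) (f (x * sigma)%R * (expR (- (l * x ^+ 2)))%:E) <= w3%:E)%E ->
  (\int[P0 R]_x ((Num.sqrt (1 - e + e * fine (f x)) - 1) ^+ 2)%:E <=
   (e ^+ 2 + sigma * peak * (e ^+ 2 * w1 + e * w2 + e * w3))%:E)%E.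
Proof.
move=> e01 mf f0 h1 h2 h3; have /andP[e0 e1] := e01.
have fi0 x : 0 <= fine (f x) by rewrite fine_ge0.
have mg : measurable_fun setT (fun x => fine (f x)) by exact: measurableT_comp.
have mi (D : set R) : measurable D ->
    measurable_fun setT (fun y : R => (\1_D (y / sigma) : R)%:E).
  move=> mD; apply/measurable_EFinP.
  apply: (@measurableT_comp _ _ _ _ _ _ (\1_D : R -> R) _ (fun y : R => y / sigma)).
    exact: measurable_indic.
  exact: mulrr_measurable.
have sp0 : 0 <= sigma * peak by rewrite mulr_ge0 ?normal_peak_ge0// ltW.
have mg2 : measurable_fun setT (fun x => (fine (f x) ^+ 2)%:E).
  by apply/measurable_EFinP; exact: measurable_funX.
have mc := measurable_core; have mm := measurable_middle M; have mfar := measurable_far M.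
pose T1 y := ((fine (f y) ^+ 2)%:E * (\1_core (y / sigma) : R)%:E)%E.
pose T2 y := (f y * (\1_(middle M) (y / sigma) : R)%:E)%E.
pose T3 y := (f y * (\1_(far M) (y / sigma) : R)%:E)%E.
have mT1 : measurable_fun setT T1 by apply: emeasurable_funM => //; exact: mi.
have mT2 : measurable_fun setT T2 by apply: emeasurable_funM => //; exact: mi.
have mT3 : measurable_fun setT T3 by apply: emeasurable_funM => //; exact: mi.
have T10 y : (0 <= T1 y)%E by rewrite mule_ge0// lee_fin ?sqr_ge0.
have T20 y : (0 <= T2 y)%E by rewrite mule_ge0// lee_fin.
have T30 y : (0 <= T3 y)%E by rewrite mule_ge0// lee_fin.
have I1 : (\int[P0 R]_y T1 y <= (sigma * peak * w1)%:E)%E.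
  rewrite (P0_rescaled s0 s2)//; last by move=> x; rewrite lee_fin sqr_ge0.
  by rewrite [leRHS]EFinM lee_wpmul2l// lee_fin.
have I2 : (\int[P0 R]_y T2 y <= (sigma * peak * w2)%:E)%E.
  by rewrite (P0_rescaled s0 s2)// [leRHS]EFinM lee_wpmul2l// lee_fin.
have I3 : (\int[P0 R]_y T3 y <= (sigma * peak * w3)%:E)%E.
  by rewrite (P0_rescaled s0 s2)// [leRHS]EFinM lee_wpmul2l// lee_fin.
apply: (@le_trans _ _ (\int[P0 R]_y ((e ^+ 2)%:E +
   ((e ^+ 2)%:E * T1 y + (e%:E * T2 y + e%:E * T3 y))))%E).
  apply: ge0_le_integral => //.
  - by move=> y _; rewrite lee_fin sqr_ge0.
  - apply/measurable_EFinP; apply: measurable_funX; apply: measurable_funB => //.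
    apply: measurableT_comp; first exact: measurable_sqrt.
    apply: measurable_funD => //; exact: measurable_funM.
  - apply: emeasurable_funD => //; apply: emeasurable_funD.
      exact: emeasurable_funM.
    by apply: emeasurable_funD; exact: emeasurable_funM.
  move=> y _.
  have fle : ((fine (f y))%:E <= f y)%E.
    by case: (f y) (f0 y) => [z| |]//= _; rewrite leey.
  have lin : (((Num.sqrt (1 - e + e * fine (f y)) - 1) ^+ 2)%:E <=
      (e ^+ 2)%:E + e%:E * f y)%E.
    apply: (@le_trans _ _ ((e ^+ 2)%:E + e%:E * (fine (f y))%:E)%E).
      by rewrite -EFinM -EFinD lee_fin; exact: sqrt_sub1_sqr_le_lin.
    by rewrite leeD2l// lee_wpmul2l// lee_fin.
  have e2 : (0 <= (e ^+ 2)%:E)%E by rewrite lee_fin sqr_ge0.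
  have pos (a b : \bar R) : (0 <= a -> 0 <= b -> a <= a + b)%E.
    by move=> a0 b0; rewrite leeDl.
  have [yD|yD|yD] := regions_cover M (y / sigma).
  - apply: (@le_trans _ _ ((e ^+ 2)%:E + (e ^+ 2)%:E * T1 y)%E).
      rewrite /T1 indicE mem_set// mule1 -EFinM -EFinD lee_fin.
      exact: sqrt_sub1_sqr_le_quad.
    by rewrite leeD2l// leeDl// adde_ge0// mule_ge0.
  - apply: (le_trans lin); rewrite leeD2l//.
    apply: (@le_trans _ _ (e%:E * T2 y)%E).
      by rewrite /T2 indicE mem_set// mule1.
    rewrite addeC -addeA leeDl// adde_ge0// mule_ge0//.
  - apply: (le_trans lin); rewrite leeD2l//.
    apply: (@le_trans _ _ (e%:E * T3 y)%E).
      by rewrite /T3 indicE mem_set// mule1.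
    by rewrite addeA addeC leeDl// adde_ge0// mule_ge0.
rewrite ge0_integralD//; last 3 first.
- by move=> y _; rewrite lee_fin sqr_ge0.
- by move=> y _; rewrite !adde_ge0// mule_ge0// lee_fin sqr_ge0.
- apply: emeasurable_funD; first exact: emeasurable_funM.
  by apply: emeasurable_funD; exact: emeasurable_funM.
rewrite integral_cst//= probability_setT mule1 [leRHS]EFinD leeD2l//.
rewrite ge0_integralD//; last 4 first.
- by move=> y _; rewrite mule_ge0// lee_fin sqr_ge0.
- exact: emeasurable_funM.
- by move=> y _; rewrite adde_ge0// mule_ge0.
- by apply: emeasurable_funD; exact: emeasurable_funM.
rewrite ge0_integralD//; last 4 first.
- by move=> y _; rewrite mule_ge0.
- exact: emeasurable_funM.
- by move=> y _; rewrite mule_ge0.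
- exact: emeasurable_funM.
rewrite !ge0_integralZl// ?lee_fin ?sqr_ge0//.
have -> : sigma * peak * (e ^+ 2 * w1 + e * w2 + e * w3) =
  e ^+ 2 * (sigma * peak * w1) + (e * (sigma * peak * w2) + e * (sigma * peak * w3)).
  by ring.
rewrite !EFinD !(EFinM (e ^+ 2)) !(EFinM e).
by apply: leeD; [|apply: leeD]; apply: lee_wpmul2l => //; rewrite lee_fin ?sqr_ge0.
Qed.

End hellinger_regions.
Section region_bounds.
Context (R : realType).
Local Notation RT := (measurableTypeR R).
Local Notation leb := (@lebesgue_measure R).
Local Notation peak := (normal_peak (1 : R)).
Variables (f : R -> \bar R) (sigma l u : R).
Hypotheses (mf : measurable_fun setT f) (f0 : forall x, (0 <= f x)%E) (l0 : 0 <= l).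

Lemma measurable_gauss_factor :
  measurable_fun setT (fun x : R => (expR (- (l * x ^+ 2)))%:E).
Proof.
apply/measurable_EFinP; apply: measurableT_comp; first exact: measurable_expR.
apply: measurable_funN; apply: measurable_funM => //; exact: measurable_funX.
Qed.

Lemma measurable_rescaled_integrand :
  measurable_fun setT (fun x : R => (f (x * sigma)%R * (expR (- (l * x ^+ 2)))%:E)%E).
Proof.
apply: emeasurable_funM; first exact: measurable_rescaled.
exact: measurable_gauss_factor.
Qed.

Lemma rescaled_integrand_ge0 x :
  (0 <= f (x * sigma)%R * (expR (- (l * x ^+ 2)))%:E)%E.
Proof. by rewrite mule_ge0// lee_fin expR_ge0. Qed.

Let upper := [set x : R |
  ((expR (l * (u + x ^+ 2 - Num.min (x ^+ 2) 1 / 2)))%:E <= f (x * sigma)%R)%E].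
Hypothesis upper0 : leb upper = 0%E.

Let measurable_upper : measurable upper.
Proof.
apply: measurable_level => //; apply: measurable_funM => //.
apply: measurable_funB.
  by apply: measurable_funD => //; exact: measurable_funX.
by apply: measurable_funM => //; exact: measurable_min_sqr.
Qed.

(** For |x| <= 1 the density is at most exp(l (u + x^2 / 2)), whose square times
    exp(- l x^2) is the constant exp(2 u l). *)
Lemma core_integral_le :
  (\int[leb]_(x in @core R) ((fine (f (x * sigma)%R) ^+ 2)%:E * (expR (- (l * x ^+ 2)))%:E)
     <= (expR (2 * u * l) * (2 * 1))%:E)%E.
Proof.
apply: ae_le_integral_bounded.
- exact: measurable_core.
- by move=> x; rewrite /core/= in_itv/= ler_norml.
- exact: ler01.
- exact: expR_ge0.
- apply: emeasurable_funM; last exact: measurable_gauss_factor.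
  apply/measurable_EFinP; apply: measurable_funX.
  by apply: measurableT_comp => //; exact: measurable_rescaled.
- by move=> x; rewrite mule_ge0// lee_fin ?sqr_ge0 ?expR_ge0.
apply: (ae_off_null measurable_upper upper0) => x /= /negP.
rewrite -ltNge => fx x1.
have x21 : x ^+ 2 <= 1 by rewrite -real_normK ?num_real// expr_le1.
rewrite (min_idPl x21) in fx.
have fx' : fine (f (x * sigma)) <= expR (l * (u + x ^+ 2 / 2)).
  have -> : u + x ^+ 2 / 2 = u + x ^+ 2 - x ^+ 2 / 2 by field.
  by move: fx; have := f0 (x * sigma);
    case: (f (x * sigma)) => [z| |]//= _; rewrite lte_fin => /ltW.
rewrite -EFinM lee_fin.
have -> : expR (2 * u * l) = expR (l * (u + x ^+ 2 / 2)) ^+ 2 * expR (- (l * x ^+ 2)).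
  by rewrite -expRM_natl -expRD; congr expR; field.
by rewrite ler_wpM2r ?expR_ge0// lerXn2r ?nnegrE ?expR_ge0 ?fine_ge0.
Qed.

(** For |x| >= 1 the truncated square is 1, and the density times exp(- l x^2) is
    at most exp(l (u - 1/2)). *)
Lemma middle_integral_le M : 1 <= M ->
  (\int[leb]_(x in middle M) (f (x * sigma)%R * (expR (- (l * x ^+ 2)))%:E)
     <= (expR ((u - 2^-1) * l) * (2 * M))%:E)%E.
Proof.
move=> M1; apply: ae_le_integral_bounded.
- exact: measurable_middle.
- by move=> x; rewrite /middle/= in_itv/= => -[_ xM]; rewrite -ler_norml ltW.
- exact: le_trans M1.
- exact: expR_ge0.
- exact: measurable_rescaled_integrand.
- exact: rescaled_integrand_ge0.
apply: (ae_off_null measurable_upper upper0) => x /= /negP.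
rewrite -ltNge => fx [x1 _].
have x21 : 1 <= x ^+ 2 by rewrite -real_normK ?num_real// expr_ge1// ltW.
rewrite (min_idPr x21) in fx.
apply: (@le_trans _ _ ((expR (l * (u + x ^+ 2 - 1 / 2)))%:E * (expR (- (l * x ^+ 2)))%:E)%E).
  by rewrite lee_wpmul2r ?lee_fin ?expR_ge0// ltW.
rewrite -EFinM -expRD lee_fin ler_expR le_eqVlt; apply/orP; left; apply/eqP.
by field.
Qed.

(** This is the normalising constant of the normal law with variance
    1 / (2 lam). *)
Lemma integral_gauss_factor (lam : R) : 0 < lam ->
  (\int[leb]_x (expR (- (lam * x ^+ 2)))%:E = (Num.sqrt (pi / lam))%:E)%E.
Proof.
move=> lam0; pose s := (Num.sqrt (2 * lam))^-1.
have s20 : s ^+ 2 = (2 * lam)^-1 by rewrite exprVn sqr_sqrtr// mulr_ge0// ltW.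
have sn0 : s != 0 by rewrite invr_eq0 gt_eqF// sqrtr_gt0 mulr_gt0.
have p0 := normal_peak_gt0 sn0.
have mn : measurable_fun setT (EFin \o normal_fun 0 s).
  by apply/measurable_EFinP; exact: measurable_normal_fun.
have := integral_normal_pdf 0 s.
rewrite normal_pdfE//.
under eq_integral do rewrite EFinM.
rewrite ge0_integralZl//; last 2 first.
- by move=> x _; rewrite lee_fin normal_fun_ge0.
- by rewrite lee_fin ltW.
move=> e.
have -> : (\int[leb]_x (expR (- (lam * x ^+ 2)))%:E = \int[leb]_x (normal_fun 0 s x)%:E)%E.
  apply: eq_integral => x _; rewrite /normal_fun subr0; congr (expR _)%:E.
  rewrite -mulr_natr s20 mulNr; congr (- _); field.
  by rewrite gt_eqF.
have -> : Num.sqrt (pi / lam) = (normal_peak s)^-1.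
  rewrite /normal_peak invrK -mulr_natr s20; congr Num.sqrt; field.
  by rewrite gt_eqF.
have : ((normal_peak s)^-1%:E * ((normal_peak s)%:E * \int[leb]_x (normal_fun 0 s x)%:E) =
   (normal_peak s)^-1%:E * 1)%E by rewrite e.
by rewrite muleA -EFinM mulVf ?gt_eqF// mul1e mule1.
Qed.

Lemma far_integral_le_decay (M lam : R) : 0 < lam ->
  leb [set x : R | M <= `|x| /\
     ((expR (l * (u - 2^-1 + x ^+ 2) - lam * x ^+ 2))%:E <= f (x * sigma)%R)%E] = 0%E ->
  (\int[leb]_(x in far M) (f (x * sigma)%R * (expR (- (l * x ^+ 2)))%:E)
     <= (expR ((u - 2^-1) * l) * Num.sqrt (pi / lam))%:E)%E.
Proof.
move=> lam0 dec0.
set N := [set x | _] in dec0.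
have mN : measurable N.
  apply: measurableI; first exact: measurable_far.
  apply: measurable_level => //; apply: measurable_funB.
    apply: measurable_funM => //; apply: measurable_funD; first exact: measurable_cst.
    exact: measurable_funX.
  by apply: measurable_funM => //; exact: measurable_funX.
have mg : measurable_fun setT (fun x : R => (expR (- (lam * x ^+ 2)))%:E).
  apply/measurable_EFinP; apply: measurableT_comp; first exact: measurable_expR.
  by apply: measurable_funN; apply: measurable_funM => //; exact: measurable_funX.
have mfar := measurable_far M.
apply: (@le_trans _ _ (\int[leb]_(x in far M)
   ((expR ((u - 2^-1) * l))%:E * (expR (- (lam * x ^+ 2)))%:E))%E).
  apply: ae_ge0_le_integral => //.
  - by move=> x _; exact: rescaled_integrand_ge0.
  - by apply: measurable_funTS; exact: measurable_rescaled_integrand.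
  - by apply: measurable_funTS; exact: emeasurable_funM.
  apply: (ae_off_null mN dec0) => x /= nN xM.
  have fx : (f (x * sigma)%R <= (expR (l * (u - 2^-1 + x ^+ 2) - lam * x ^+ 2))%:E)%E.
    by rewrite leNgt; apply/negP => /ltW h; apply: nN.
  apply: (@le_trans _ _ ((expR (l * (u - 2^-1 + x ^+ 2) - lam * x ^+ 2))%:E *
      (expR (- (l * x ^+ 2)))%:E)%E).
    by rewrite lee_wpmul2r ?lee_fin ?expR_ge0.
  rewrite -!EFinM -!expRD lee_fin ler_expR le_eqVlt; apply/orP; left; apply/eqP.
  by ring.
rewrite ge0_integralZl//; last by apply: measurable_funTS.
rewrite EFinM lee_wpmul2l ?lee_fin ?expR_ge0//.
rewrite -integral_gauss_factor//; apply: ge0_subset_integral => //.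
Qed.

(** The rescaled integral is, up to its constant, the mass of a subset under a
    probability. *)
Lemma far_integral_le_mass (M : R) (nu : probability RT R) :
  0 < sigma -> sigma ^+ 2 = 2 * l -> is_density (P0 R) nu f ->
  (\int[leb]_(x in far M) (f (x * sigma)%R * (expR (- (l * x ^+ 2)))%:E)
     <= ((sigma * peak)^-1)%:E)%E.
Proof.
move=> s0 s2 [_ _ nuE].
have sp0 : 0 < sigma * peak by rewrite mulr_gt0// normal_peak1_gt0.
have mfar := measurable_far M.
have := P0_rescaled s0 s2 mfar mf f0.
set I := (\int[leb]_(x in far M) _)%E => e.
have h : ((sigma * peak)%:E * I <= 1)%E.
  rewrite -e -(probability_setT nu) nuE//; apply: ge0_le_integral => //.
  - by move=> y _; rewrite mule_ge0// lee_fin.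
  - apply: emeasurable_funM => //; apply/measurable_EFinP.
    apply: (@measurableT_comp _ _ _ _ _ _ (\1_(far M) : R -> R) _ (fun y : R => y / sigma)).
      exact: measurable_indic.
    exact: mulrr_measurable.
  - move=> y _; rewrite indicE; case: (_ \in _); rewrite ?mule1// mule0.
    exact: f0.
have -> : I = ((sigma * peak)^-1%:E * ((sigma * peak)%:E * I))%E.
  by rewrite muleA -EFinM mulVf ?gt_eqF// mul1e.
rewrite -[leRHS]mule1 lee_wpmul2l// lee_fin invr_ge0 ltW//.
Qed.

End region_bounds.

Section far_comparison.
Context (R : realType).
Local Notation leb := (@lebesgue_measure R).

(** Two densities with nearly the same logarithmic growth rate alpha are compared
    pointwise: on the far region alpha(x) - x^2 - delta <= u - 1/2, thus
    increasing the parameter from l' to l multiplies the integrand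
    exp(l (alpha(x) - x^2)) by at most exp((l - l') (u - 1/2)), up to
    exp(2 delta l).  The integral for the fixed parameter l' is finite, which
    makes up for the missing decay at infinity. *)
Lemma far_integral_compare (f f' : R -> \bar R) (sigma sigma' l l' u delta M : R)
    (alpha : R -> R) :
  measurable_fun setT f -> (forall x, (0 <= f x)%E) ->
  measurable_fun setT f' -> (forall x, (0 <= f' x)%E) ->
  1 <= M -> 0 < l' -> l' <= l ->
  (forall x, M <= `|x| -> (f (x * sigma)%R <= (expR (l * (alpha x + delta)))%:E)%E) ->
  (forall x, M <= `|x| -> ((expR (l' * (alpha x - delta)))%:E <= f' (x * sigma')%R)%E) ->
  leb [set x : R | ((expR (l' * (u + x ^+ 2 - Num.min (x ^+ 2) 1 / 2)))%:E <=
      f' (x * sigma')%R)%E] = 0%E ->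
  (\int[leb]_(x in far M) (f (x * sigma)%R * (expR (- (l * x ^+ 2)))%:E) <=
   (expR ((l - l') * (u - 2^-1) + 2 * delta * l))%:E *
   \int[leb]_(x in far M) (f' (x * sigma')%R * (expR (- (l' * x ^+ 2)))%:E))%E.
Proof.
move=> mf f0 mf' f'0 M1 l'0 ll hf hf' up0.
have mN : measurable [set x : R | ((expR (l' * (u + x ^+ 2 - Num.min (x ^+ 2) 1 / 2)))%:E <=
      f' (x * sigma')%R)%E].
  apply: measurable_level => //; apply: measurable_funM => //.
  apply: measurable_funB.
    by apply: measurable_funD => //; exact: measurable_funX.
  by apply: measurable_funM => //; exact: measurable_min_sqr.
have mfar := measurable_far M.
rewrite -ge0_integralZl//; last 2 first.
- by apply: measurable_funTS; exact: measurable_rescaled_integrand.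
- by move=> x _; exact: rescaled_integrand_ge0.
apply: ae_ge0_le_integral => //.
- by move=> x _; exact: rescaled_integrand_ge0.
- by apply: measurable_funTS; exact: measurable_rescaled_integrand.
- by move=> x _; rewrite mule_ge0 ?rescaled_integrand_ge0// lee_fin expR_ge0.
- apply: measurable_funTS; apply: emeasurable_funM => //.
  exact: measurable_rescaled_integrand.
apply: (ae_off_null mN up0) => x /= /negP; rewrite -ltNge => ux xM.
have x21 : 1 <= x ^+ 2.
  by rewrite -real_normK ?num_real// expr_ge1//; exact: le_trans xM.
rewrite (min_idPr x21) in ux.
set a := alpha x in hf hf'.
have h1 := hf _ xM; have h2 := hf' _ xM.
have a1 : a - delta - x ^+ 2 <= u - 2^-1.
  have := le_lt_trans h2 ux; rewrite lte_fin ltr_expR ltr_pM2l// -/a.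
  lra.
apply: (@le_trans _ _ ((expR (l * (a + delta)))%:E * (expR (- (l * x ^+ 2)))%:E)%E).
  by rewrite lee_wpmul2r ?lee_fin ?expR_ge0.
apply: (@le_trans _ _ ((expR ((l - l') * (u - 2^-1) + 2 * delta * l))%:E *
   ((expR (l' * (a - delta)))%:E * (expR (- (l' * x ^+ 2)))%:E))%E); last first.
  by rewrite lee_wpmul2l ?lee_fin ?expR_ge0// lee_wpmul2r ?lee_fin ?expR_ge0.
rewrite -!EFinM -!expRD lee_fin ler_expR.
have : (l - l') * (a - delta - x ^+ 2) <= (l - l') * (u - 2^-1).
  by rewrite ler_wpM2l// subr_ge0.
lra.
Qed.

End far_comparison.
(** * Undetectability above the threshold *)

Section lower_bound.
Context (R : realType).
Local Notation RT := (measurableTypeR R).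
Local Notation leb := (@lebesgue_measure R).
Local Notation peak := (normal_peak (1 : R)).

Lemma ln_dominated (kappa K : R) : 0 < kappa ->
  \forall n \near \oo, K * ln (n%:R : R) <= expR (kappa * ln (n%:R : R)).
Proof.
move=> k0; near=> n.
have L0 : 0 <= ln (n%:R : R) by near: n; exact: ln_nat_large.
have big : K * (2 / kappa) <= expR (kappa / 2 * ln (n%:R : R)).
  by near: n; apply: expR_ln_large; rewrite divr_gt0.
move: (ln _) L0 big => L L0 big.
have k20 : 0 <= kappa / 2 * L by rewrite mulr_ge0// divr_ge0// ltW.
have h : kappa / 2 * L <= expR (kappa / 2 * L).
  by apply: le_trans (expR_ge1Dx _); rewrite lerDr.
have -> : expR (kappa * L) = expR (kappa / 2 * L) * expR (kappa / 2 * L).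
  by rewrite -expRD; congr expR; field.
apply: (@le_trans _ _ (expR (kappa / 2 * L) * (kappa / 2 * L))); last first.
  by rewrite ler_wpM2l// expR_ge0.
have -> : K * L = K * (2 / kappa) * (kappa / 2 * L) by field; rewrite gt_eqF.
by rewrite ler_wpM2r.
Unshelve. all: by end_near. Qed.

Lemma lne_close_bounds (l a d : R) (z : \bar R) : 0 < l -> (0 <= z)%E ->
  (`|lne z / l%:E - a%:E| <= d%:E)%E ->
  (z <= (expR (l * (a + d)))%:E)%E /\ ((expR (l * (a - d)))%:E <= z)%E.
Proof.
move=> l0; have l1 : 0 < l^-1 by rewrite invr_gt0.
rewrite inver gt_eqF//; case: z => [z| |]//=; rewrite ?lee_fin => z0; last first.
  by rewrite gt0_mulye ?lte_fin// addye// leye_eq.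
have [->|z1] := eqVneq z 0.
  by rewrite lexx gt0_mulNye ?lte_fin// addNye leye_eq.
have {z0 z1}z0 : 0 < z by rewrite lt_neqAle eq_sym z1.
rewrite [(z <= 0)]leNgt z0/= lee_fin ler_norml => /andP[h1 h2].
have lz : l * (ln z / l) = ln z by field; rewrite gt_eqF.
split; rewrite -{1}(lnK (x := z)) ?posrE// ler_expR.
  by rewrite -[leLHS]lz ler_pM2l//; lra.
by rewrite -[leRHS]lz ler_pM2l//; lra.
Qed.

(** Collects the exponents of n in n times the Hellinger bound; each of the
    three regions contributes at most n^(- (beta - bs) / 2). *)
Lemma hellinger_rate (L sigma M K bs beta delta e u : R) :
  1 <= L -> 0 < sigma -> sigma ^+ 2 = 2 * L -> 0 <= M -> 0 <= K ->
  0 < beta - bs -> delta = (beta - bs) / 8 ->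
  e = expR (- beta * L) -> u = bs + delta - 2^-1 ->
  expR L * (e ^+ 2 + sigma * peak * (e ^+ 2 * (expR (2 * u * L) * (2 * 1)) +
     e * (expR ((u - 2^-1) * L) * (2 * M)) + e * (K * expR ((bs + 3 * delta - 1) * L)))) <=
  expR ((1 - 2 * beta) * L) + 2 * (2 + 2 * M + K) * L * expR (- ((beta - bs) / 2) * L).
Proof.
move=> L1 s0 s2 M0 K0 g0 dE eE uE.
have L0 : 0 <= L by exact: le_trans ler01 L1.
have sL : sigma * peak <= 2 * L.
  have p1 := normal_peak1_lt1 R.
  have : sigma <= 2 * L.
    rewrite -(@ler_pXn2r _ 2) ?nnegrE ?mulr_ge0 ?(ltW s0)// s2.
    by have := L1; nra.
  by apply: le_trans; rewrite ler_piMr// ltW.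
set G := expR (- ((beta - bs) / 2) * L).
have G0 : 0 <= G by exact: expR_ge0.
have ee : expR L * e ^+ 2 = expR ((1 - 2 * beta) * L).
  by rewrite eE -expRM_natl -expRD; congr expR; ring.
have x1 : expR L * (e ^+ 2 * (expR (2 * u * L) * (2 * 1))) <= 2 * G.
  rewrite mulrA ee mulrA -expRD mulr1 mulrC ler_pM2l// ler_expR -mulrDl ler_wpM2r//.
  by rewrite uE dE; move: g0; lra.
have x2 : expR L * (e * (expR ((u - 2^-1) * L) * (2 * M))) <= 2 * M * G.
  have -> : expR L * (e * (expR ((u - 2^-1) * L) * (2 * M))) =
    2 * M * (expR L * e * expR ((u - 2^-1) * L)) by ring.
  rewrite ler_wpM2l ?mulr_ge0// eE -!expRD ler_expR.
  rewrite -[X in X + _ + _]mul1r -!mulrDl ler_wpM2r//.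
  by rewrite uE dE; move: g0; lra.
have x3 : expR L * (e * (K * expR ((bs + 3 * delta - 1) * L))) <= K * G.
  have -> : expR L * (e * (K * expR ((bs + 3 * delta - 1) * L))) =
    K * (expR L * e * expR ((bs + 3 * delta - 1) * L)) by ring.
  rewrite ler_wpM2l// eE -!expRD ler_expR.
  rewrite -[X in X + _ + _]mul1r -!mulrDl ler_wpM2r//.
  by rewrite dE; move: g0; lra.
rewrite mulrDr ee lerD2l mulrCA.
rewrite [X in _ * X <= _]mulrDr [X in _ * (X + _) <= _]mulrDr.
have -> : 2 * (2 + 2 * M + K) * L * G = 2 * L * (2 * G + 2 * M * G + K * G) by ring.
apply: ler_pM => //.
- by rewrite mulr_ge0 ?normal_peak_ge0 ?(ltW s0).
- by rewrite eE !addr_ge0// !mulr_ge0 ?expR_ge0 ?exprn_ge0 ?expR_ge0.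
- exact: lerD (lerD x1 x2) x3.
Qed.

Lemma cvge_of_squeeze (c : R) (w : nat -> \bar R) :
  (forall e : R, 0 < e -> \forall n \near \oo, ((c - e)%:E <= w n <= (c + e)%:E)%E) ->
  w n @[n --> \oo] --> c%:E.
Proof.
move=> H; apply/fine_cvgP; split.
  have := H 1 ltr01; apply: filterS => n /andP[h1 h2].
  by rewrite fin_numElt (lt_le_trans _ h1) ?ltNyr// (le_lt_trans h2) ?ltry.
apply/cvgrPdist_le => e e0; have := H e e0; apply: filterS => n /andP[h1 h2] /=.
have wf : w n \is a fin_num.
  by rewrite fin_numElt (lt_le_trans _ h1) ?ltNyr// (le_lt_trans h2) ?ltry.
move: h1 h2; rewrite -(fineK wf) !lee_fin ler_norml /= => h1 h2.
by apply/andP; split; lra.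
Qed.

Variables (mu : nat -> probability RT R) (f : nat -> R -> \bar R).
Hypothesis hf : forall n, is_density (P0 R) (mu n) (f n).
Variable bstar : R.
Hypothesis hsup : forall delta : R, 0 < delta ->
  exists N1 : nat, forall n : nat, (N1 <= n)%N ->
  (leb [set x : R |
     (bstar + delta - 2^-1)%:E <=
       h_tilde f n x / (ln n%:R)%:E - (x ^+ 2)%:E
       + (Num.min (x ^+ 2) 1 / 2)%:E] = 0)%E.

Let sig n := Num.sqrt (2 * ln (n%:R : R)).

Let upper_null (delta : R) : 0 < delta -> \forall n \near \oo,
  leb [set x : R | ((expR (ln n%:R * ((bstar + delta - 2^-1) + x ^+ 2 -
     Num.min (x ^+ 2) 1 / 2)))%:E <= f n (x * sig n)%R)%E] = 0%E.
Proof.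
move=> d0; have [N HN] := hsup d0; near=> n.
rewrite -(level_set_h_tilde hf); last first.
  by apply: (lt_le_trans ltr01); near: n; exact: ln_nat_large.
by apply: HN; near: n; exact: nbhs_infty_ge.
Unshelve. all: by end_near. Qed.

(** The common consequence of the two alternative hypotheses on large |x|. *)
Definition far_negligible (M : R) := forall delta : R, 0 < delta ->
  exists2 K : R, 0 <= K & \forall n \near \oo,
    (\int[leb]_(x in far M) (f n (x * sig n)%R * (expR (- (ln n%:R * x ^+ 2)))%:E)
     <= (K * expR ((bstar + 3 * delta - 1) * ln n%:R))%:E)%E.

(** Fix one large index N and compare all later indices with it. *)
Lemma far_negligible_uniform (M : R) (alpha : R -> R) : 1 <= M ->
  ereal_sup [set `|h_tilde f n x / (ln n%:R)%:E - (alpha x)%:E|%E |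
                     x in [set x : R | M <= `|x|]] @[n --> \oo] --> 0%E ->
  far_negligible M.
Proof.
move=> M1 hA delta d0.
have close : \forall n \near \oo, forall x, M <= `|x| ->
    (`|h_tilde f n x / (ln n%:R)%:E - (alpha x)%:E| <= delta%:E)%E.
  have : \forall n \near \oo, (ereal_sup [set `|h_tilde f n x / (ln n%:R)%:E -
      (alpha x)%:E|%E | x in [set x : R | (M <= `|x|)%R]] < delta%:E)%E.
    move/fine_cvgP : hA => [hfin /cvgr_lt /(_ _ d0) hlt].
    by apply: filterS2 hfin hlt => n nfin; rewrite -{1}(fineK nfin) lte_fin.
  apply: filterS => n supn x xM; apply: le_trans (ltW supn).
  by apply: ereal_sup_ubound; exists x.
have L1 : \forall n \near \oo, 1 <= ln (n%:R : R) by exact: ln_nat_large.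
have [N _ HN] : \forall n \near \oo, [/\ 1 <= ln (n%:R : R),
   leb [set x : R | ((expR (ln n%:R * ((bstar + delta - 2^-1) + x ^+ 2 -
     Num.min (x ^+ 2) 1 / 2)))%:E <= f n (x * sig n)%R)%E] = 0%E &
   forall x, M <= `|x| ->
    (`|h_tilde f n x / (ln n%:R)%:E - (alpha x)%:E| <= delta%:E)%E].
  near=> n; split; [near: n|near: n|near: n] => //.
  exact: upper_null.
have [LN1 upN clN] := HN N (leqnn N).
have LN0 : 0 < ln (N%:R : R) by exact: lt_le_trans ltr01 LN1.
have sN0 : 0 < sig N by rewrite sqrtr_gt0 mulr_gt0.
have sN2 : sig N ^+ 2 = 2 * ln N%:R by rewrite sqr_sqrtr// mulr_ge0// ltW.
have sp0 : 0 < sig N * peak by rewrite mulr_gt0// normal_peak1_gt0.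
have N0 : (0 < N)%N.
  by rewrite lt0n; apply: contraTneq LN0 => ->; rewrite ln0// ltxx.
exists (expR (- ln N%:R * (bstar + delta - 1)) * (sig N * peak)^-1).
  by rewrite mulr_ge0 ?expR_ge0// invr_ge0 ltW.
exists N => // n /= Nn.
have [Ln1 upn cln] := HN n Nn.
have Ln0 : 0 < ln (n%:R : R) by exact: lt_le_trans ltr01 Ln1.
have LNn : ln (N%:R : R) <= ln (n%:R : R).
  by rewrite ler_ln ?posrE ?ltr0n ?ler_nat// (leq_trans N0).
have [mfn f0n _] := hf n; have [mfN f0N _] := hf N.
have b1 x : M <= `|x| -> (f n (x * sig n)%R <= (expR (ln n%:R * (alpha x + delta)))%:E)%E.
  by move=> xM; have [] := lne_close_bounds Ln0 (f0n (x * sig n)) (cln x xM).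
have b2 x : M <= `|x| -> ((expR (ln N%:R * (alpha x - delta)))%:E <= f N (x * sig N)%R)%E.
  by move=> xM; have [] := lne_close_bounds LN0 (f0N (x * sig N)) (clN x xM).
apply: (le_trans (far_integral_compare mfn f0n mfN f0N M1 LN0 LNn b1 b2 upN)).
apply: (@le_trans _ _ ((expR ((ln n%:R - ln N%:R) * (bstar + delta - 2^-1 - 2^-1) +
   2 * delta * ln n%:R))%:E * ((sig N * peak)^-1)%:E)%E).
  rewrite lee_wpmul2l ?lee_fin ?expR_ge0//.
  exact: far_integral_le_mass sN0 sN2 (hf N).
rewrite -EFinM lee_fin [leRHS]mulrAC -expRD le_eqVlt; apply/orP; left; apply/eqP.
by congr (expR _ * _); field.
Unshelve. all: by end_near. Qed.

(** The factor exp(- lambda_n x^2) makes the integral finite, of order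
    lambda_n^(- 1/2), which is less than every power of n. *)
Lemma far_negligible_decay (M : R) (lambda : nat -> R) :
  (forall n, 0 < lambda n) ->
  (forall kappa : R, 0 < kappa -> lambda n * n%:R `^ kappa @[n --> \oo] --> +oo) ->
  (forall delta : R, 0 < delta ->
         exists N2 : nat, forall n : nat, (N2 <= n)%N ->
         (leb [set x : R | (M <= `|x|)%R /\
            (bstar + delta - 1)%:E <=
              h_tilde f n x / (ln n%:R)%:E
              - ((1 - lambda n / ln n%:R) * x ^+ 2)%:E] = 0)%E) ->
  far_negligible M.
Proof.
move=> lam0 lam_slow hB delta d0; exists 1 => //.
have [N2 HN2] := hB _ d0.
have d20 : 0 < 2 * delta by rewrite mulr_gt0.
have exps : bstar + delta - 2^-1 - 2^-1 + delta <= bstar + 3 * delta - 1 by lra.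
near=> n.
have L1 : 1 <= ln (n%:R : R) by near: n; exact: ln_nat_large.
have n0 : (0 < n)%N by near: n; exact: nbhs_infty_gt.
have up : leb [set x : R | ((expR (ln n%:R * ((bstar + delta - 2^-1) + x ^+ 2 -
     Num.min (x ^+ 2) 1 / 2)))%:E <= f n (x * sig n)%R)%E] = 0%E.
  by near: n; exact: upper_null.
have pl : pi <= lambda n * n%:R `^ (2 * delta).
  by near: n; have /cvgryPge := lam_slow _ d20; exact.
have nN2 : (N2 <= n)%N by near: n; exact: nbhs_infty_ge.
have L0 : 0 < ln (n%:R : R) by exact: lt_le_trans ltr01 L1.
have [mfn f0n _] := hf n.
have := HN2 n nN2.
have -> : [set x : R | (M <= `|x|)%R /\
     ((bstar + delta - 1)%:E <= h_tilde f n x / (ln n%:R)%:E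
              - ((1 - lambda n / ln n%:R) * x ^+ 2)%:E)%E] =
   [set x : R | M <= `|x| /\ ((expR (ln n%:R * ((bstar + delta - 2^-1) - 2^-1 + x ^+ 2) -
      lambda n * x ^+ 2))%:E <= f n (x * sig n)%R)%E].
  have e x : ((bstar + delta - 1)%:E <= h_tilde f n x / (ln n%:R)%:E
              - ((1 - lambda n / ln n%:R) * x ^+ 2)%:E)%E =
     ((expR (ln n%:R * ((bstar + delta - 2^-1) - 2^-1 + x ^+ 2) -
      lambda n * x ^+ 2))%:E <= f n (x * sig n)%R)%E.
    rewrite -[X in (_ <= X)%E]adde0 lne_level_ge//; congr (_ <= _)%E.
    by congr (expR _)%:E; field; rewrite gt_eqF.
  by apply/seteqP; split => x /= [xM]; rewrite e.
move=> dec0.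
apply: (le_trans (far_integral_le_decay mfn f0n (lam0 n) dec0)).
rewrite lee_fin mul1r.
apply: (@le_trans _ _ (expR ((bstar + delta - 2^-1 - 2^-1) * ln n%:R) *
   expR (delta * ln n%:R))).
  rewrite ler_wpM2l ?expR_ge0//.
  rewrite -[leRHS]ger0_norm ?expR_ge0// -sqrtr_sqr ler_wsqrtr//.
  rewrite ler_pdivrMr// mulrC -expRM_natl.
  by move: pl; rewrite /powR gt_eqF ?ltr0n// mulrA.
by rewrite -expRD ler_expR -mulrDl ler_wpM2r// ltW.
Unshelve. all: by end_near. Qed.

(** Above the threshold n times the squared Hellinger distance tends to 0. *)
Lemma no_separation (M beta : R) : 1 <= M -> far_negligible M ->
  2^-1 < beta -> bstar < beta ->
  forall e : R, 0 < e -> \forall n \near \oo, forall phi : n.-tuple RT -> R,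
    is_test phi ->
    ((1 - e)%:E <= error_sum (P0 R) (alternative mu beta n) phi <= (1 + e)%:E)%E.
Proof.
move=> M1 hfar b12 bb e e0.
have beta0 : 0 < beta by apply: lt_trans b12; rewrite invr_gt0.
have M0 : 0 <= M by exact: le_trans ler01 M1.
pose gam := beta - bstar; have g0 : 0 < gam by rewrite subr_gt0.
pose delta := gam / 8; have d0 : 0 < delta by rewrite divr_gt0.
have [K K0 HK] := hfar _ d0.
have b21 : 0 < 2 * beta - 1 by lra.
pose eps := e ^+ 2 / 8; have eps0 : 0 < eps by rewrite divr_gt0// exprn_gt0.
pose C := 2 * (2 + 2 * M + K) / eps.
near=> n.
have n0 : (0 < n)%N by near: n; exact: nbhs_infty_gt.
have L1 : 1 <= ln (n%:R : R) by near: n; exact: ln_nat_large.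
have up : leb [set x : R | ((expR (ln n%:R * ((bstar + delta - 2^-1) + x ^+ 2 -
     Num.min (x ^+ 2) 1 / 2)))%:E <= f n (x * sig n)%R)%E] = 0%E.
  by near: n; exact: upper_null.
have w3 : (\int[leb]_(x in far M) (f n (x * sig n)%R * (expR (- (ln n%:R * x ^+ 2)))%:E)
     <= (K * expR ((bstar + 3 * delta - 1) * ln n%:R))%:E)%E by near: n.
have r1 : expR ((1 - 2 * beta) * ln n%:R) <= eps.
  have : eps^-1 <= expR ((2 * beta - 1) * ln n%:R).
    by near: n; apply: expR_ln_large.
  rewrite -[1 - 2 * beta]opprB mulNr expRN => h.
  by rewrite -[leRHS]invrK lef_pV2 ?posrE ?invr_gt0// expR_gt0.
have r2 : C * ln n%:R <= expR (gam / 2 * ln n%:R).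
  by near: n; apply: ln_dominated; rewrite divr_gt0.
move=> phi tphi.
have L0 : 0 < ln (n%:R : R) by exact: lt_le_trans ltr01 L1.
have s0 : 0 < sig n by rewrite sqrtr_gt0 mulr_gt0.
have s2 : sig n ^+ 2 = 2 * ln n%:R by rewrite sqr_sqrtr// mulr_ge0// ltW.
have [mfn f0n _] := hf n.
have e01 := sparsity_itv n beta0.
have w1 := core_integral_le mfn f0n up.
have w2 := middle_integral_le mfn f0n up M1.
have Hle := hellinger_le_regions s0 s2 e01 mfn f0n w1 w2 w3.
have dens := is_density_fine (hf n).
have QE := alternative_density beta0 dens.
pose q (x : RT) : R := 1 - n%:R `^ (- beta) + n%:R `^ (- beta) * fine (f n x).
have mq : measurable_fun [set: RT] q.
  apply: measurable_funD => //; apply: measurable_funM => //.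
  by apply: measurableT_comp.
have q0 x : 0 <= q x.
  have /andP[a0 a1] := e01.
  by rewrite addr_ge0 ?subr_ge0// mulr_ge0// fine_ge0.
apply: (@error_sum_near1 _ RT R (P0 R) (alternative mu beta n) q n mq q0 QE _ Hle
  phi e tphi e0).
rewrite sparsityE//.
have -> : n%:R = expR (ln n%:R) :> R by rewrite lnK// posrE ltr0n.
rewrite expRK.
apply: (le_trans (hellinger_rate L1 s0 s2 M0 K0 g0 (erefl _) (erefl _) (erefl _))).
rewrite -/gam.
have -> : e ^+ 2 / 4 = eps + eps by rewrite /eps; field.
apply: lerD => //.
rewrite mulNr expRN ler_pdivrMr ?expR_gt0//.
have -> : 2 * (2 + 2 * M + K) * ln n%:R = eps * (C * ln n%:R).
  by rewrite /C; field; rewrite gt_eqF.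
by rewrite ler_pM2l.
Unshelve. all: by end_near. Qed.

End lower_bound.

(** * The detection threshold *)

Section separation.
Context (R : realType).
Local Notation RT := (measurableTypeR R).

(** The likelihood ratio test with threshold 1 is at least as good as any other
    test; in particular it separates as soon as some S_n(s) does. *)
Lemma alternative_lr_test (mu : nat -> probability RT R) (beta : R) (n : nat)
    (f : R -> \bar R) : 0 < beta -> is_density (P0 R) (mu n) f ->
  exists phi : n.-tuple RT -> R,
    [/\ is_lr_test (P0 R) (alternative mu beta n) phi, is_test phi &
     forall psi : n.-tuple RT -> R, is_test psi ->
       (error_sum (P0 R) (alternative mu beta n) phi <=
        error_sum (P0 R) (alternative mu beta n) psi)%E].
Proof.
move=> b0 hf; have [mf f0 _] := hf.
have QE := alternative_density b0 (is_density_fine hf).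
have /andP[e0 e1] := sparsity_itv n b0.
pose q (x : RT) : R := 1 - n%:R `^ (- beta) + n%:R `^ (- beta) * fine (f x).
have mq : measurable_fun [set: RT] q.
  apply: measurable_funD => //; apply: measurable_funM => //.
  by apply: measurableT_comp.
have q0 x : 0 <= q x by rewrite addr_ge0 ?subr_ge0// mulr_ge0// fine_ge0.
exists (\1_[set t : n.-tuple RT | (1 < (\prod_(x <- t) q x)%:E)%E]); split.
- exact: (@is_lr_test_prod _ RT R (P0 R) (alternative mu beta n) q n mq q0 QE).
- exact: (@is_test_lr _ RT R q n mq).
- exact: (@lr_test_optimal _ RT R (P0 R) (alternative mu beta n) q n mq q0 QE).
Qed.

End separation.

Theorem theorem4p5 (R : realType)
    (mu : nat -> probability (measurableTypeR R) R)
    (hmu : forall n, mu n `<< P0 R)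
    (f : nat -> R -> \bar R)
    (hf : forall n, is_density (P0 R) (mu n) (f n))
    (bstar : R)
    (hinf : forall delta : R, 0 < delta ->
      (0 < limn_einf (fun n => lebesgue_measure [set x : R |
         (bstar - delta - 2^-1)%:E <=
           h_tilde f n x / (ln n%:R)%:E - (x ^+ 2)%:E
           + (Num.min (x ^+ 2) 1 / 2)%:E]))%E)
    (hsup : forall delta : R, 0 < delta ->
      exists N1 : nat, forall n : nat, (N1 <= n)%N ->
      (lebesgue_measure [set x : R |
         (bstar + delta - 2^-1)%:E <=
           h_tilde f n x / (ln n%:R)%:E - (x ^+ 2)%:E
           + (Num.min (x ^+ 2) 1 / 2)%:E] = 0)%E)
    (lambda : nat -> R)
    (lambda_gt0 : forall n, 0 < lambda n)
    (lambda_to0 : lambda n @[n --> \oo] --> 0)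
    (lambda_slow : forall kappa : R, 0 < kappa ->
      lambda n * n%:R `^ kappa @[n --> \oo] --> +oo)
    (M : R) (hM : 1 <= M)
    (hAB :
      (exists alpha : R -> R,
         ereal_sup [set `|h_tilde f n x / (ln n%:R)%:E - (alpha x)%:E|%E |
                     x in [set x : R | M <= `|x|]] @[n --> \oo] --> 0%E)
      \/
      (forall delta : R, 0 < delta ->
         exists N2 : nat, forall n : nat, (N2 <= n)%N ->
         (lebesgue_measure [set x : R | (M <= `|x|)%R /\
            (bstar + delta - 1)%:E <=
              h_tilde f n x / (ln n%:R)%:E
              - ((1 - lambda n / ln n%:R) * x ^+ 2)%:E] = 0)%E)) :
  detection_threshold mu bstar /\
  forall beta : R, 2^-1 < beta <= 1 -> beta < bstar ->
  forall s : R, exists c : nat -> R,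
    completely_separates (P0 R) (alternative mu beta)
      (fun n => \1_[set X | ((c n)%:E < S_stat s X)%E]).
Proof.
have far : far_negligible f bstar M.
  case: hAB => [[alpha hA]|hB].
    exact: (far_negligible_uniform hf hsup hM hA).
  exact: (far_negligible_decay hf hsup lambda_gt0 lambda_slow hB).
have S_separates (beta : R) : 2^-1 < beta <= 1 -> beta < bstar -> forall s : R,
    exists c : nat -> R, completely_separates (P0 R) (alternative mu beta)
      (fun n => \1_[set X | ((c n)%:E < S_stat s X)%E]).
  move=> b12 bb s.
  have [g [rho [g0 g1 rho0 tails]]] := level_sets_detectable hf hinf b12 bb.
  have [c Hc] := S_test_separates s g0 g1 rho0 tails.
  have tests n : is_test (\1_[set X : n.-tuple (measurableTypeR R) |
      ((c n)%:E < S_stat s X)%E] : _ -> R) by exact: is_test_S_stat.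
  exists c; split; first exact: tests.
  apply: (@cvge_of_squeeze _ 0) => e e0; have := Hc e e0; apply: filterS => n hn.
  apply/andP; split; last by rewrite add0r.
  apply: le_trans (error_sum_ge0 (P0 R) (alternative mu beta n) (tests n)).
  by rewrite lee_fin sub0r oppr_le0 ltW.
split=> // beta b12; have /andP[beta12 beta1] := b12.
have beta0 : 0 < beta by apply: lt_trans beta12; rewrite invr_gt0.
split=> [bb phi tphi|bb].
  apply: cvge_of_squeeze => e e0.
  have := no_separation hf hsup hM far beta12 bb e0.
  by apply: filterS => n; apply.
have [c [tS cS]] := S_separates beta b12 bb 0.
have [phi Hphi] : {phi : forall n, n.-tuple (measurableTypeR R) -> R &
    forall n, [/\ is_lr_test (P0 R) (alternative mu beta n) (phi n), is_test (phi n) &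
     forall psi : n.-tuple (measurableTypeR R) -> R, is_test psi ->
       (error_sum (P0 R) (alternative mu beta n) (phi n) <=
        error_sum (P0 R) (alternative mu beta n) psi)%E]}.
  exists (fun n => projT1 (cid (alternative_lr_test beta0 (hf n)))) => n.
  by case: cid.
exists phi; split=> [n|]; first by have [] := Hphi n.
split=> [n|]; first by have [] := Hphi n.
apply: squeeze_cvge cS; last exact: cvg_cst.
apply: nearW => n; have [_ tphi opt] := Hphi n.
by rewrite error_sum_ge0//= opt.
Qed.
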